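(* Consider a sequence (indexed by $T$) of change-in-slope models as described in the context, with $m^*\ge1$ and noise variance $\sigma^2$, and the estimator with penalty $\beta=(2+\epsilon)\log T$, where $\epsilon>0$ is an arbitrarily small constant. There are absolute constants $c_3,c_4$ depending only on $\epsilon$ such that if $m^*=o(\log T)$, $\delta_T^3\Delta_T^2\ge c_3\log T$ and $\Delta_T^2\ge c_4\log T/T^2$, then $$\mathbb{P}\Big(\hat m=m^*,\ \max_{j=1,\dots,m^*}|\hat\tau_j-\tau_j^*|^3\Delta_j^2\le c_3\log T\Big)\to1\quad\text{as }T\to\infty.$$
   Context: Change-in-slope model: $x_t=f_t+\varepsilon_t$, $1\le t\le T$, with $\varepsilon_t$ i.i.d. $N(0,\sigma^2)$. There are true changepoints $0=\tau_0^*<\tau_1^*<\dots<\tau_{m^*}^*<\tau^*_{m^*+1}=T$ and real values $\theta^*_0,\dots,\theta^*_{m^*+1}$ such that, for $j=1,\dots,m^*+1$ and $\tau^*_{j-1}+1\le t\le\tau^*_j$, $$f_t=\theta^*_{j-1}+\frac{\theta^*_j-\theta^*_{j-1}}{\tau^*_j-\tau^*_{j-1}}(t-\tau^*_{j-1}).$$ The size of the $j$-th change is $\Delta_j=\Big|\frac{\theta^*_{j+1}-\theta^*_j}{\tau^*_{j+1}-\tau^*_j}-\frac{\theta^*_j-\theta^*_{j-1}}{\tau^*_j-\tau^*_{j-1}}\Big|$, $j=1,\dots,m^*$. Let $\delta_j=\tau_j^*-\tau_{j-1}^*$, $\delta_T=\min_{1\le j\le m^*+1}\delta_j$, $\Delta_T=\min_{1\le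 j\le m^*}\Delta_j$. The number of changepoints $m^*$, the changepoints and the values $\theta_j^*$ (hence $\delta_T$, $\Delta_T$) may depend on $T$. Cost: for $0=\tau_0<\tau_1<\dots<\tau_m<\tau_{m+1}=T$, $$\mathcal{L}(x_{1:T};\tau_{1:m})=\min_{\theta_0,\dots,\theta_{m+1}\in\mathbb{R}}\sum_{j=1}^{m+1}\sum_{t=\tau_{j-1}+1}^{\tau_j}\frac1{\sigma^2}\Big[x_t-\theta_{j-1}-\frac{\theta_j-\theta_{j-1}}{\tau_j-\tau_{j-1}}(t-\tau_{j-1})\Big]^2.$$ The estimate $(\hat m,\hat\tau_{1:\hat m})$ minimises $\mathcal{L}(x_{1:T};\tau_{1:m})+\beta m$ over $m\ge0$ and $\tau_{1:m}$.
   Formalization: The thresholds are c_3σ² log T and c_4σ² log T/T² (also in the error bound), as the claim fails for large σ when the constants depend only on ε; τ_1* > 1 is assumed for large T, as a change at time 1 leaves θ_0 unobserved and cannot be detected. *)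

(* Defs.v *)
From mathcomp Require Import all_boot all_order all_algebra.
From mathcomp Require Import finmap.
From mathcomp Require Import all_classical all_reals all_analysis.

Set Implicit Arguments.
Unset Strict Implicit.
Unset Printing Implicit Defensive.

Import Order.TTheory GRing.Theory Num.Theory.
Import numFieldNormedType.Exports.

Local Open Scope classical_set_scope.
Local Open Scope ring_scope.

(* A set of changepoints tau_1 < ... < tau_m is the list [:: tau_1; ...; tau_m];
   m is its size. *)

(* 0 = tau_0 < tau_1 < ... < tau_m < tau_(m+1) = T *)
Definition is_changepoints (T : nat) (tau : seq nat) : bool :=
  path ltn 0%N (rcons tau T).

(* tau_j with the conventions tau_0 = 0 and tau_(m+1) = T; the latter is
   produced by the default value of nth *)
Definition knot (T : nat) (tau : seq nat) (j : nat) : nat :=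
  nth T (0%N :: tau) j.

Section change_in_slope.
Context {R : realType}.
Implicit Types (tau : seq nat) (theta x : nat -> R).

(* The segments are j = 1, ..., m+1, and segment j is tau_(j-1) < t <= tau_j. *)
Definition slope T tau theta (j : nat) : R :=
  (theta j - theta j.-1) / ((knot T tau j)%:R - (knot T tau j.-1)%:R).

Definition segment_line T tau theta (j t : nat) : R :=
  theta j.-1 + slope T tau theta j * (t%:R - (knot T tau j.-1)%:R).

Definition is_signal T tau theta (f : nat -> R) : Prop :=
  forall j t, (1 <= j <= (size tau).+1)%N ->
    ((knot T tau j.-1).+1 <= t <= knot T tau j)%N ->
    f t = segment_line T tau theta j t.

(* Delta_j, for 1 <= j <= m *)
Definition jump T tau theta (j : nat) : R :=
  `| slope T tau theta j.+1 - slope T tau theta j |.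

(* delta_j, for 1 <= j <= m+1 *)
Definition spacing T tau (j : nat) : nat :=
  (knot T tau j - knot T tau j.-1)%N.

(* In the two minima the unit of the iteration is the first term, so it does
   not affect the value (for min_jump, provided that m >= 1). *)
Definition min_spacing T tau : nat :=
  \big[minn/spacing T tau 1]_(1 <= j < (size tau).+2) spacing T tau j.

Definition min_jump T tau theta : R :=
  \big[Num.min/jump T tau theta 1]_(1 <= j < (size tau).+1) jump T tau theta j.

Definition residual_cost (sigma : R) T x tau theta : R :=
  \sum_(1 <= j < (size tau).+2)
    \sum_((knot T tau j.-1).+1 <= t < (knot T tau j).+1)
      (sigma ^+ 2)^-1 * (x t - segment_line T tau theta j t) ^+ 2.

(* The infimum over theta is attained, as this is a linear least squares
   problem in theta_0, ..., theta_(m+1); it is the minimum. *)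
Definition cost (sigma : R) T x tau : R :=
  inf (range (residual_cost sigma T x tau)).

Definition penalised_cost (sigma beta : R) T x tau : R :=
  cost sigma T x tau + beta * (size tau)%:R.

Definition is_minimiser (sigma beta : R) T x tau : Prop :=
  is_changepoints T tau /\
  forall tau', is_changepoints T tau' ->
    penalised_cost sigma beta T x tau <= penalised_cost sigma beta T x tau'.

(* max_(1 <= j <= m) |tauh_j - tau_j|^3 Delta_j^2, for tauh of the same size m
   as tau; all terms are nonnegative, whence the unit 0 *)
Definition max_error T tau theta (tauh : seq nat) : R :=
  \big[Num.max/0]_(1 <= j < (size tau).+1)
    (`| (knot T tauh j)%:R - (knot T tau j)%:R | ^+ 3 *
     jump T tau theta j ^+ 2).

End change_in_slope.

Section noise.
Context d (Omega : measurableType d) (R : realType) (P : probability Omega R).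

Definition mutually_independent (I : choiceType) (D : set I)
    (X : I -> {RV P >-> R}) : Prop :=
  forall (J : {fset I}) (A : I -> set R),
    [set` J] `<=` D -> (forall i, measurable (A i)) ->
    P (\bigcap_(i in [set` J]) (X i @^-1` A i)) =
    (\prod_(i <- J) P (X i @^-1` A i))%E.

(* eps_1, ..., eps_T are i.i.d. N(0, sigma^2); the second argument of
   normal_prob is the standard deviation *)
Definition iid_normal_noise (sigma : R) (T : nat)
    (eps : nat -> {RV P >-> R}) : Prop :=
  mutually_independent [set t | (1 <= t <= T)%N] eps /\
  forall t, (1 <= t <= T)%N -> forall A : set R, measurable A ->
    distribution P (eps t) A = normal_prob 0 sigma A.

End noise.

(* Main.v *)
Require Import Defs.
From mathcomp Require Import all_boot all_order all_algebra.
From mathcomp Require Import finmap.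
From mathcomp Require Import all_classical all_reals all_analysis.
From mathcomp Require Import measurable_realfun.
From mathcomp Require Import ring lra zify.

Set Implicit Arguments.
Unset Strict Implicit.
Unset Printing Implicit Defensive.

Import Order.TTheory GRing.Theory Num.Theory.
Import numFieldNormedType.Exports.

Local Open Scope classical_set_scope.
Local Open Scope ring_scope.

(** Dividing by sigma, the data are F + z on 1..T, where z is standard normal noise and F is
piecewise linear: its second difference [d2 F] vanishes off the true changepoints, where it
has the size of the jump over sigma. The cost of a list of changepoints is the squared
distance from the data to the functions that are piecewise linear with these knots.
Write L = ln T, m for the true number of changepoints and beta for the penalty (2 + eps) L.
Two comparisons of the minimiser with a competitor prove the theorem.

Every change is found. Suppose that no estimated changepoint is within h of tau_j. Five more
knots, tau_j, tau_j +- h and tau_j +- (h + 1), let the fit subtract a multiple of the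
[wedge] |t - tau_j| minus its mean on that window. The wedge is orthogonal to linear
functions and its squared norm is of order h^3, so that the cost falls by an amount of order
jump^2 h^3, up to noise of order L. Once jump^2 h^3 is a large multiple of L, this exceeds
5 beta, which contradicts minimality ([detect_change], [localise]). So each tau_j has an
estimate within the claimed distance. The estimates of different changepoints differ,
because these distances are small compared with the spacing, and if there are exactly m
estimated changepoints, then these are all of them.

Nothing else is found. If there are k > 0 extra changepoints, then comparison with the truth
gives some u, with knots among the estimated and the true changepoints, such that
k beta <= 1 + 2 <z, u> - |u|^2 ([overfit_pays]). For u in a fixed space of dimension D the
right-hand side exceeds x with probability at most exp (- s x / 2) C^D for any s < 1
([rare_chi_square]), so a union bound over T^k spaces would give (2 + eps / 2) L k and a
contradiction. The m estimates that belong to true changepoints are not at known places,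
though, and a union over their positions as well would cost too much. It is avoided as
follows, with a window around each true changepoint whose half-width 2 d is of the order of
the localisation error; d <= T^(2/3) and m = o (L).

- A window that contains a single estimated knot contributes at most a quadratic form in z
  of bounded mean, whatever the position of the knot ([single_knot_window], a Hardy
  inequality). There are o (L) windows, so by Markov's inequality they contribute o (L).
- A window with n >= 2 estimated knots has to be described with a number of choices of order
  T^(n - 1). Three or more knots among T^(2/3) places are cheap enough, as 2 n / 3 <= n - 1.
  Of two knots, either they are close, or one of them is near the changepoint, or one of them
  is isolated on a scale r of order T^(1/3). In the last case the kink there forces u to be
  large, so that moving this knot to a grid of mesh q, a small multiple of r / m, changes u by
  a small proportion only ([move_knot]); the grid has about T^(1/3) points in the window.
- A knot outside all windows has T possible places.

An atom is one of these choices together with the exponent, its level, of the power of T that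
bounds their number; the total level is at most k ([overfit_bound]). The union over lists of
atoms is a geometric series ([rare_lists]), so that 2 <z, u> - |u|^2 <= (2 + eps / 2) k L outside
an event of small probability ([rare_bad_noise]); this contradicts the lower bound k beta - 1.

The noise enters only through E exp <a, z> = exp (|a|^2 / 2). An event is called [rare] when
its indicator is at most a positive combination of exponentials exp <a, z> of small mean.
Rare events are closed under unions, so that everything above is about deterministic vectors
z, and the probability spaces appear only in [rare_probability] and in the theorem. *)

(** * Vectors indexed by time *)

Section vectors.
Context {R : realType}.
Implicit Types (T : nat) (a b z : nat -> R).

(** A vector is a function on nat; inner products only see its values on 1..T. *)
Definition ip T a b : R := \sum_(1 <= t < T.+1) a t * b t.
Definition nrm2 T a : R := ip T a a.
Definition nrm T a : R := Num.sqrt (nrm2 T a).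

Lemma eq_ip T a a' b b' : (forall t, (1 <= t <= T)%N -> a t = a' t) ->
  (forall t, (1 <= t <= T)%N -> b t = b' t) -> ip T a b = ip T a' b'.
Proof.
by move=> ea eb; apply: eq_big_nat => t ht; rewrite ea // eb.
Qed.

Lemma ipC T a b : ip T a b = ip T b a.
Proof. by apply: eq_bigr => t _; rewrite mulrC. Qed.

Lemma ipDl T a b z : ip T (fun t => a t + b t) z = ip T a z + ip T b z.
Proof. by rewrite -big_split; apply: eq_bigr => t _; rewrite mulrDl. Qed.

Lemma ipDr T a b z : ip T z (fun t => a t + b t) = ip T z a + ip T z b.
Proof. by rewrite ipC ipDl !(ipC T z). Qed.

Lemma ipZl T (c : R) a z : ip T (fun t => c * a t) z = c * ip T a z.
Proof. by rewrite /ip mulr_sumr; apply: eq_bigr => t _; rewrite mulrA. Qed.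

Lemma ipZr T (c : R) a z : ip T z (fun t => c * a t) = c * ip T z a.
Proof. by rewrite ipC ipZl ipC. Qed.

Lemma ip_suml T (I : Type) (r : seq I) (P : pred I) (F : I -> nat -> R) z :
  ip T (fun t => \sum_(i <- r | P i) F i t) z = \sum_(i <- r | P i) ip T (F i) z.
Proof.
rewrite /ip exchange_big; apply: eq_bigr => t _.
by rewrite mulr_suml.
Qed.

Lemma ip_sumr T (I : Type) (r : seq I) (P : pred I) (F : I -> nat -> R) z :
  ip T z (fun t => \sum_(i <- r | P i) F i t) = \sum_(i <- r | P i) ip T z (F i).
Proof. by rewrite ipC ip_suml; apply: eq_bigr => i _; rewrite ipC. Qed.

Lemma nrm2_ge0 T a : 0 <= nrm2 T a.
Proof. by apply: sumr_ge0 => t _; rewrite -expr2 sqr_ge0. Qed.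

Lemma nrm2Z T (c : R) a : nrm2 T (fun t => c * a t) = c ^+ 2 * nrm2 T a.
Proof. by rewrite /nrm2 ipZl ipZr mulrA expr2. Qed.

Lemma nrm2D T a b :
  nrm2 T (fun t => a t + b t) = nrm2 T a + 2 * ip T a b + nrm2 T b.
Proof. by rewrite /nrm2 ipDl !ipDr (ipC T b a); ring. Qed.

Lemma nrm2B T a b :
  nrm2 T (fun t => a t - b t) = nrm2 T a - 2 * ip T a b + nrm2 T b.
Proof.
rewrite /nrm2 /ip mulr_sumr -sumrB -big_split.
by apply: eq_bigr => t _ /=; ring.
Qed.

Lemma nrm2_eq0 T a : nrm2 T a = 0 -> forall t, (1 <= t <= T)%N -> a t = 0.
Proof.
move=> h t ht; apply/eqP; rewrite -sqrf_eq0; apply/eqP.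
have ge i : 0 <= a i * a i by rewrite -expr2 sqr_ge0.
have : \sum_(1 <= t < T.+1 | (fun=> true) t) a t * a t == 0 by rewrite -/(ip T a a) -/(nrm2 T a) h.
rewrite psumr_eq0 // => /allP /(_ t).
by rewrite mem_index_iota ltnS ht => /(_ isT) /=; rewrite -expr2 => /eqP.
Qed.

Lemma ip_delta T c a : (1 <= c <= T)%N -> ip T (fun t => (t == c)%:R) a = a c.
Proof.
move=> hc; rewrite /ip (bigD1_seq c) ?iota_uniq ?mem_index_iota //= eqxx mul1r.
by rewrite big1 ?addr0 // => t /negbTE ->; rewrite mul0r.
Qed.

Lemma nrm_ge0 T a : 0 <= nrm T a. Proof. exact: sqrtr_ge0. Qed.

Lemma sqr_nrm T a : nrm T a ^+ 2 = nrm2 T a.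
Proof. by rewrite sqr_sqrtr // nrm2_ge0. Qed.

Lemma cauchy_schwarz T a b : ip T a b ^+ 2 <= nrm2 T a * nrm2 T b.
Proof.
have [b0|b0] := eqVneq (nrm2 T b) 0.
  have -> : ip T a b = 0.
    rewrite /ip big_nat_cond big1 // => t /andP[ht _].
    by rewrite (nrm2_eq0 b0) ?mulr0 // -ltnS.
  by rewrite expr0n b0 mulr0.
have pb : 0 < nrm2 T b by rewrite lt_def b0 nrm2_ge0.
have := nrm2_ge0 T (fun t => nrm2 T b * a t - ip T a b * b t).
rewrite nrm2B ipZl ipZr !nrm2Z => h.
rewrite -subr_ge0 -(pmulr_rge0 _ pb).
by apply: le_trans h _; rewrite le_eqVlt; apply/orP; left; apply/eqP; ring.
Qed.

Lemma normr_ip T a b : `|ip T a b| <= nrm T a * nrm T b.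
Proof.
rewrite -ler_sqr ?nnegrE ?mulr_ge0 ?nrm_ge0 //.
by rewrite real_normK ?num_real // exprMn !sqr_nrm cauchy_schwarz.
Qed.

Lemma nrmZ T (c : R) a : nrm T (fun t => c * a t) = `|c| * nrm T a.
Proof. by rewrite /nrm nrm2Z sqrtrM ?sqr_ge0 // sqrtr_sqr. Qed.

Lemma nrmD T a b : nrm T (fun t => a t + b t) <= nrm T a + nrm T b.
Proof.
rewrite -ler_sqr ?nnegrE ?addr_ge0 ?nrm_ge0 // sqr_nrm nrm2D sqrrD !sqr_nrm.
have := normr_ip T a b; have := ler_norm (ip T a b); lra.
Qed.

Lemma nrm0 T : nrm T (fun=> 0) = 0.
Proof. by rewrite /nrm /nrm2 /ip big1 ?sqrtr0 // => t _; rewrite mulr0. Qed.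

End vectors.

(** * Rare events *)

Section rare_events.
Context {R : realType}.
Variable T : nat.
Implicit Types (a b z : nat -> R) (c p q x y : R) (E : (nat -> R) -> Prop)
  (f : (nat -> R) -> R) (L : seq (R * (nat -> R))).

Definition expsum L z : R := \sum_(l <- L) l.1 * expR (ip T l.2 z).
(** The expectation of [expsum L] under standard normal noise. *)
Definition expmean L : R := \sum_(l <- L) l.1 * expR (nrm2 T l.2 / 2).

(** A bound on the expectation that makes sense without a probability space, because it is
witnessed by an explicit dominating combination of exponentials. *)
Definition mean_le p f := exists L,
  [/\ {in L, forall l, 0 <= l.1}, expmean L <= p & forall z, f z <= expsum L z].

(** For standard normal noise Markov's inequality turns this into probability at most p. The
witness is kept as data, so that unions are formed by concatenation. *)
Definition rare p E := exists L,
  [/\ {in L, forall l, 0 <= l.1}, expmean L <= p & forall z, E z -> 1 <= expsum L z].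

End rare_events.

Section rare_theory.
Context {R : realType}.
Variable T : nat.
Implicit Types (a b z : nat -> R) (c p q x y : R) (E : (nat -> R) -> Prop)
  (f : (nat -> R) -> R) (L : seq (R * (nat -> R))).

Local Notation mean_le := (@mean_le R T).
Local Notation rare := (@rare R T).

Lemma expsum_ge0 L z : {in L, forall l, 0 <= l.1} -> 0 <= expsum T L z.
Proof.
move=> h; rewrite /expsum big_seq; apply: sumr_ge0 => l lL.
by rewrite mulr_ge0 ?h ?expR_ge0.
Qed.

Lemma mean_le_mono p p' f f' : mean_le p f -> p <= p' ->
  (forall z, f' z <= f z) -> mean_le p' f'.
Proof.
move=> [L [h1 h2 h3]] pp ff; exists L; split=> //; first exact: le_trans pp.
by move=> z; apply: le_trans (h3 z).
Qed.

Lemma mean_le0 : mean_le 0 (fun=> 0).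
Proof. by exists [::]; split=> [l||z]; rewrite ?/expmean ?/expsum ?big_nil ?inE. Qed.

Lemma mean_leD p q f g : mean_le p f -> mean_le q g ->
  mean_le (p + q) (fun z => f z + g z).
Proof.
move=> [L [h1 h2 h3]] [M [k1 k2 k3]]; exists (L ++ M); split.
- by move=> l; rewrite mem_cat => /orP[]; [apply: h1|apply: k1].
- by rewrite /expmean big_cat lerD.
- by move=> z; rewrite /expsum big_cat lerD ?h3 ?k3.
Qed.

Lemma mean_leZ c p f : 0 <= c -> mean_le p f -> mean_le (c * p) (fun z => c * f z).
Proof.
move=> c0 [L [h1 h2 h3]]; exists [seq (c * l.1, l.2) | l <- L]; split.
- by move=> l /mapP[l' lL ->] /=; rewrite mulr_ge0 ?h1.
- rewrite /expmean big_map /=; apply: le_trans (ler_wpM2l c0 h2).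
  by rewrite mulr_sumr ler_sum // => l _; rewrite mulrA.
- move=> z; rewrite /expsum big_map /=; apply: le_trans (ler_wpM2l c0 (h3 z)) _.
  by rewrite mulr_sumr ler_sum // => l _; rewrite mulrA.
Qed.

Lemma mean_le_sum (I : eqType) (r : seq I) (p : I -> R) (f : I -> (nat -> R) -> R) :
  {in r, forall i, mean_le (p i) (f i)} ->
  mean_le (\sum_(i <- r) p i) (fun z => \sum_(i <- r) f i z).
Proof.
elim: r => [|i r IH] h.
  rewrite big_nil; apply: mean_le_mono mean_le0 _ _ => // z.
  by rewrite big_nil.
rewrite big_cons.
have h1 : mean_le (p i) (f i) by apply: h; rewrite mem_head.
have h2 : {in r, forall j, mean_le (p j) (f j)}.
  by move=> j jr; apply: h; rewrite inE jr orbT.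
apply: mean_le_mono (mean_leD h1 (IH h2)) _ _ => // z.
by rewrite big_cons.
Qed.

Lemma mean_le_exp a : mean_le (expR (nrm2 T a / 2)) (fun z => expR (ip T a z)).
Proof.
exists [:: (1, a)]; split.
- by move=> l; rewrite inE => /eqP->.
- by rewrite /expmean big_seq1 mul1r.
- by move=> z; rewrite /expsum big_seq1 mul1r.
Qed.

Lemma rare_mono p q E E' : rare p E -> p <= q -> (forall z, E' z -> E z) ->
  rare q E'.
Proof.
move=> [L [h1 h2 h3]] pq EE; exists L; split=> //; first exact: le_trans pq.
by move=> z /EE /h3.
Qed.

Lemma markov p x f : 0 < x -> mean_le p f -> rare (p / x) (fun z => x <= f z).
Proof.
move=> x0 /(@mean_leZ x^-1 _ _) []; first by rewrite invr_ge0 ltW.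
move=> L [h1 h2 h3]; exists L; split=> //; first by rewrite mulrC.
move=> z h; apply: le_trans (h3 z).
by rewrite mulrC ler_pdivlMr // mul1r.
Qed.

Lemma rareF E : (forall z, ~ E z) -> rare 0 E.
Proof. by move=> h; exists [::]; split=> [l||z /h] //; rewrite /expmean big_nil. Qed.

Lemma rareU p q E E' : rare p E -> rare q E' -> rare (p + q) (fun z => E z \/ E' z).
Proof.
move=> [L [h1 h2 h3]] [M [k1 k2 k3]]; exists (L ++ M); split.
- by move=> l; rewrite mem_cat => /orP[]; [apply: h1|apply: k1].
- by rewrite /expmean big_cat lerD.
- move=> z; rewrite /expsum big_cat /= => -[/h3 h|/k3 h].
    by have := expsum_ge0 z k1; rewrite /expsum in h * => h'; lra.
  by have := expsum_ge0 z h1; rewrite /expsum in h * => h'; lra.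
Qed.

Lemma rare_bigU (I : eqType) (r : seq I) (p : I -> R) (E : I -> (nat -> R) -> Prop) :
  {in r, forall i, rare (p i) (E i)} ->
  rare (\sum_(i <- r) p i) (fun z => exists2 i, i \in r & E i z).
Proof.
elim: r => [|i r IH] h.
  by rewrite big_nil; apply: rareF => z [].
rewrite big_cons.
have h1 : rare (p i) (E i) by apply: h; rewrite mem_head.
have h2 : {in r, forall j, rare (p j) (E j)}.
  by move=> j jr; apply: h; rewrite inE jr orbT.
apply: rare_mono (rareU h1 (IH h2)) _ _ => // z [j].
rewrite inE => /orP[/eqP->|jr] Ej; first by left.
by right; exists j.
Qed.

Lemma sqrN1 : (-1) ^+ 2 = 1 :> R. Proof. by rewrite sqrrN expr1n. Qed.

(** Chernoff's bound: the exponentials at +- x a / |a|, each multiplied by exp (- x^2), have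
mean exp (- x^2 / 2), and one of them is at least 1 on the event. *)
Lemma rare_linear a x : 0 <= x ->
  rare (2 * expR (- (x ^+ 2 / 2))) (fun z => x * nrm T a < `|ip T a z|).
Proof.
move=> x0.
have [n0|n0] := eqVneq (nrm T a) 0.
  apply: (@rare_mono 0 _ (fun=> False)) => [||z].
  - by apply: rareF => z [].
  - by rewrite mulr_ge0 ?expR_ge0.
  - by rewrite n0 mulr0 => /lt_le_trans /(_ (normr_ip _ _ _)); rewrite n0 mul0r ltxx.
have n1 : 0 < nrm T a by rewrite lt_def n0 nrm_ge0.
pose g (s : R) : nat -> R := fun t => s * x / nrm T a * a t.
pose e := expR (- x ^+ 2).
have E1 s : s ^+ 2 = 1 -> mean_le (e * expR (x ^+ 2 / 2)) (fun z => e * expR (ip T (g s) z)).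
  move=> s1; apply: mean_leZ; first exact: expR_ge0.
  apply: mean_le_mono (mean_le_exp _) _ _ => //.
  rewrite ler_expR nrm2Z -sqr_nrm !exprMn s1 exprVn mul1r mulfVK //.
  by rewrite sqrf_eq0.
have E2 := mean_leD (E1 1 (expr1n _ _)) (E1 (-1) (sqrN1)).
apply: rare_mono (markov ltr01 E2) _ _.
  rewrite divr1 -expRD.
  by rewrite le_eqVlt; apply/orP; left; apply/eqP; rewrite (_ : - x ^+ 2 + _ = - (x ^+ 2 / 2)); [ring|field].
move=> z h.
have key s : s * ip T a z = `|ip T a z| -> 1 <= e * expR (ip T (g s) z).
  move=> hs; rewrite -expRD -expR0 ler_expR ipZl.
  have -> : s * x / nrm T a * ip T a z = x * (s * ip T a z) / nrm T a by ring.
  rewrite hs addrC subr_ge0 ler_pdivlMr // expr2 -mulrA ler_wpM2l // ltW //.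
have [ip0|ip0] := leP 0 (ip T a z).
  have := key 1 _; rewrite mul1r ger0_norm // => /(_ erefl) H.
  by apply: le_trans H _; rewrite lerDl mulr_ge0 ?expR_ge0.
have := key (-1) _; rewrite mulN1r ltr0_norm // => /(_ erefl) H.
by apply: le_trans H _; rewrite lerDr mulr_ge0 ?expR_ge0.
Qed.

(** From 1 + y <= exp y at |y| / 2, squared. *)
Lemma sqr_le_exp y : y ^+ 2 <= 4 * (expR y + expR (- y)).
Proof.
have H (u : R) : 0 <= u -> u ^+ 2 <= 4 * expR u.
  move=> u0; have := expR_ge1Dx (u / 2) => h.
  have -> : expR u = expR (u / 2) ^+ 2.
    by rewrite expr2 -expRD; congr expR; field.
  have : (1 + u / 2) ^+ 2 <= expR (u / 2) ^+ 2.
    by rewrite ler_sqr ?nnegrE ?expR_ge0 //; lra.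
  nra.
have [y0|y0] := leP 0 y.
  by apply: le_trans (H _ y0) _; have := expR_ge0 (- y); lra.
have := H (- y); rewrite sqrrN => H1.
by apply: le_trans (H1 _) _; first lra; have := expR_ge0 y; lra.
Qed.

Lemma expR_half_le2 : expR (1 / 2 : R) <= 2.
Proof.
have := expR_ge1Dx (- (1 / 2) : R); rewrite expRN => h.
have e0 := expR_gt0 (1 / 2 : R).
have : (1 / 2) * expR (1/2) <= 1 :> R.
  rewrite -[leRHS](@mulVf _ (expR (1/2))) ?gt_eqF //.
  by rewrite ler_pM2r //; lra.
lra.
Qed.

(** After scaling a to norm 1, [sqr_le_exp] bounds the square by 4 times two exponentials
of mean exp (1 / 2) <= 2 each. *)
Lemma mean_le_sqr a : mean_le (16 * nrm2 T a) (fun z => ip T a z ^+ 2).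
Proof.
have [n0|n0] := eqVneq (nrm2 T a) 0.
  rewrite n0 mulr0; apply: mean_le_mono mean_le0 _ _ => // z.
  by apply: le_trans (cauchy_schwarz _ _ _) _; rewrite n0 mul0r.
have n1 : 0 < nrm2 T a by rewrite lt_def n0 nrm2_ge0.
have n2 : 0 < nrm T a by rewrite sqrtr_gt0.
have e (s : R) : s ^+ 2 = 1 -> mean_le 2 (fun z => expR (ip T (fun t => s / nrm T a * a t) z)).
  move=> s1; apply: mean_le_mono (mean_le_exp _) _ _ => //.
  rewrite nrm2Z exprMn exprVn sqr_nrm s1 mul1r mulVf //.
  exact: expR_half_le2.
have n3 : 0 <= 4 * nrm2 T a by rewrite mulr_ge0 // ltW.
have h := mean_leZ n3 (mean_leD (e 1 (expr1n _ _)) (e (-1) sqrN1)).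
apply: mean_le_mono h _ _; first lra.
move=> z; rewrite !ipZl.
have := sqr_le_exp (ip T a z / nrm T a).
rewrite exprMn exprVn sqr_nrm ler_pdivrMr // => h; apply: le_trans h _.
by rewrite !mulNr !mul1r (mulrC (_^-1) (ip T a z)) le_eqVlt; apply/orP; left; apply/eqP; ring.
Qed.

End rare_theory.

(** * A chi-square tail uniform over a linear space *)

Section chi_square.
Context {R : realType}.
Variable T : nat.
Implicit Types (a b z g : nat -> R) (c p q s x y : R) (es vs : seq (nat -> R)).

Fixpoint orthonormal es : Prop :=
  if es is e :: es' then
    [/\ nrm2 T e = 1, {in es', forall a, ip T e a = 0} & orthonormal es']
  else True.

(** The coefficients are chosen one at a time, which suits induction on the list. Values
outside 1..T are ignored, as they are in [ip]. *)
Fixpoint in_span vs g : Prop :=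
  if vs is v :: vs' then exists c, in_span vs' (fun t => g t - c * v t)
  else forall t, (1 <= t <= T)%N -> g t = 0.

Lemma eq_in_span vs g g' : (forall t, (1 <= t <= T)%N -> g t = g' t) ->
  in_span vs g -> in_span vs g'.
Proof.
elim: vs g g' => [|v vs IH] g g' e /=; first by move=> h t ht; rewrite -e // h.
by move=> [c h]; exists c; apply: IH h => t ht; rewrite e.
Qed.

Lemma in_span0 vs : in_span vs (fun=> 0).
Proof.
elim: vs => [//|v vs IH] /=; exists 0.
by apply: eq_in_span IH => t _; rewrite mul0r subr0.
Qed.

Lemma in_spanD vs g g' c : in_span vs g -> in_span vs g' ->
  in_span vs (fun t => g t + c * g' t).
Proof.
elim: vs g g' => [|v vs IH] g g' /=.
  by move=> h h' t ht; rewrite h ?h' // mulr0 addr0.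
move=> [k h] [k' h']; exists (k + c * k').
by apply: eq_in_span (IH _ _ h h') => t _; ring.
Qed.

Lemma in_span_mem vs v : v \in vs -> in_span vs v.
Proof.
elim: vs => [//|w vs IH]; rewrite inE => /orP[/eqP->|/IH h] /=.
  by exists 1; apply: eq_in_span (in_span0 vs) => t _; rewrite mul1r subrr.
by exists 0; apply: eq_in_span h => t _; rewrite mul0r subr0.
Qed.

Lemma in_span_sum vs (I : eqType) (r : seq I) (F : I -> nat -> R) (C : I -> R) :
  {in r, forall i, in_span vs (F i)} ->
  in_span vs (fun t => \sum_(i <- r) C i * F i t).
Proof.
elim: r => [|i r IH] h.
  by apply: eq_in_span (in_span0 vs) => t _; rewrite big_nil.
have h1 : in_span vs (F i) by apply: h; rewrite mem_head.
have h2 : {in r, forall j, in_span vs (F j)}.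
  by move=> j jr; apply: h; rewrite inE jr orbT.
by apply: eq_in_span (in_spanD (C i) (IH h2) h1) => t _; rewrite big_cons addrC.
Qed.

Lemma proj_orthonormal es v : orthonormal es ->
  {in es, forall a, ip T (fun t => \sum_(e <- es) ip T e v * e t) a = ip T v a}.
Proof.
move=> on a ain; rewrite ip_suml (ipC T v).
under eq_bigr do rewrite ipZl.
elim: es on ain => [//|e es IH] /= [ne oe on]; rewrite inE => /orP[/eqP->|ain].
  rewrite big_cons [ip T e e]ne mulr1 big_seq big1 ?addr0 // => b hb.
  by rewrite [ip T b e]ipC oe ?mulr0.
by rewrite big_cons (oe _ ain) mulr0 add0r IH.
Qed.

(** Gram-Schmidt; vectors that depend on the others are dropped, whence only an inequality
between the sizes. *)
Lemma orthonormal_span vs : exists es, [/\ orthonormal es, (size es <= size vs)%N &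
  forall g, in_span vs g -> in_span es g].
Proof.
elim: vs => [|v vs [es [on sz sp]]]; first by exists [::].
pose w := fun t => v t - \sum_(e <- es) ip T e v * e t.
have ow : {in es, forall a, ip T w a = 0}.
  move=> a ain; rewrite /w.
  have -> : ip T (fun t => v t - \sum_(e <- es) ip T e v * e t) a =
      ip T (fun t => v t + -1 * \sum_(e <- es) ip T e v * e t) a.
    by apply: eq_ip => // t _; rewrite mulN1r.
  by rewrite ipDl ipZl proj_orthonormal // mulN1r subrr.
have spv g : in_span (v :: vs) g -> exists c, in_span es (fun t => g t - c * w t).
  move=> /= [c /sp h]; exists c.
  have k : in_span es (fun t => \sum_(e <- es) ip T e v * e t).
    by apply: (in_span_sum (F := id)) => e; exact: in_span_mem.
  by apply: eq_in_span (in_spanD c h k) => t _; rewrite /w; ring.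
have [w0|w0] := eqVneq (nrm2 T w) 0.
  exists es; split=> //; first exact: leq_trans sz _.
  move=> g /spv [c]; apply: eq_in_span => t ht.
  by rewrite (nrm2_eq0 w0) // mulr0 subr0.
have w1 : nrm T w != 0 by rewrite -sqrf_eq0 sqr_nrm.
exists ((fun t => (nrm T w)^-1 * w t) :: es); split=> //=.
- split=> //; first by rewrite nrm2Z -sqr_nrm -exprMn mulVf ?expr1n.
  by move=> a /ow h; rewrite ipZl h mulr0.
- move=> g /spv [c h]; exists (c * nrm T w).
  by apply: eq_in_span h => t _; rewrite mulrA mulfK.
Qed.

(** The left-hand side is largest when g is the projection of z, where it is the squared norm
of that projection. *)
Lemma dual_norm_span es z g : orthonormal es -> in_span es g ->
  2 * ip T z g - nrm2 T g <= \sum_(e <- es) ip T e z ^+ 2.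
Proof.
elim: es g z => [|e es IH] g z /=.
  move=> _ h; rewrite big_nil /nrm2 /ip mulr_sumr -sumrB big_nat_cond big1 // => t.
  by rewrite ltnS andbT => ht; rewrite h //; ring.
move=> [ne oe on] [c h]; rewrite big_cons.
pose h' := fun t => g t - c * e t.
have eh : ip T e h' = 0.
  rewrite /h' in h *; move: h oe {IH on}; rewrite -/h'; move: h' => h'.
  elim: es h' => [|e' es IH] h' /= h oe.
    by rewrite /ip big_nat_cond big1 // => t; rewrite ltnS andbT => ht; rewrite h // mulr0.
  case: h => k /IH => /(_ _) hk.
  have -> : ip T e h' = ip T e (fun t => (h' t - k * e' t) + k * e' t).
    by apply: eq_ip => // t _; rewrite subrK.
  rewrite ipDr ipZr (oe e') ?mem_head // mulr0 addr0 hk // => a ain.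
  by apply: oe; rewrite inE ain orbT.
have eg : forall t, (1 <= t <= T)%N -> g t = h' t + c * e t by move=> t _; rewrite subrK.
have -> : ip T z g = ip T z h' + c * ip T e z.
  by rewrite (eq_ip (a' := z) (b' := fun t => h' t + c * e t)) // ipDr ipZr (ipC T z e).
have -> : nrm2 T g = nrm2 T h' + c ^+ 2.
  rewrite /nrm2 (eq_ip (a' := fun t => h' t + c * e t) (b' := fun t => h' t + c * e t)) //.
  rewrite -/(nrm2 T (fun t => h' t + c * e t)) nrm2D nrm2Z ne ipZr (ipC T h') eh /nrm2; ring.
have := IH h' z on h.
have := sqr_ge0 (ip T e z - c); rewrite sqrrB; lra.
Qed.

(** The exponential of a square is not a combination of exponentials of linear forms. But with
K = [k%:R - M%:R] the integer part of y = <e, z>, one has y^2 <= 2 K y - K^2 + 1, so that one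
factor exp (s y^2 / 2) is at most a sum over all K of exponentials that are linear in y.
The bound |z| <= M makes this sum finite. The vectors e are treated one by one; as they are
orthonormal, their contributions to the mean multiply. *)
Lemma expR_sum_sqr_rare (s : R) (M : nat) es a c : 0 <= s -> 0 <= c -> orthonormal es ->
  {in es, forall e, ip T e a = 0} ->
  rare T (c * expR (nrm2 T a / 2) *
      (expR (s / 2) * \sum_(k <- iota 0 (M + M).+1)
          expR (- (s * (1 - s) * (k%:R - M%:R) ^+ 2 / 2))) ^+ size es)
    (fun z => [/\ nrm T z <= M%:R &
       1 <= c * expR (ip T a z) * expR (s / 2 * \sum_(e <- es) ip T e z ^+ 2)]).
Proof.
move=> s0; elim: es a c => [|e es IH] a c c0 /=.
  move=> _ _; rewrite expr0 mulr1.
  have := markov ltr01 (mean_leZ c0 (mean_le_exp T a)); rewrite divr1.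
  move=> h; apply: rare_mono h _ _ => // z [_].
  by rewrite big_nil mulr0 expR0 mulr1.
move=> [ne oe on] oa.
pose a' (k : nat) := fun t => a t + s * (k%:R - M%:R) * e t.
pose c' (k : nat) := c * expR (s / 2) * expR (- (s * (k%:R - M%:R) ^+ 2 / 2)).
have H : {in iota 0 (M + M).+1, forall k, rare T
   (c' k * expR (nrm2 T (a' k) / 2) *
      (expR (s / 2) * \sum_(k <- iota 0 (M + M).+1)
          expR (- (s * (1 - s) * (k%:R - M%:R) ^+ 2 / 2))) ^+ size es)
   (fun z => [/\ nrm T z <= M%:R &
       1 <= c' k * expR (ip T (a' k) z) * expR (s / 2 * \sum_(e <- es) ip T e z ^+ 2)])}.
  move=> k _; apply: IH => //.
    by rewrite !mulr_ge0 ?expR_ge0.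
  move=> b bin; rewrite /a' ipDr ipZr oa ?inE ?bin ?orbT //.
  by rewrite (ipC T b) oe // mulr0 addr0.
apply: rare_mono (rare_bigU H) _ _ => [|z [zM h]].
  rewrite -mulr_suml exprS mulrA ler_wpM2r //.
    by rewrite exprn_ge0 // mulr_ge0 ?expR_ge0 // sumr_ge0 // => k _; exact: expR_ge0.
  rewrite !mulr_sumr; apply: ler_sum => k _.
  have -> : nrm2 T (a' k) = nrm2 T a + s ^+ 2 * (k%:R - M%:R) ^+ 2.
    rewrite nrm2D nrm2Z ne ipZr (ipC T a) oa ?mem_head //; ring.
  rewrite /c' -!mulrA ler_wpM2l // -!expRD ler_expR le_eqVlt; apply/orP; left; apply/eqP.
  by field.
have yM : `|ip T e z| <= M%:R.
  apply: le_trans (normr_ip _ _ _) _.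
  have -> : nrm T e = 1 by rewrite /nrm ne sqrtr1.
  by rewrite mul1r.
pose y := ip T e z.
pose k := Num.truncn (y + M%:R).
have yk : (k%:R <= y + M%:R < k.+1%:R).
  apply: truncn_itv; move: yM; rewrite ler_norml => /andP[]; rewrite -/y; lra.
exists k.
  rewrite mem_iota /= add0n ltnS -(ler_nat R).
  by move: yk yM; rewrite ler_norml -/y natrD => /andP[h1 _] /andP[_ h2]; lra.
split=> //; apply: le_trans h _.
rewrite /c' /a' ipDl ipZl big_cons mulrDr -/y.
rewrite -!mulrA ler_wpM2l // -!expRD ler_expR.
have : (y - (k%:R - M%:R)) ^+ 2 <= 1.
  move: yk; rewrite -natr1 => /andP[h1 h2].
  have d0 : 0 <= y - (k%:R - M%:R) by lra.
  have d1 : y - (k%:R - M%:R) <= 1 by lra.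
  nra.
move: (k%:R - M%:R) => K hK.
have : s * (y - K) ^+ 2 <= s * 1 by rewrite ler_wpM2l.
nra.
Qed.

(** By [dual_norm_span] the event says that a sum of squares of at most [size vs] orthonormal
coordinates of z exceeds x; each coordinate costs a factor C. *)
Lemma rare_chi_square (s x C : R) (M : nat) vs : 0 <= s -> 1 <= C ->
  expR (s / 2) * \sum_(k <- iota 0 (M + M).+1)
    expR (- (s * (1 - s) * (k%:R - M%:R) ^+ 2 / 2)) <= C ->
  rare T (expR (- (s * x / 2)) * C ^+ size vs)
    (fun z => nrm T z <= M%:R /\
       exists2 g, in_span vs g & x < 2 * ip T z g - nrm2 T g).
Proof.
move=> s0 C1 hC; have [es [on sz sp]] := orthonormal_span vs.
have := @expR_sum_sqr_rare s M es (fun=> 0) (expR (- (s * x / 2))) s0 (expR_ge0 _) on.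
have i0 b : ip T b (fun=> 0) = 0 by rewrite /ip big1 // => t _; rewrite mulr0.
move=> /(_ (fun e _ => i0 e)); rewrite /nrm2 i0 mul0r expR0 mulr1.
move=> H; apply: rare_mono H _ _.
  rewrite ler_wpM2l ?expR_ge0 //.
  apply: (@le_trans _ _ (C ^+ size es)).
    rewrite lerXn2r // nnegrE ?mulr_ge0 ?expR_ge0 ?sumr_ge0 //.
      by apply: le_trans C1.
  by rewrite ler_weXn2l.
move=> z [zM [g /sp gs h]]; split=> //.
rewrite ipC i0 expR0 mulr1 -expRD -[leLHS]expR0 ler_expR.
have := dual_norm_span z on gs => h'.
have : s * x <= s * \sum_(e <- es) ip T e z ^+ 2.
  by rewrite ler_wpM2l // ltW // (lt_le_trans h).
lra.
Qed.

(** What matters is that the bound does not depend on M, which is a power of T in the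
application. Each half of the sum is at most a geometric series, because i <= i^2. *)
Lemma lattice_gauss_sum (q : R) (M : nat) : 0 < q ->
  \sum_(k <- iota 0 (M + M).+1) expR (- (q * (k%:R - M%:R) ^+ 2)) <= 
  2 * (1 - expR (- q))^-1.
Proof.
move=> q0.
have rho1 : expR (- q) < 1 by rewrite expR_lt1 oppr_lt0.
have rho0 : 0 < expR (- q) by exact: expR_gt0.
have geom n : \sum_(0 <= i < n) expR (- q) ^+ i <= (1 - expR (- q))^-1.
  rewrite -[leRHS]mul1r ler_pdivlMr ?subr_gt0 //.
  suff -> : (\sum_(0 <= i < n) expR (- q) ^+ i) * (1 - expR (- q)) = 1 - expR (- q) ^+ n.
    by rewrite gerBl exprn_ge0 // ltW.
  elim: n => [|n IH]; first by rewrite big_geq // mul0r expr0 subrr.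
  by rewrite big_nat_recr //= mulrDl IH exprS; ring.
have term (i : nat) : expR (- (q * (i%:R) ^+ 2)) <= expR (- q) ^+ i.
  rewrite -expRM_natl ler_expR mulrN lerN2.
  rewrite mulrC ler_pM2l //.
  have [->|i0] := posnP i; first by rewrite expr0n.
  have : 1 <= i%:R :> R by rewrite ler1n.
  nra.
rewrite -addnS iotaD big_cat /= add0n mulr2n mulrDl mul1r; apply: lerD.
  have -> : iota 0 M = index_iota 0 M by rewrite /index_iota subn0.
  rewrite big_nat_rev /= add0n.
  apply: le_trans (geom M.+1); rewrite big_nat_recl //.
  apply: le_trans (_ : \sum_(0 <= i < M) expR (- q) ^+ i.+1 <= _); last first.
    by rewrite lerDr expr0.
  apply: ler_sum_nat => i /andP[_ iM].
  apply: le_trans (term i.+1).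
  rewrite ler_expR lerN2 ler_pM2l // le_eqVlt; apply/orP; left; apply/eqP.
  rewrite -[RHS]sqrrN; congr (_ ^+ 2).
  rewrite natrB ?(leq_trans iM) // -natr1; ring.
rewrite -[M :: _]/(iota M M.+1) -[X in iota X]addn0 iotaDl big_map.
apply: le_trans (geom M.+1); rewrite /index_iota subn0.
apply: ler_sum => i _.
by rewrite natrD addrC addKr; apply: term.
Qed.

End chi_square.

(** * Piecewise linear functions *)

Section splines.
Context {R : realType}.
Implicit Types (T t c h k m n : nat) (K : pred nat) (g f w : nat -> R).

Definition d2 g t : R := g t.+1 - 2 * g t + g t.-1.

Definition spline T K g := forall t, (0 < t < T)%N -> t \notin K -> d2 g t = 0.

(** Truncated subtraction makes this the positive part of t - c. *)
Definition ramp c t : R := (t - c)%N%:R.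

Lemma d2D f g t : d2 (fun t => f t + g t) t = d2 f t + d2 g t.
Proof. by rewrite /d2; ring. Qed.

Lemma d2B f g t : d2 (fun t => f t - g t) t = d2 f t - d2 g t.
Proof. by rewrite /d2; ring. Qed.

Lemma d2Z (c : R) g t : d2 (fun t => c * g t) t = c * d2 g t.
Proof. by rewrite /d2; ring. Qed.

Lemma d2_sum (I : Type) (r : seq I) (F : I -> nat -> R) t :
  d2 (fun t => \sum_(i <- r) F i t) t = \sum_(i <- r) d2 (F i) t.
Proof.
elim: r => [|i r IH]; first by rewrite /d2 !big_nil; ring.
by rewrite big_cons -IH /d2 !big_cons; ring.
Qed.

Lemma d2_ramp c t : (0 < t)%N -> d2 (ramp c) t = (t == c)%:R.
Proof.
case: t => // t _; rewrite /d2 /ramp /=.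
have [tc|tc|tc] := ltngtP t.+1 c.
- have [-> -> ->] : [/\ t.+2 - c = 0, t.+1 - c = 0 & t - c = 0]%N by split; lia.
  by rewrite mulr0 subr0 addr0.
- have [-> ->] : (t.+2 - c = (t - c).+2 /\ t.+1 - c = (t - c).+1)%N by split; lia.
  have f0 : (false%:R : R) = 0 by [].
  by rewrite f0 -!natr1; ring.
- have [-> -> ->] : [/\ t.+2 - c = 1, t.+1 - c = 0 & t - c = 0]%N by split; lia.
  by rewrite mulr0 subr0 addr0.
Qed.

(** Both sides have the same second differences and the same first two values. *)
Lemma ramp_expansion g t :
  g t = g 0%N + (g 1%N - g 0%N) * t%:R + \sum_(1 <= c < t) d2 g c * ramp c t.
Proof.
elim/ltn_ind: t => -[|[|t]] IH.
- by rewrite big_geq // mulr0 !addr0.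
- by rewrite big_geq // mulr1 addr0 addrC subrK.
have := IH t.+1 (ltnSn _); have := IH t (ltnW (ltnSn _)).
have -> : g t.+2 = d2 g t.+1 + 2 * g t.+1 - g t by rewrite /d2 /=; ring.
move=> -> ->.
have E : \sum_(1 <= c < t) d2 g c * ramp c t = \sum_(1 <= c < t.+2) d2 g c * ramp c t.
  have [t0|t0] := posnP t; first by rewrite t0 big_geq // big_nat1 /ramp subn1 mulr0.
  by rewrite [RHS](big_cat_nat (n := t)) ?(leqW (leqnSn _)) //= [X in _ = _ + X]big_nat_cond [X in _ = _ + X]big1 ?addr0 // => c /andP[/andP[tc _] _]; rewrite /ramp (eqP tc) mulr0.
have E1 : \sum_(1 <= c < t.+1) d2 g c * ramp c t.+1 = \sum_(1 <= c < t.+2) d2 g c * ramp c t.+1.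
  by rewrite [RHS]big_nat_recr //= /ramp subnn mulr0 addr0.
rewrite E E1.
have -> : d2 g t.+1 = \sum_(1 <= c < t.+2) d2 g c * (c == t.+1)%:R.
  rewrite big_nat_recr //= eqxx mulr1 big_nat_cond big1 ?add0r // => c /andP[/andP[_ ct] _].
  by rewrite ltn_eqF // mulr0.
rewrite -!natr1.
have -> : \sum_(1 <= c < t.+2) d2 g c * ramp c t.+2 =
  \sum_(1 <= c < t.+2) d2 g c * (c == t.+1)%:R +
  2 * \sum_(1 <= c < t.+2) d2 g c * ramp c t.+1 - \sum_(1 <= c < t.+2) d2 g c * ramp c t.
  rewrite mulr_sumr -big_split -sumrB; apply: eq_bigr => c _ /=.
  have := d2_ramp c (isT : (0 < t.+1)%N); rewrite /d2 /= eq_sym => <-; ring.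
ring.
Qed.

Definition spline_basis (ks : seq nat) : seq (nat -> R) :=
  (fun=> 1) :: (fun t => t%:R) :: [seq ramp k | k <- ks].

Lemma size_spline_basis ks : size (spline_basis ks) = (size ks).+2.
Proof. by rewrite /= size_map. Qed.

(** By [ramp_expansion]: only ramps at knots have a coefficient other than 0. *)
Lemma spline_in_span T ks g : spline T (mem ks) g -> in_span T (spline_basis ks) g.
Proof.
move=> sg; pose vs := spline_basis ks.
have h0 : in_span T vs (fun=> 1) by apply: in_span_mem; rewrite inE eqxx.
have h1 : in_span T vs (fun t => t%:R) by apply: in_span_mem; rewrite !inE eqxx orbT.
pose r := [seq c <- index_iota 1 T | c \in ks].
have h2 : in_span T vs (fun t => \sum_(c <- r) d2 g c * ramp c t).
  apply: (in_span_sum (F := ramp)) => c.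
  rewrite mem_filter => /andP[ck _]; apply: in_span_mem.
  by rewrite !inE map_f ?orbT.
have H := in_spanD 1 (in_spanD (g 0%N) h2 h0) (in_spanD (g 1%N - g 0%N - 1) h1 h1).
apply: eq_in_span H => t /andP[t1 tT].
rewrite [RHS]ramp_expansion.
have -> : \sum_(c <- r) d2 g c * ramp c t = \sum_(1 <= c < t) d2 g c * ramp c t.
  rewrite big_filter [LHS]big_mkcond (big_cat_nat (n := t)) //=.
  rewrite [X in _ + X](_ : _ = 0) ?addr0; last first.
    rewrite big_nat_cond big1 // => c /andP[/andP[tc _] _].
    by rewrite /ramp (eqP tc) mulr0 if_same.
  apply: eq_big_nat => c /andP[c1 ct].
  by case: ifPn => // ck; rewrite sg ?mul0r // c1 (leq_trans ct).
ring.
Qed.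

Lemma affine_of_d2 g a n : (forall i, (a < i < a + n)%N -> d2 g i = 0) ->
  forall i, (i <= n)%N -> g (a + i)%N = g a + (g a.+1 - g a) * i%:R.
Proof.
move=> h; elim/ltn_ind => -[|[|i]] IH hi.
- by rewrite addn0 mulr0 addr0.
- by rewrite addn1 mulr1 addrC subrK.
have h1 := IH i.+1 (ltnSn _) (ltnW hi).
have h0 := IH i (ltnW (ltnSn _)) (ltnW (ltnW hi)).
have : d2 g (a + i.+1) = 0 by apply: h; lia.
rewrite /d2 (_ : (a + i.+1).+1 = a + i.+2)%N; last lia.
rewrite (_ : (a + i.+1).-1 = a + i)%N; last lia.
rewrite h1 h0 -[(i.+2)%:R]natr1 -[(i.+1)%:R]natr1 => e.
lra.
Qed.

End splines.

(** * Kinks and wedges *)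

Section wedge.
Context {R : realType}.
Implicit Types (T t c h k m n : nat) (g f w phi z : nat -> R).

Lemma sum_window T c h phi : (h < c)%N -> (c + h <= T)%N ->
  (forall t, (1 <= t <= T)%N -> ~~ (c - h <= t <= c + h)%N -> phi t = 0) ->
  \sum_(1 <= t < T.+1) phi t =
  phi c + \sum_(1 <= s < h.+1) (phi (c + s)%N + phi (c - s)%N).
Proof.
move=> hc cT h0.
rewrite (big_cat_nat (n := c - h)) /=; [|lia|lia].
rewrite big_nat_cond big1 ?add0r; last by move=> t /andP[ht _]; apply: h0; lia.
rewrite (big_cat_nat (n := (c + h).+1)) /=; [|lia|lia].
rewrite [X in _ + X]big_nat_cond [X in _ + X]big1 ?addr0; last first.
  by move=> t /andP[ht _]; apply: h0; lia.
elim: h hc {cT h0} => [|h IH] hc.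
  by rewrite subn0 addn0 big_nat1 big_geq // addr0.
rewrite big_ltn; last lia.
rewrite (_ : (c - h.+1).+1 = c - h)%N; last lia.
rewrite addnS big_nat_recr /=; last lia.
rewrite IH; last exact: ltnW.
by rewrite [in RHS]big_nat_recr //= addnS; ring.
Qed.

Lemma kink_shape w c h : (0 < h)%N -> (h <= c)%N ->
  (forall t, (c - h < t < c + h)%N -> t != c -> d2 w t = 0) ->
  exists p q, p + q = d2 w c /\
    forall s, (s <= h)%N -> w (c + s)%N = w c + p * s%:R /\ w (c - s)%N = w c + q * s%:R.
Proof.
move=> h0 hc hw.
have right := @affine_of_d2 R w c h (fun i hi => hw i ltac:(lia) ltac:(lia)).
have left := @affine_of_d2 R w (c - h) h (fun i hi => hw i ltac:(lia) ltac:(lia)).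
set B := w (c - h).+1 - w (c - h)%N in left.
have wc : w c = w (c - h)%N + B * h%:R by rewrite -(left h) // subnK.
have ls s : (s <= h)%N -> w (c - s)%N = w c - B * s%:R.
  move=> sh; have := left (h - s)%N (leq_subr _ _).
  rewrite (_ : c - h + (h - s) = c - s)%N; last lia.
  by move=> ->; rewrite wc natrB //; ring.
exists (w c.+1 - w c), (- B); split.
  by rewrite /d2 -subn1 (ls 1%N) // ; ring.
by move=> s sh; rewrite right // ls // mulNr.
Qed.

(** The mean of |s| over s = -h, ..., h. *)
Definition wedge_mean h : R := h%:R * (h%:R + 1) / (2 * h%:R + 1).

Definition wedge c h t : R :=
  if (c - h <= t <= c + h)%N then ((t - c) + (c - t))%N%:R - wedge_mean h else 0.

Lemma wedge_center c h s : (s <= h)%N -> (h <= c)%N ->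
  wedge c h (c + s)%N = s%:R - wedge_mean h /\ wedge c h (c - s)%N = s%:R - wedge_mean h.
Proof.
move=> sh hc; rewrite /wedge.
have [-> ->] : (c - h <= c + s <= c + h /\ c - h <= c - s <= c + h)%N by split; lia.
by split; congr (_%:R - _); lia.
Qed.

Lemma sum_shift (m : R) h : \sum_(1 <= s < h.+1) (s%:R - m) = h%:R * (h%:R + 1) / 2 - m * h%:R.
Proof.
elim: h => [|h IH]; first by rewrite big_geq //; field.
by rewrite big_nat_recr //= IH -natr1; field.
Qed.

Lemma sum_shift_mul (m : R) h : \sum_(1 <= s < h.+1) s%:R * (s%:R - m) =
  h%:R * (h%:R + 1) * (2 * h%:R + 1) / 6 - m * h%:R * (h%:R + 1) / 2.
Proof.
elim: h => [|h IH]; first by rewrite big_geq //; field.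
by rewrite big_nat_recr //= IH -natr1; field.
Qed.

(** On the window w is w c plus p s to the right and q s to the left, with p + q = [d2 w c].
The constant is orthogonal to the wedge; so is the odd part (p - q) s / 2, as the wedge is
even. There remains (p + q) / 2 times |s|, which is the wedge up to a constant. *)
Lemma ip_wedge T c h w : (0 < h < c)%N -> (c + h <= T)%N ->
  (forall t, (c - h < t < c + h)%N -> t != c -> d2 w t = 0) ->
  ip T w (wedge c h) = d2 w c / 2 * nrm2 T (wedge c h).
Proof.
move=> /andP[h0 hc] cT hw.
have [p [q [<- pq]]] := kink_shape h0 (ltnW hc) hw.
have vout t : ~~ (c - h <= t <= c + h)%N -> wedge c h t = 0 by rewrite /wedge => /negbTE ->.
have out2 f t : (1 <= t <= T)%N -> ~~ (c - h <= t <= c + h)%N -> f t * wedge c h t = 0.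
  by move=> _ /vout ->; rewrite mulr0.
rewrite /nrm2 /ip !(@sum_window T c h _ hc cT); try exact: out2.
have vs s := wedge_center (h := h) (c := c) (s := s) ^~ (ltnW hc).
have vc : wedge c h c = - wedge_mean h.
  by have [+ _] := vs 0%N isT; rewrite addn0 => ->; rewrite sub0r.
rewrite vc.
set m := wedge_mean h.
have m1 : m * (2 * h%:R + 1) = h%:R * (h%:R + 1).
  by rewrite /m /wedge_mean mulfVK // gt_eqF // -natrM natr1 ltr0n.
have -> : \sum_(1 <= s < h.+1) (w (c + s)%N * wedge c h (c + s) + w (c - s)%N * wedge c h (c - s)) =
   2 * w c * \sum_(1 <= s < h.+1) (s%:R - m) + (p + q) * \sum_(1 <= s < h.+1) s%:R * (s%:R - m).
  rewrite !mulr_sumr -big_split; apply: eq_big_nat => s /andP[_ sh] /=.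
  have [-> ->] := pq s sh; have [-> ->] := vs s sh; rewrite /m; ring.
have -> : \sum_(1 <= s < h.+1) (wedge c h (c + s) * wedge c h (c + s) +
   wedge c h (c - s) * wedge c h (c - s)) =
   2 * \sum_(1 <= s < h.+1) s%:R * (s%:R - m) - 2 * m * \sum_(1 <= s < h.+1) (s%:R - m).
  rewrite !mulr_sumr -sumrB; apply: eq_big_nat => s /andP[_ sh] /=.
  have [-> ->] := vs s sh; rewrite /m; ring.
rewrite sum_shift.
have -> : h%:R * (h%:R + 1) / 2 - m * h%:R = m / 2 by rewrite -m1; field.
by field.
Qed.

(** The squared norm is h (h + 1) (2 h + 1) / 3 - h^2 (h + 1)^2 / (2 h + 1). *)
Lemma nrm2_wedge_ge T c h : (0 < h < c)%N -> (c + h <= T)%N ->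
  h%:R ^+ 3 / 6 <= nrm2 T (wedge c h).
Proof.
move=> /andP[h0 hc] cT.
have vout t : ~~ (c - h <= t <= c + h)%N -> wedge c h t = 0 by rewrite /wedge => /negbTE ->.
rewrite /nrm2 /ip (@sum_window T c h _ hc cT) //; last by move=> t _ /vout ->; rewrite mulr0.
have vs s := wedge_center (h := h) (c := c) (s := s) ^~ (ltnW hc).
have vc : wedge c h c = - wedge_mean h.
  by have [+ _] := vs 0%N isT; rewrite addn0 => ->; rewrite sub0r.
rewrite vc.
set m := wedge_mean h.
have -> : \sum_(1 <= s < h.+1) (wedge c h (c + s) * wedge c h (c + s) +
   wedge c h (c - s) * wedge c h (c - s)) =
   2 * \sum_(1 <= s < h.+1) s%:R * (s%:R - m) - 2 * m * \sum_(1 <= s < h.+1) (s%:R - m).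
  rewrite !mulr_sumr -sumrB; apply: eq_big_nat => s /andP[_ sh] /=.
  have [-> ->] := vs s sh; rewrite /m; ring.
rewrite sum_shift_mul sum_shift.
have H1 : 1 <= h%:R :> R by rewrite ler1n.
have d0 : 2 * h%:R + 1 != 0 :> R by rewrite gt_eqF //; lra.
have -> : - m * - m + (2 * (h%:R * (h%:R + 1) * (2 * h%:R + 1) / 6 - m * h%:R * (h%:R + 1) / 2) -
   2 * m * (h%:R * (h%:R + 1) / 2 - m * h%:R)) =
   h%:R * (h%:R + 1) * (h%:R ^+ 2 + h%:R + 1) / (3 * (2 * h%:R + 1)).
  rewrite /m /wedge_mean; field.
  by rewrite d0.
rewrite ler_pdivlMr; last lra.
move: H1; move: (h%:R : R) => x x1.
have x2 : 0 <= x ^+ 2 by rewrite sqr_ge0.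
have x3 : 0 <= x ^+ 3 by rewrite exprn_ge0 //; lra.
have -> : x * (x + 1) * (x ^+ 2 + x + 1) =
  x ^+ 3 / 6 * (3 * (2 * x + 1)) + (3 / 2 * x ^+ 3 + 2 * x ^+ 2 + x) by field.
lra.
Qed.

(** Cauchy-Schwarz against the wedge: a kink that is isolated on the scale h forces a squared
norm of order kink^2 h^3. *)
Lemma kink_le_nrm T c h w : (0 < h < c)%N -> (c + h <= T)%N ->
  (forall t, (c - h < t < c + h)%N -> t != c -> d2 w t = 0) ->
  d2 w c ^+ 2 * h%:R ^+ 3 <= 24 * nrm2 T w.
Proof.
move=> hc cT hw.
have E := ip_wedge hc cT hw.
have N := nrm2_wedge_ge hc cT.
have := cauchy_schwarz T w (wedge c h); rewrite E exprMn.
have h0 : 0 < h%:R ^+ 3 :> R by rewrite exprn_gt0 // ltr0n; case/andP: hc.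
have N0 : 0 < nrm2 T (wedge c h) by apply: lt_le_trans N; lra.
rewrite (expr2 (nrm2 T _)) mulrA ler_pM2r // => H.
have : (d2 w c / 2) ^+ 2 * (h%:R ^+ 3 / 6) <= nrm2 T w.
  by apply: le_trans H; rewrite ler_wpM2l ?sqr_ge0.
lra.
Qed.

End wedge.

(** * Changepoints and the least squares cost *)

Section changepoints.
Implicit Types (T t j : nat) (tau ks : seq nat).

Lemma is_changepointsE T tau :
  is_changepoints T tau = [&& (0 < T)%N, all (fun t => 0 < t < T)%N tau & sorted ltn tau].
Proof.
rewrite /is_changepoints path_sortedE; last exact: ltn_trans.
rewrite !(sorted_pairwise ltn_trans) pairwise_rcons all_rcons /= -!andbA; congr andb.
by rewrite !andbA -all_predI.
Qed.

Lemma changepoints_uniq T tau : is_changepoints T tau -> uniq tau.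
Proof. by rewrite is_changepointsE ltn_sorted_uniq_leq => /and4P[]. Qed.

Lemma mem_changepoints T tau t : is_changepoints T tau -> t \in tau -> (0 < t < T)%N.
Proof. by rewrite is_changepointsE => /and3P[_ /allP h _] /h. Qed.

Lemma changepoints_of_list T ks : (0 < T)%N -> exists2 tau, is_changepoints T tau &
  (size tau <= size ks)%N /\ forall t, (t \in tau) = (t \in ks) && (0 < t < T)%N.
Proof.
move=> T0; pose ks' := undup [seq t <- ks | 0 < t < T]%N.
exists (sort leq ks').
  rewrite is_changepointsE T0 ltn_sorted_uniq_leq sort_uniq undup_uniq sort_sorted ?andbT //.
  by apply/allP => t; rewrite mem_sort mem_undup mem_filter => /andP[].
split; first by rewrite size_sort (leq_trans (size_undup _)) // size_filter count_size.
by move=> t; rewrite mem_sort mem_undup mem_filter andbC.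
Qed.

Lemma knot0 T tau : knot T tau 0 = 0%N. Proof. by []. Qed.

Lemma knot_last T tau : knot T tau (size tau).+1 = T.
Proof. by rewrite /knot nth_default. Qed.

Lemma knotE T tau j : (j < size tau)%N -> knot T tau j.+1 = nth 0%N tau j.
Proof. by move=> h; rewrite /knot /= (set_nth_default 0%N). Qed.

Lemma knot_mem T tau j : (1 <= j <= size tau)%N -> knot T tau j \in tau.
Proof. by case: j => // j /= h; rewrite knotE // mem_nth. Qed.

Lemma knot_ltnS T tau j : is_changepoints T tau -> (j <= size tau)%N ->
  (knot T tau j < knot T tau j.+1)%N.
Proof.
rewrite /is_changepoints => /(pathP T) h jt.
have := h j; rewrite size_rcons ltnS => /(_ jt).
have E s i : nth T (rcons s T) i = nth T s i.
  by rewrite nth_rcons; case: ltnP => // h1; rewrite if_same nth_default.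
by rewrite -rcons_cons !E.
Qed.

Lemma knot_lt T tau i j : is_changepoints T tau -> (i < j <= (size tau).+1)%N ->
  (knot T tau i < knot T tau j)%N.
Proof.
move=> cp; elim: j => // j IH /andP[]; rewrite ltnS leq_eqVlt => /orP[/eqP->|ij] js.
  exact: knot_ltnS.
by apply: ltn_trans (IH _) (knot_ltnS cp js); rewrite ij ltnW.
Qed.

Lemma knot_le T tau i j : is_changepoints T tau -> (i <= j <= (size tau).+1)%N ->
  (knot T tau i <= knot T tau j)%N.
Proof.
move=> cp /andP[]; rewrite leq_eqVlt => /orP[/eqP->//|ij] js.
by rewrite ltnW // knot_lt // ij.
Qed.

Lemma mem_knot T tau t : t \in tau -> exists2 j, (1 <= j <= size tau)%N & knot T tau j = t.
Proof.
move=> h; exists (index t tau).+1; first by rewrite /= index_mem.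
by rewrite knotE ?index_mem // nth_index.
Qed.

Lemma knot_notin T tau t j : is_changepoints T tau -> (j <= size tau)%N ->
  (knot T tau j < t < knot T tau j.+1)%N -> t \notin tau.
Proof.
move=> cp js /andP[h1 h2]; apply/negP => /(@mem_knot T) [i /andP[i0 im] it]; subst t.
have [ij|ji] := leqP i j.
  have := @knot_le T tau i j cp; rewrite ij (leq_trans js) //= => /(_ isT); lia.
have := @knot_le T tau j.+1 i cp; rewrite ji (leq_trans im) //= => /(_ isT); lia.
Qed.

Lemma sum_segments (V : nmodType) T tau (phi : nat -> V) : is_changepoints T tau ->
  (\sum_(1 <= j < (size tau).+2) \sum_((knot T tau j.-1).+1 <= t < (knot T tau j).+1) phi t =
  \sum_(1 <= t < T.+1) phi t)%R.
Proof.
move=> cp; rewrite -[in RHS](knot_last T tau).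
have : ((size tau).+1 <= (size tau).+1)%N by [].
elim: {1 3 4}(size tau).+1 => [|n IH] hn; first by rewrite !big_geq.
rewrite big_nat_recr //= IH ?(ltnW hn) //.
by rewrite -big_cat_nat //= ltnS knot_le // leqnSn.
Qed.

End changepoints.

Section cost_spline.
Context {R : realType}.
Implicit Types (T t j : nat) (tau : seq nat) (g theta x f : nat -> R) (sigma : R).

(** The continuous function through the values theta at the knots, written as a sum of ramps so
that its second differences can be read off. *)
Definition interp T tau theta t : R :=
  theta 0%N + slope T tau theta 1 * t%:R +
  \sum_(1 <= j < (size tau).+1)
    (slope T tau theta j.+1 - slope T tau theta j) * ramp (knot T tau j) t.

Lemma d2_interp T tau theta t : (0 < t)%N ->
  d2 (interp T tau theta) t = \sum_(1 <= j < (size tau).+1)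
    (slope T tau theta j.+1 - slope T tau theta j) * (t == knot T tau j)%:R.
Proof.
move=> t0; rewrite /interp d2D d2_sum.
rewrite (_ : d2 _ t = 0) ?add0r; last first.
  by case: t t0 => // t _; rewrite /d2 /= -!natr1; ring.
by apply: eq_bigr => j _; rewrite d2Z d2_ramp.
Qed.

Lemma interp_spline T tau theta : spline T (mem tau) (interp T tau theta).
Proof.
move=> t /andP[t0 tT] tt; rewrite d2_interp // big_nat_cond big1 // => j.
rewrite ltnS andbT => hj; rewrite (_ : t == _ = false) ?mulr0 //.
by apply: contraNF tt => /eqP->; exact: knot_mem.
Qed.

Lemma d2_interp_knot T tau theta j : is_changepoints T tau -> (1 <= j <= size tau)%N ->
  `|d2 (interp T tau theta) (knot T tau j)| = jump T tau theta j.
Proof.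
move=> cp hj; have h0 : (0 < knot T tau j)%N by rewrite -{1}(knot0 T tau) knot_lt //; lia.
rewrite d2_interp //.
rewrite /jump; congr `|_|.
rewrite (bigD1_seq j) ?iota_uniq //=; last by rewrite mem_index_iota ltnS.
rewrite eqxx mulr1 big_nat_cond big1 ?addr0 // => i /andP[hi ij].
rewrite (_ : _ == _ = false) ?mulr0 //.
move: ij; rewrite neq_ltn => /orP[ij|ij].
  by rewrite gtn_eqF // knot_lt //; lia.
by rewrite ltn_eqF // knot_lt //; lia.
Qed.

Lemma slope_mul T tau theta j : is_changepoints T tau -> (1 <= j <= (size tau).+1)%N ->
  slope T tau theta j * ((knot T tau j)%:R - (knot T tau j.-1)%:R) = theta j - theta j.-1.
Proof.
case: j => // j cp hj; rewrite /slope mulfVK // subr_eq0 eqr_nat gtn_eqF //.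
exact: knot_ltnS.
Qed.

Lemma interp_segment T tau theta j t : is_changepoints T tau ->
  (1 <= j <= (size tau).+1)%N -> (knot T tau j.-1 <= t <= knot T tau j)%N ->
  interp T tau theta t = segment_line T tau theta j t.
Proof.
move=> cp hj /andP[t1 t2]; rewrite /interp.
have -> : \sum_(1 <= i < (size tau).+1)
    (slope T tau theta i.+1 - slope T tau theta i) * ramp (knot T tau i) t =
  \sum_(1 <= i < j)
    (slope T tau theta i.+1 - slope T tau theta i) * (t%:R - (knot T tau i)%:R).
  rewrite (big_cat_nat (n := j)) /=; [|lia|lia].
  rewrite [X in _ + X]big_nat_cond [X in _ + X]big1 ?addr0; last first.
    move=> i /andP[/andP[ji im] _]; rewrite /ramp (_ : (t - _)%N = 0%N) ?mulr0 //.
    have := @knot_le T tau j i cp; rewrite ji leqW //= => /(_ isT); lia.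
  apply: eq_big_nat => i /andP[i1 ij]; rewrite /ramp natrB //.
  by apply: leq_trans t1; apply: knot_le => //; lia.
elim: j hj {t1 t2} => // -[|j] IH hj.
  by rewrite big_geq // addr0 /segment_line knot0 subr0.
rewrite big_nat_recr //= addrA IH; last lia.
rewrite /segment_line /=.
have := @slope_mul T tau theta j.+1 cp; rewrite (ltnW hj) => /(_ isT) /= E.
have -> : theta j.+1 = theta j + slope T tau theta j.+1 * ((knot T tau j.+1)%:R - (knot T tau j)%:R).
  by rewrite E addrC subrK.
by ring.
Qed.

(** So theta ranges over the piecewise linear functions, and the cost is a squared distance. *)
Lemma residual_costE sigma T x tau theta : 0 < sigma -> is_changepoints T tau ->
  residual_cost sigma T x tau theta =
  nrm2 T (fun t => x t / sigma - interp T tau theta t / sigma).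
Proof.
move=> s0 cp; rewrite /nrm2 /ip -(sum_segments _ cp); apply: eq_big_nat => j hj.
apply: eq_big_nat => t /andP[t1 t2].
rewrite (@interp_segment T tau theta j) //; last by rewrite ltnW.
by field; rewrite gt_eqF.
Qed.

Lemma spline_segment T tau g j t : is_changepoints T tau -> spline T (mem tau) g ->
  (1 <= j <= (size tau).+1)%N -> (knot T tau j.-1 <= t <= knot T tau j)%N ->
  segment_line T tau (fun j => g (knot T tau j)) j t = g t.
Proof.
case: j => // j cp sg /= hj /andP[t1 t2]; rewrite /segment_line /slope /=.
set a := knot T tau j; set b := knot T tau j.+1.
have ab : (a < b)%N by apply: knot_ltnS.
have bT : (b <= T)%N.
  by rewrite -[leqRHS](knot_last T tau); apply: knot_le => //; lia.
have A := @affine_of_d2 R g a (b - a) _.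
have {}A : forall i, (i <= b - a)%N -> g (a + i)%N = g a + (g a.+1 - g a) * i%:R.
  apply: A => i; rewrite subnKC ?(ltnW ab) // => hi.
  by apply: sg; [lia|apply: knot_notin hi].
have gb := A (b - a)%N (leqnn _); rewrite subnKC ?(ltnW ab) // natrB ?(ltnW ab) // in gb.
have ab0 : b%:R - a%:R != 0 :> R by rewrite subr_eq0 eqr_nat gtn_eqF.
rewrite gb -[in RHS](subnKC t1) A ?leq_sub2r // natrB //.
by field.
Qed.

Lemma has_inf_residual sigma T x tau : 0 < sigma -> is_changepoints T tau ->
  has_inf (range (residual_cost sigma T x tau)).
Proof.
move=> s0 cp; split; first by exists (residual_cost sigma T x tau (fun=> 0)); exists (fun=> 0).
by exists 0 => _ [theta _ <-]; rewrite residual_costE // nrm2_ge0.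
Qed.

Lemma cost_le_spline sigma T x tau g : 0 < sigma -> is_changepoints T tau ->
  spline T (mem tau) g -> cost sigma T x tau <= nrm2 T (fun t => x t / sigma - g t).
Proof.
move=> s0 cp sg; have [_ lb] := has_inf_residual x s0 cp.
pose theta j := sigma * g (knot T tau j).
suff <- : residual_cost sigma T x tau theta = nrm2 T (fun t => x t / sigma - g t).
  by apply: ge_inf => //; exists theta.
rewrite /nrm2 /ip -(sum_segments _ cp); apply: eq_big_nat => j hj.
apply: eq_big_nat => t /andP[t1 t2].
have sg' : spline T (mem tau) (fun t => sigma * g t).
  by move=> i hi it; rewrite d2Z sg ?mulr0.
have := @spline_segment T tau (fun t => sigma * g t) j t cp sg' hj.
rewrite -/(theta) => ->; last by rewrite ltnW.
by field; rewrite gt_eqF.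
Qed.

(** A fit whose squared distance is within 1 of the infimum is enough, because the comparisons
below have a margin of order ln T. *)
Lemma cost_spline sigma T x tau : 0 < sigma -> is_changepoints T tau ->
  exists2 g, spline T (mem tau) g & nrm2 T (fun t => x t / sigma - g t) <= cost sigma T x tau + 1.
Proof.
move=> s0 cp; have [_ [theta _ <-] h] := inf_adherent ltr01 (has_inf_residual x s0 cp).
exists (fun t => sigma^-1 * interp T tau theta t).
  by move=> t ht tt; rewrite d2Z interp_spline ?mulr0.
move: h; rewrite residual_costE // => /ltW; congr (_ <= _).
by apply: eq_ip => t _; rewrite [sigma^-1 * _]mulrC.
Qed.

Lemma signal_spline sigma T tau theta f : 0 < sigma -> is_changepoints T tau ->
  is_signal T tau theta f -> exists F, [/\ spline T (mem tau) F,
    forall t, (1 <= t <= T)%N -> f t / sigma = F t &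
    forall j, (1 <= j <= size tau)%N -> `|d2 F (knot T tau j)| = jump T tau theta j / sigma].
Proof.
move=> s0 cp sf; exists (fun t => sigma^-1 * interp T tau theta t); split.
- by move=> t ht tt; rewrite d2Z interp_spline ?mulr0.
- move=> t ht; rewrite mulrC; congr (_ * _).
  have : exists2 j, (1 <= j <= (size tau).+1)%N & ((knot T tau j.-1).+1 <= t <= knot T tau j)%N.
    have : (0 < t <= knot T tau (size tau).+1)%N by rewrite knot_last.
    elim: (size tau).+1 {1 3}(leqnn (size tau).+1) => [|n IH] hn; first by rewrite knot0; lia.
    have [nt /andP[_ tn]|tn ht'] := ltnP (knot T tau n) t.
      by exists n.+1 => //=; rewrite nt.
    have [|j hj H] := IH (leqnn _); first by case/andP: ht' => ->.
    by exists j => //; lia.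
  move=> [j hj htj]; rewrite (sf j) // (@interp_segment T tau theta j) //.
  by case/andP: htj => /ltnW -> ->.
- move=> j hj; rewrite d2Z normrM d2_interp_knot // mulrC ger0_norm //.
  by rewrite invr_ge0 ltW.
Qed.

End cost_spline.

(** * Exponential moments of the noise *)

Section density_transfer.
Context {R : realType} d1 d2 (X : measurableType d1) (Y : measurableType d2).
Variables (mu : {measure set X -> \bar R}) (nu : {measure set Y -> \bar R}).
Variables (phi : X -> Y) (H : X -> R) (c : R).
Hypotheses (mphi : measurable_fun setT phi) (mH : measurable_fun setT H).
Hypotheses (H0 : forall x, 0 <= H x).
Hypothesis HB : forall B, measurable B ->
  (\int[mu]_x (H x * \1_B (phi x))%:E = c%:E * nu B)%E.

Import HBNNSimple.

(** An identity that holds for indicators of B passes to nonnegative g by monotone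
convergence along simple functions. *)
Lemma integral_transfer (g : Y -> R) : measurable_fun setT g -> (forall y, 0 <= g y) ->
  (\int[mu]_x (H x * g (phi x))%:E = c%:E * \int[nu]_y (g y)%:E)%E.
Proof.
move=> mg g0.
have /measurable_EFinP mg' := mg.
pose f := nnsfun_approx measurableT mg'.
have fg y : (EFin \o f ^~ y @ \oo --> (g y)%:E)%classic.
  by apply: cvg_nnsfun_approx => // z _; rewrite lee_fin.
have mfphi n : measurable_fun setT (fun x => f n (phi x)).
  by apply: measurableT_comp => //; exact: measurable_funP.
have ndf y : {homo (f ^~ y) : m n / (m <= n)%N >-> m <= n}.
  by move=> m n mn; exact/lefP/nd_nnsfun_approx.
have E1 : (fun n => \int[mu]_x (H x * f n (phi x))%:E)%E @ \oo --> (\int[mu]_x (H x * g (phi x))%:E)%E.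
  have := @cvg_monotone_convergence _ _ _ mu setT measurableT
    (fun n x => (H x * f n (phi x))%:E).
  have -> : (fun x => limn ((fun n x => (H x * f n (phi x))%:E) ^~ x)) =
    (fun x => (H x * g (phi x))%:E).
    apply/funext => x; apply/cvg_lim => //=.
    under eq_fun do rewrite EFinM.
    rewrite EFinM; apply: cvgeZl => //; exact: fg.
  apply.
  - by move=> n; apply/measurable_EFinP; exact: measurable_funM.
  - by move=> n x _; rewrite lee_fin mulr_ge0.
  - by move=> x _ m n mn; rewrite lee_fin ler_wpM2l // ndf.
have E2 : (fun n => \int[nu]_y (f n y)%:E)%E @ \oo --> (\int[nu]_y (g y)%:E)%E.
  have := @cvg_monotone_convergence _ _ _ nu setT measurableT
    (fun n y => (f n y)%:E).
  have -> : (fun x => limn ((fun n x => (f n x)%:E) ^~ x)) = (fun x => (g x)%:E).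
    by apply/funext => x; apply/cvg_lim => //; exact: fg.
  apply.
  - by move=> n; apply/measurable_EFinP; exact: measurable_funP.
  - by move=> n x _; rewrite lee_fin.
  - by move=> x _ m n mn; rewrite lee_fin ndf.
have E n : (\int[mu]_x (H x * f n (phi x))%:E = c%:E * \int[nu]_y (f n y)%:E)%E.
  set s := fset_set (f n @` setT).
  have s0 (i : 'I_#|`s|) : 0 <= s`_i.
    have : s`_i \in s by exact: mem_nth.
    by rewrite in_fset_set // inE => -[y _ <-].
  have fE y : f n y = \sum_(i < #|`s|) (s`_i * \1_(f n @^-1` [set s`_i]) y) by exact: fimfunEord.
  have mB (i : 'I_#|`s|) : measurable (f n @^-1` [set s`_i]) by exact: measurable_sfunP.
  transitivity (\sum_(i < #|`s|) \int[mu]_x ((s`_i)%:E * (H x * \1_(f n @^-1` [set s`_i]) (phi x))%:E))%E.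
    rewrite -ge0_integral_sum //=; first last.
    - by move=> i x _; rewrite -EFinM lee_fin !mulr_ge0 // indicE.
    - move=> i; apply: measurable_funeM; apply/measurable_EFinP; apply: measurable_funM => //.
      by apply: measurableT_comp => //; exact: measurable_indic.
    apply: eq_integral => x _; rewrite fE mulr_sumr -sumEFin; apply: eq_bigr => i _.
    by rewrite -EFinM; congr (_%:E); ring.
  under eq_bigr => i _.
    rewrite ge0_integralZl_EFin //; last 2 first.
    - by move=> x _; rewrite lee_fin mulr_ge0 // indicE.
    - apply/measurable_EFinP; apply: measurable_funM => //.
      by apply: measurableT_comp => //; exact: measurable_indic.
    rewrite HB // muleCA; over.
  rewrite -ge0_sume_distrr; last by move=> i _; rewrite mule_ge0 ?lee_fin.
  congr (c%:E * _)%E.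
  under [RHS]eq_integral do rewrite fE -sumEFin.
  rewrite ge0_integral_sum //=.
  - apply: eq_bigr => i _.
    under eq_integral do rewrite EFinM.
    rewrite ge0_integralZl_EFin //.
    + by rewrite integral_indic // setIT.
    + by apply/measurable_EFinP; exact: measurable_indic.
  - by move=> i; apply/measurable_EFinP; apply: measurable_funM => //; exact: measurable_indic.
  - by move=> i x _; rewrite lee_fin mulr_ge0 // indicE.
have E3 : (fun n => c%:E * \int[nu]_y (f n y)%:E)%E @ \oo --> (c%:E * \int[nu]_y (g y)%:E)%E.
  by apply: cvgeZl.
move: E1; rewrite (funext E) => E1.
by rewrite -(cvg_lim _ E1) // (cvg_lim _ E3).
Qed.

End density_transfer.

Section normal_mgf.
Context {R : realType}.
Variable sigma : R.
Hypothesis sigma0 : 0 < sigma.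
Local Notation mu := (@lebesgue_measure R).

Lemma integral_normal_prob (g : R -> R) : measurable_fun setT g -> (forall y, 0 <= g y) ->
  (\int[normal_prob 0 sigma]_y (g y)%:E = \int[mu]_x (normal_pdf 0 sigma x * g x)%:E)%E.
Proof.
move=> mg g0; apply/esym; rewrite -[RHS]mul1e.
apply: (@integral_transfer R _ _ _ _ mu (normal_prob 0 sigma) id (normal_pdf 0 sigma) 1).
- exact: measurable_id.
- exact: measurable_normal_pdf.
- by move=> x; exact: normal_pdf_ge0.
- move=> B mB; rewrite mul1e /normal_prob /= [RHS]integral_mkcond.
  apply: eq_integral => x _; rewrite /patch indicE.
  by case: ifPn => _; rewrite ?mulr1 ?mulr0.
- exact: mg.
- exact: g0.
Qed.

(** Completing the square moves the mean of the density to a sigma^2. *)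
Lemma normal_mgf (a : R) :
  (\int[normal_prob 0 sigma]_y (expR (a * y))%:E = (expR (a ^+ 2 * sigma ^+ 2 / 2))%:E)%E.
Proof.
have ma : measurable_fun setT (fun y : R => expR (a * y)).
  by apply: measurableT_comp => //; exact: measurable_funM.
rewrite integral_normal_prob //.
have s0 : sigma != 0 by rewrite gt_eqF.
transitivity (\int[mu]_x ((expR (a ^+ 2 * sigma ^+ 2 / 2))%:E * (normal_pdf (a * sigma ^+ 2) sigma x)%:E))%E.
  apply: eq_integral => x _; rewrite !normal_pdfE // -EFinM; congr (_%:E).
  rewrite /normal_fun mulrAC -mulrA [RHS]mulrCA; congr (_ * _).
  rewrite -!expRD; congr expR; rewrite -mulr_natr; field.
  exact: s0.
rewrite ge0_integralZl_EFin ?expR_ge0 //.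
- by rewrite integral_normal_pdf mule1.
- by move=> x _; rewrite lee_fin normal_pdf_ge0.
- by apply/measurable_EFinP; exact: measurable_normal_pdf.
Qed.

End normal_mgf.

Section noise_mgf.
Context {R : realType} d (Omega : measurableType d) (P : probability Omega R).
Variables (sigma : R) (T : nat) (eps : nat -> {RV P >-> R}).
Hypothesis sigma0 : 0 < sigma.
Hypothesis iid : iid_normal_noise sigma T eps.

(** Independence is given for preimages of sets, that is for products of indicators. Induction
on n replaces the indicators at 1, ..., n by nonnegative functions one at a time, each time by
[integral_transfer] with the other factors collected in H. *)
Lemma noise_prod_expectation n (u : nat -> R -> R) (A : nat -> set R) (v : nat -> R) :
  (forall t, measurable (A t)) -> (forall t, measurable_fun setT (u t)) ->
  (forall t x, 0 <= u t x) ->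
  (forall t, (n < t <= T)%N -> u t = \1_(A t)) ->
  (forall t, (1 <= t <= n)%N -> (\int[normal_prob 0 sigma]_y (u t y)%:E = (v t)%:E)%E) ->
  (forall t, (n < t <= T)%N -> (normal_prob 0 sigma (A t) = (v t)%:E)%E) -> (n <= T)%N ->
  (\int[P]_w (\prod_(1 <= t < T.+1) u t (eps t w))%:E = (\prod_(1 <= t < T.+1) v t)%:E)%E.
Proof.
case: iid => ind law; elim: n u A v => [|n IH] u A v mA mu u0 uA vu vA nT.
  pose J : {fset nat} := [fset t in index_iota 1 T.+1]%fset.
  have memJ t : (t \in J) = (1 <= t <= T)%N by rewrite in_fset /= mem_index_iota ltnS.
  have := ind J A _ mA.
  have -> : (\prod_(i <- J) P (eps i @^-1` A i))%E = (\prod_(1 <= t < T.+1) v t)%:E.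
    rewrite [LHS](perm_big (index_iota 1 T.+1)) /=; last first.
      apply: uniq_perm; rewrite ?fset_uniq ?iota_uniq // => t.
      by rewrite memJ mem_index_iota ltnS.
    rewrite -prodEFin; apply: eq_big_nat => t ht.
    by rewrite -vA // -(law t).
  move=> <-; last by move=> t /=; rewrite memJ.
  rewrite -[X in P X]setTI.
  have mJ : measurable (\bigcap_(i in [set` J]) eps i @^-1` A i).
    apply: bigcap_measurableType => t _.
    by rewrite -[X in measurable X]setTI; exact: measurable_funP.
  rewrite setIC -integral_indic //; apply: eq_integral => w _; congr (_%:E).
  rewrite indicE; case: (boolP (w \in _)) => [|].
    rewrite inE => h; rewrite big_nat_cond big1 // => t; rewrite andbT ltnS => ht.
    by rewrite uA // indicE mem_set //; apply: h; rewrite /= memJ.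
  move=> /negP h.
  have [t ht nt] : exists2 t, (1 <= t <= T)%N & ~ A t (eps t w).
    apply: contrapT => H; apply: h; rewrite inE => t /=; rewrite memJ => ht.
    by apply: contrapT => nt; apply: H; exists t.
  rewrite (bigD1_seq t) ?iota_uniq ?mem_index_iota ?ltnS //= uA // indicE memNset //.
  by rewrite mul0r.
have rn : n.+1 \in index_iota 1 T.+1 by rewrite mem_index_iota ltnS.
pose H w := \prod_(1 <= t < T.+1 | t != n.+1) u t (eps t w).
pose c := \prod_(1 <= t < T.+1 | t != n.+1) v t.
have mH : measurable_fun setT H.
  rewrite (_ : H = fun w => \prod_(t <- [seq t <- index_iota 1 T.+1 | t != n.+1]) u t (eps t w)).
    by apply: measurable_prod => t _; apply: measurableT_comp.
  by apply/funext => w; rewrite big_filter.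
transitivity (\int[P]_w (H w * u n.+1 (eps n.+1 w))%:E)%E.
  by apply: eq_integral => w _; rewrite (bigD1_seq n.+1) ?iota_uniq //= mulrC.
rewrite (bigD1_seq n.+1) ?iota_uniq //= mulrC -/c EFinM -vu ?leqnn //.
apply: (@integral_transfer R _ _ _ _ P (normal_prob 0 sigma) (eps n.+1) H c) => //.
- exact: (measurable_funP (eps n.+1)).
- by move=> w; apply: prodr_ge0.
- move=> B mB.
  pose u' t := if t == n.+1 then \1_B : R -> R else u t.
  pose v' t := if t == n.+1 then fine (normal_prob 0 sigma B) else v t.
  have fB : (normal_prob 0 sigma B = (fine (normal_prob 0 sigma B))%:E)%E.
    by rewrite fineK // fin_num_measure.
  have := IH u' (fun t => if t == n.+1 then B else A t) v'.
  have -> : (\prod_(1 <= t < T.+1) v' t)%:E = (c%:E * normal_prob 0 sigma B)%E.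
    rewrite (bigD1_seq n.+1) ?iota_uniq //= mulrC EFinM {2}/v' eqxx -fB; congr (_%:E * _)%E.
    by apply: eq_bigr => t /negbTE h; rewrite /v' h.
  move=> <- //.
  + apply: eq_integral => w _; congr (_%:E).
    rewrite [RHS](bigD1_seq n.+1) ?iota_uniq //= mulrC {1}/u' eqxx; congr (_ * _).
    by apply: eq_bigr => t /negbTE h; rewrite /u' h.
  + by move=> t; case: ifP.
  + by move=> t; rewrite /u'; case: ifP => // _; exact: measurable_indic.
  + by move=> t x; rewrite /u'; case: ifP => // _; rewrite indicE.
  + move=> t /andP[h1 h2]; rewrite /u'; case: eqP => // h3; apply: uA.
    by rewrite h2 andbT ltn_neqAle h1 andbT eq_sym; apply/eqP.
  + by move=> t ht; rewrite /u' /v' ltn_eqF ?vu //; lia.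
  + move=> t /andP[h1 h2]; rewrite /v'; case: eqP => // h3; apply: vA.
    by rewrite h2 andbT ltn_neqAle h1 andbT eq_sym; apply/eqP.
  + exact: ltnW.
- exact: mu.
Qed.

Definition noise (w : Omega) (t : nat) : R := eps t w / sigma.

Lemma noise_mgf (a : nat -> R) :
  (\int[P]_w (expR (ip T a (noise w)))%:E = (expR (nrm2 T a / 2))%:E)%E.
Proof.
have E w : expR (ip T a (noise w)) = \prod_(1 <= t < T.+1) expR (a t / sigma * eps t w).
  rewrite /ip expR_sum; apply: eq_bigr => t _; congr expR; rewrite /noise; ring.
under eq_integral do rewrite E.
rewrite (@noise_prod_expectation T (fun t x => expR (a t / sigma * x)) (fun=> setT)
  (fun t => expR (a t ^+ 2 / 2))) //.
- rewrite -expR_sum /nrm2 /ip mulr_suml; congr (expR _)%:E.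
- move=> t; apply: measurableT_comp => //; exact: measurable_funM.
- by move=> t; lia.
- move=> t _; rewrite normal_mgf //; congr (expR _)%:E; field.
  by rewrite gt_eqF.
- by move=> t; lia.
Qed.

Lemma measurable_expsum (L : seq (R * (nat -> R))) :
  measurable_fun setT (fun w => expsum T L (noise w)).
Proof.
apply: measurable_sum => l; apply: measurable_funM => //.
apply: measurableT_comp => //; apply: measurable_sum => t.
by apply: measurable_funM => //; apply: measurable_funM.
Qed.

Lemma integral_expsum (L : seq (R * (nat -> R))) : {in L, forall l, 0 <= l.1} ->
  (\int[P]_w (expsum T L (noise w))%:E = (expmean T L)%:E)%E.
Proof.
elim: L => [|l L IH] L0.
  rewrite /expmean big_nil; under eq_integral do rewrite /expsum big_nil.
  by rewrite integral0.
have l0 : 0 <= l.1 by apply: L0; rewrite mem_head.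
have {}L0 : {in L, forall l, 0 <= l.1} by move=> k kL; apply: L0; rewrite inE kL orbT.
rewrite /expmean big_cons EFinD -/(expmean T L) -IH //.
under eq_integral do rewrite /expsum big_cons EFinD -/(expsum T L _).
have me : measurable_fun setT (fun w => expR (ip T l.2 (noise w))).
  apply: measurableT_comp => //; apply: measurable_sum => t.
  by apply: measurable_funM => //; apply: measurable_funM.
rewrite ge0_integralD //.
- congr (_ + _)%E; under eq_integral do rewrite EFinM.
  rewrite ge0_integralZl_EFin //.
  + by rewrite noise_mgf.
  + exact/measurable_EFinP.
- by move=> w _; rewrite lee_fin mulr_ge0 ?expR_ge0.
- by apply/measurable_EFinP; apply: measurable_funM.
- by move=> w _; rewrite lee_fin expsum_ge0.
- by apply/measurable_EFinP; exact: measurable_expsum.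
Qed.

(** Markov's inequality for the witness. The event N is the measurable set where the witness is
at least 1; E itself may fail to be measurable. *)
Lemma rare_probability p (E : (nat -> R) -> Prop) : rare T p E ->
  exists N, [/\ measurable N, (P N <= p%:E)%E & forall w, E (noise w) -> N w].
Proof.
move=> [L [L0 Lp LE]].
pose f w := expsum T L (noise w).
have mf : measurable_fun setT (EFin \o f) by apply/measurable_EFinP; exact: measurable_expsum.
have f0 w : 0 <= f w by exact: expsum_ge0.
exists [set w | (1%:E <= `|(f w)%:E|)%E]; split.
- rewrite -[X in measurable X]setTI; apply: emeasurable_fun_c_infty => //.
  exact: measurableT_comp.
- have := @le_integral_abse _ _ _ P setT measurableT (EFin \o f) 1 mf ltr01.
  rewrite mul1e setTI => h; apply: le_trans h _.
  under eq_integral do rewrite /= ger0_norm //.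
  by rewrite integral_expsum // lee_fin.
- by move=> w /LE h /=; rewrite lee_fin ger0_norm.
Qed.

End noise_mgf.

(** * Undetected changes *)

Section localisation.
Context {R : realType}.
Implicit Types (T t c h : nat) (tau : seq nat) (g x z F : nat -> R) (sigma beta B : R).

(** The wedge has kinks at c and, because of the jumps of [wedge] at the ends of its window, at
the last point inside and at the first point outside on either side. *)
Lemma wedge_spline T c h : (h < c)%N ->
  spline T (mem [:: (c - h).-1; (c - h)%N; c; (c + h)%N; (c + h).+1]) (@wedge R c h).
Proof.
move=> hc t /andP[t0 tT]; rewrite !inE => /norP[n1 /norP[n2 /norP[n3 /norP[n4 n5]]]].
have inside s : (c - h <= s <= c + h)%N -> wedge c h s = ((s - c) + (c - s))%N%:R - wedge_mean h :> R.
  by move=> hs; rewrite /wedge hs.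
have outside s : ~~ (c - h <= s <= c + h)%N -> wedge c h s = 0 :> R.
  by move=> /negbTE hs; rewrite /wedge hs.
rewrite /d2; have [hl|hl] := ltnP t (c - h).
  by rewrite !outside; [ring|lia|lia|lia].
have [hr|hr] := ltnP (c + h) t.
  by rewrite !outside; [ring|lia|lia|lia].
rewrite !inside; [|lia|lia|lia].
have [tc|ct] := ltnP t c.
  have [-> ->] : (t.+1 - c + (c - t.+1) = c - t.+1 /\ t - c + (c - t) = (c - t.+1).+1)%N by split; lia.
  have -> : (t.-1 - c + (c - t.-1) = (c - t.+1).+2)%N by lia.
  by rewrite -!natr1; ring.
have [-> ->] : (t.+1 - c + (c - t.+1) = (t.-1 - c).+2 /\ t - c + (c - t) = (t.-1 - c).+1)%N by split; lia.
have -> : (t.-1 - c + (c - t.-1) = t.-1 - c)%N by lia.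
by rewrite -!natr1; ring.
Qed.

(** Without an estimated changepoint near c, the fit g has no kink there, so the residual has the
kink of F at c plus noise. Subtracting the best multiple of the wedge lowers the squared
distance by <residual, wedge>^2 / |wedge|^2 and costs at most five changepoints. *)
Lemma detect_change sigma beta B T x z F tau tauh c h : 0 < sigma -> 0 <= beta ->
  (forall t, (1 <= t <= T)%N -> x t / sigma = F t + z t) ->
  spline T (mem tau) F -> is_minimiser sigma beta T x tauh ->
  (0 < h < c)%N -> (c + h <= T)%N ->
  (forall t, (c - h < t < c + h)%N -> t != c -> t \notin tau) ->
  `|ip T (wedge c h) z| <= B * nrm T (wedge c h) ->
  48 * (1 + 5 * beta + B ^+ 2) < d2 F c ^+ 2 * h%:R ^+ 3 ->
  exists2 u, u \in tauh & (c - h < u < c + h)%N.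
Proof.
move=> s0 b0 xF sF [cp opt] hc cT noc noise big.
apply: contrapT => no.
have noh u : (c - h < u < c + h)%N -> u \notin tauh.
  by move=> hu; apply/negP => uin; apply: no; exists u.
have [g sg gle] := cost_spline x s0 cp.
pose v : nat -> R := wedge c h.
pose e t := x t / sigma - g t.
pose N := nrm2 T v.
have h0 : 0 < h%:R :> R by rewrite ltr0n; case/andP: hc.
have Nge : h%:R ^+ 3 / 6 <= N by exact: nrm2_wedge_ge.
have N0 : 0 < N by apply: lt_le_trans Nge; rewrite divr_gt0 ?exprn_gt0.
have inT t : (c - h < t < c + h)%N -> (0 < t < T)%N by move: hc; lia.
have ev : ip T e v = d2 F c / 2 * N + ip T z v.
  have -> : ip T e v = ip T (fun t => (F t - g t) + z t) v.
    by apply: eq_ip => // t ht; rewrite /e xF //; ring.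
  rewrite ipDl; congr (_ + _); rewrite ip_wedge // => [|t ht tc].
    by rewrite d2B (sg c) ?subr0 ?inT ?noh //; move: hc; lia.
  by rewrite d2B sF ?sg ?subr0 ?inT ?noh ?noc.
(* the multiple of the wedge that lowers the squared distance most *)
pose k := ip T e v / N.
pose ks := tauh ++ [:: (c - h).-1; (c - h)%N; c; (c + h)%N; (c + h).+1].
have T0 : (0 < T)%N by move: hc; lia.
have [tau' cp' [sz mem']] := changepoints_of_list ks T0.
have sg' : spline T (mem tau') (fun t => g t + k * v t).
  move=> t ht; rewrite mem' ht andbT mem_cat negb_or => /andP[t1 t2].
  rewrite d2D d2Z sg // (@wedge_spline T) //; first by ring.
  by case/andP: hc.
have cle := cost_le_spline x s0 cp' sg'.
have := opt _ cp'; rewrite /penalised_cost => ople.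
have nE : nrm2 T (fun t => x t / sigma - (g t + k * v t)) = nrm2 T e - ip T e v ^+ 2 / N.
  have -> : nrm2 T (fun t => x t / sigma - (g t + k * v t)) = nrm2 T (fun t => e t - k * v t).
    by apply: eq_ip => t _; rewrite /e; ring.
  rewrite nrm2B ipZr nrm2Z -/N /k; field.
  by rewrite gt_eqF.
rewrite nE in cle.
have szR : (size tau')%:R <= (size tauh)%:R + 5 :> R.
  by rewrite -natrD ler_nat (leq_trans sz) // size_cat.
have : beta * (size tau')%:R <= beta * ((size tauh)%:R + 5) by rewrite ler_wpM2l.
rewrite -/(nrm2 T e) in gle.
have {gle}gle : nrm2 T e <= cost sigma T x tauh + 1 by [].
move=> bm.
have : ip T e v ^+ 2 / N <= 1 + 5 * beta by rewrite mulrDr in bm; lra.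
rewrite ler_pdivrMr // ev => H.
have zb : ip T z v ^+ 2 <= B ^+ 2 * N.
  have := noise; rewrite -/v ipC => zb.
  rewrite -[ip T z v ^+ 2]real_normK ?num_real // /N -sqr_nrm -exprMn.
  by rewrite ler_sqr ?nnegrE // (le_trans _ zb).
(* (p + y)^2 >= p^2 / 2 - y^2 *)
have zs : (d2 F c / 2 * N) ^+ 2 / 2 - ip T z v ^+ 2 <= (d2 F c / 2 * N + ip T z v) ^+ 2.
  have := sqr_ge0 (d2 F c / 2 * N + 2 * ip T z v); nra.
have : (d2 F c ^+ 2 * N / 8) * N <= (1 + 5 * beta + B ^+ 2) * N by nra.
rewrite ler_pM2r // => K.
have : d2 F c ^+ 2 * (h%:R ^+ 3 / 6) <= d2 F c ^+ 2 * N by rewrite ler_wpM2l ?sqr_ge0.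
lra.
Qed.

End localisation.

(** * Windows that contain a single estimated knot *)

Section half_window.
Context {R : realType}.
Implicit Types (d n p s k : nat) (w z : nat -> R).

Definition partial_sum z k : R := \sum_(1 <= s < k.+1) z s.

(** The weights k^(-1/2) split 1 / k in the Cauchy-Schwarz inequality of [weighted_cauchy].
With them both factors there are of order sqrt d, the second one on average over the noise. *)
Definition hardy_weight d : R := \sum_(1 <= k < d.+1) (Num.sqrt k%:R)^-1.

(** A quadratic form that dominates (sum of w s z s)^2 / |w|^2, up to a factor of order 1 / d,
for every w that is linear on 0..2 d except for a kink in 0..d, wherever that kink is, provided
that w 0 is under control as well. The
first two squares take care of the line on the right of the kink, the third term of the
deviation from it. *)
Definition half_form d z : R :=
  (\sum_(1 <= s < (2 * d).+1) z s) ^+ 2 +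
  (\sum_(1 <= s < (2 * d).+1) s%:R / (2 * d%:R) * z s) ^+ 2 +
  4 * (hardy_weight d * \sum_(1 <= k < d.+1) (k%:R * Num.sqrt k%:R)^-1 * partial_sum z k ^+ 2).

Lemma hardy_weight_le d : hardy_weight d <= 2 * Num.sqrt d%:R.
Proof.
rewrite /hardy_weight; elim: d => [|d IH]; first by rewrite big_geq // mulr_ge0.
rewrite big_nat_recr //=.
have s1 : 0 < Num.sqrt d.+1%:R :> R by rewrite sqrtr_gt0 ltr0n.
have s0 : 0 <= Num.sqrt d%:R :> R by rewrite sqrtr_ge0.
have e1 : Num.sqrt d.+1%:R ^+ 2 = d%:R + 1 :> R by rewrite sqr_sqrtr // natr1.
have e0 : Num.sqrt d%:R ^+ 2 = d%:R :> R by rewrite sqr_sqrtr.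
apply: le_trans (lerD IH (lexx _)) _.
move: s1 s0 e1 e0; move: (Num.sqrt d.+1%:R) (Num.sqrt d%:R) => x y x0 y0 ex ey.
have xV : x * x^-1 = 1 by rewrite mulfV // gt_eqF.
have xV0 : 0 < x^-1 by rewrite invr_gt0.
have h : 2 * x * y <= 2 * x ^+ 2 - 1 by have := sqr_ge0 (x - y); nra.
have -> : 2 * y + x^-1 = x^-1 * (2 * x * y + 1) by rewrite mulrDr mulr1 -!mulrA (mulrCA x^-1 2) (mulrA x^-1 x) (mulrC x^-1 x) xV mul1r.
apply: le_trans (_ : x^-1 * (2 * x ^+ 2) <= _).
  by rewrite ler_wpM2l ?(ltW xV0) //; lra.
by rewrite expr2 mulrCA (mulrA x^-1) (mulrC x^-1 x) xV mul1r.
Qed.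

Lemma weighted_cauchy d z : (\sum_(1 <= k < d.+1) `|partial_sum z k| / k%:R) ^+ 2 <=
  hardy_weight d * \sum_(1 <= k < d.+1) (k%:R * Num.sqrt k%:R)^-1 * partial_sum z k ^+ 2.
Proof.
pose a k : R := Num.sqrt (Num.sqrt k%:R)^-1.
pose b k : R := `|partial_sum z k| / k%:R / a k.
have a2 k : a k ^+ 2 = (Num.sqrt k%:R)^-1 by rewrite sqr_sqrtr // invr_ge0 sqrtr_ge0.
have a0 k : (0 < k)%N -> a k != 0.
  by move=> k0; rewrite gt_eqF // sqrtr_gt0 invr_gt0 sqrtr_gt0 ltr0n.
have := cauchy_schwarz d a b; rewrite /nrm2 /ip.
have -> : \sum_(1 <= t < d.+1) a t * b t = \sum_(1 <= k < d.+1) `|partial_sum z k| / k%:R.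
  by apply: eq_big_nat => k /andP[/a0 k0 _]; rewrite /b mulrC mulfVK.
move=> h; apply: le_trans h _; rewrite le_eqVlt; apply/orP; left; apply/eqP; congr (_ * _).
  by apply: eq_bigr => k _; rewrite -expr2 a2.
apply: eq_big_nat => k /andP[k0 _]; rewrite -expr2 /b !exprMn !exprVn a2 real_normK ?num_real //.
have s0 : Num.sqrt k%:R != 0 :> R by rewrite gt_eqF // sqrtr_gt0 ltr0n.
have sk : k%:R = Num.sqrt k%:R ^+ 2 :> R by rewrite sqr_sqrtr.
move: (Num.sqrt k%:R) s0 sk => x x0 ->.
by field.
Qed.

(** Summation by parts: a linear weight that vanishes at p becomes a sum of partial sums. *)
Lemma abel_sum p z : \sum_(1 <= s < p) (p%:R - s%:R) * z s = \sum_(1 <= k < p) partial_sum z k.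
Proof.
elim: p => [|p IH]; first by rewrite !big_geq.
have [->|p0] := posnP p; first by rewrite !big_geq.
rewrite [RHS]big_nat_recr //= -IH [LHS]big_nat_recr //= /partial_sum big_nat_recr //=.
rewrite -natr1 addrA -big_split /=; congr (_ + _); last by ring.
by apply: eq_bigr => s _; ring.
Qed.

Lemma sum_affine_sqr n (a b : R) : \sum_(0 <= i < n.+1) (a + b * i%:R) ^+ 2 =
  (n%:R + 1) * (a + b * n%:R / 2) ^+ 2 + b ^+ 2 * n%:R * (n%:R + 1) * (n%:R + 2) / 12.
Proof.
elim: n => [|n IH]; first by rewrite big_nat1 /=; field.
by rewrite big_nat_recr //= IH -natr1; field.
Qed.

(** With the mean m of w on d..2 d and e its slope, the sum of squares is
(d + 1) m^2 + e^2 d (d + 1) (d + 2) / 12, and c = m - 3 e d / 2. *)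
Lemma affine_tail d w (c e N : R) : (forall s, (d <= s <= 2 * d)%N -> w s = c + e * s%:R) ->
  \sum_(d <= s < (2 * d).+1) w s ^+ 2 <= N ->
  (d%:R + 1) * c ^+ 2 <= 56 * N /\ (d%:R + 1) * (2 * d%:R * e) ^+ 2 <= 56 * N.
Proof.
move=> we.
have -> : \sum_(d <= s < (2 * d).+1) w s ^+ 2 = \sum_(0 <= i < d.+1) ((c + e * d%:R) + e * i%:R) ^+ 2.
  rewrite -{1}[d]add0n big_addn (_ : (2 * d).+1 - d = d.+1)%N; last lia.
  by apply: eq_big_nat => i hi; rewrite we ?natrD; [congr (_ ^+ 2); ring|lia].
rewrite sum_affine_sqr.
have : 0 <= d%:R :> R by [].
move: (d%:R : R) => x x0 hN.
set m := c + e * x + e * x / 2 in hN.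
have m0 : 0 <= (x + 1) * m ^+ 2 by rewrite mulr_ge0 ?sqr_ge0 //; lra.
have ex0 : 0 <= (x + 1) * (e * x) ^+ 2 by rewrite mulr_ge0 ?sqr_ge0 //; lra.
have e0 : 0 <= (x + 1) * x * e ^+ 2.
  by apply: mulr_ge0; [apply: mulr_ge0; lra|exact: sqr_ge0].
have h1 : (x + 1) * (e * x) ^+ 2 + 2 * ((x + 1) * x * e ^+ 2) = 12 * (e ^+ 2 * x * (x + 1) * (x + 2) / 12).
  by field.
have h2 : (x + 1) * (e * x) ^+ 2 <= 12 * N by lra.
have h3 : (x + 1) * m ^+ 2 <= N by lra.
split.
  have : c ^+ 2 <= 2 * m ^+ 2 + 9 / 2 * (e * x) ^+ 2.
    have -> : c = m - 3 / 2 * (e * x) by rewrite /m; field.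
    have := sqr_ge0 (m + 3 / 2 * (e * x)); nra.
  move=> hc; have : (x + 1) * c ^+ 2 <= (x + 1) * (2 * m ^+ 2 + 9 / 2 * (e * x) ^+ 2).
    by rewrite ler_wpM2l //; lra.
  rewrite mulrDr; lra.
have -> : (x + 1) * (2 * x * e) ^+ 2 = 4 * ((x + 1) * (e * x) ^+ 2) by ring.
lra.
Qed.

Lemma affine_start d w (N : R) : (forall s, (0 < s < 2 * d)%N -> d2 w s = 0) ->
  \sum_(d <= s < (2 * d).+1) w s ^+ 2 <= N -> (d%:R + 1) * w 0%N ^+ 2 <= 56 * N.
Proof.
move=> hw hN.
have A := @affine_of_d2 R w 0 (2 * d) hw.
have [] := @affine_tail d w (w 0%N) (w 1%N - w 0%N) N _ hN => //.
by move=> s /andP[_ hs]; rewrite -A.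
Qed.

(** Let c + e s be the line on the right of the kink p. The second half of the window bounds c
and e through [affine_tail]. The deviation from that line is (w 0 - c) (p - s) / p on 0..p;
by [abel_sum] its product with z is at most |w 0 - c| times the mean of the first partial sums
of z in absolute value, and |S_k| / p <= |S_k| / k makes this bound independent of p. *)
Lemma half_window_bound d p w z (N : R) : (p <= d)%N ->
  (forall s, (0 < s < 2 * d)%N -> s != p -> d2 w s = 0) ->
  \sum_(d <= s < (2 * d).+1) w s ^+ 2 <= N ->
  (d%:R + 1) * w 0%N ^+ 2 <= 56 * N ->
  (d%:R + 1) * (\sum_(1 <= s < (2 * d).+1) w s * z s) ^+ 2 <= 168 * N * half_form d z.
Proof.
move=> pd hw hN hw0.
have [d0|d0] := posnP d.
  rewrite d0 big_geq // expr0n /= mulr0.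
  have N0 : 0 <= N by apply: le_trans hN; apply: sumr_ge0 => s _; rewrite sqr_ge0.
  rewrite mulr_ge0 //; first by rewrite mulr_ge0.
  by rewrite /half_form /hardy_weight !big_geq // !mul0r mulr0 !expr0n /= !addr0.
have A := @affine_of_d2 R w p (2 * d - p) (fun i hi => hw i ltac:(lia) ltac:(lia)).
set e := w p.+1 - w p in A.
pose c := w p - e * p%:R.
have wr s : (p <= s <= 2 * d)%N -> w s = c + e * s%:R.
  move=> hs; have := A (s - p)%N ltac:(lia); rewrite subnKC; last by case/andP: hs.
  by move=> ->; rewrite natrB ?/c; [ring|case/andP: hs].
have [hc he] := @affine_tail d w c e N (fun s hs => wr s ltac:(lia)) hN.
have L := @affine_of_d2 R w 0 p (fun i hi => hw i ltac:(lia) ltac:(lia)).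
set b := w 1%N - w 0%N in L.
(* the deviation from the right-hand line is a linear function that vanishes at p *)
have dev s : (s <= p)%N -> p%:R * (w s - (c + e * s%:R)) = (w 0%N - c) * (p%:R - s%:R).
  move=> hs; have := L s hs; rewrite add0n => ->.
  have := L p (leqnn _); rewrite add0n (wr p ltac:(lia)) => ep.
  have : (b - e) * p%:R = c - w 0%N by lra.
  move=> Eb.
  have -> : p%:R * (w 0%N + b * s%:R - (c + e * s%:R)) = p%:R * (w 0%N - c) + ((b - e) * p%:R) * s%:R by ring.
  by rewrite Eb; ring.
pose S1 := \sum_(1 <= s < (2 * d).+1) z s.
pose S2 := \sum_(1 <= s < (2 * d).+1) s%:R / (2 * d%:R) * z s.
pose S3 := \sum_(1 <= k < d.+1) `|partial_sum z k| / k%:R.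
pose D := \sum_(1 <= s < p) (w s - (c + e * s%:R)) * z s.
have dR : 0 < d%:R :> R by rewrite ltr0n.
have E : \sum_(1 <= s < (2 * d).+1) w s * z s = c * S1 + (2 * d%:R * e) * S2 + D.
  have -> : D = \sum_(1 <= s < (2 * d).+1) (w s - (c + e * s%:R)) * z s.
    rewrite /D; have [p0|p0] := posnP p.
      rewrite p0 big_geq // big_nat_cond big1 // => s /andP[/andP[s1 s2] _].
      by rewrite wr ?subrr ?mul0r //; lia.
    rewrite [RHS](big_cat_nat (n := p)) //=; last lia.
    rewrite [X in _ = _ + X]big_nat_cond [X in _ = _ + X]big1 ?addr0 // => s /andP[/andP[s1 s2] _].
    by rewrite wr ?subrr ?mul0r //; lia.
  rewrite /S1 /S2 !mulr_sumr -!big_split; apply: eq_bigr => s _ /=.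
  by field; rewrite gt_eqF.
have S30 : 0 <= S3 by apply: sumr_ge0 => k _; rewrite mulr_ge0 ?invr_ge0.
have Dle : `|D| <= `|w 0%N - c| * S3.
  have [p0|p0] := posnP p.
    by rewrite /D p0 big_geq // normr0 mulr_ge0.
  have pR : 0 < p%:R :> R by rewrite ltr0n.
  have pD : p%:R * D = (w 0%N - c) * \sum_(1 <= k < p) partial_sum z k.
    rewrite -abel_sum /D !mulr_sumr; apply: eq_big_nat => s /andP[_ /ltnW sp].
    by rewrite mulrA dev // mulrA.
  have : p%:R * `|D| <= p%:R * (`|w 0%N - c| * S3).
    rewrite -{1}(ger0_norm (ltW pR)) -normrM pD normrM mulrCA ler_wpM2l //.
    apply: le_trans (ler_norm_sum _ _ _) _.
    rewrite /S3 mulr_sumr [leRHS](big_cat_nat (n := p)) ?leqW //=.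
    apply: le_trans (_ : \sum_(1 <= k < p) p%:R * (`|partial_sum z k| / k%:R) <= _).
      apply: ler_sum_nat => k /andP[k1 kp].
      rewrite mulrCA -[leLHS]mulr1 ler_wpM2l // ler_pdivlMr ?ltr0n // mul1r ler_nat ltnW //.
    rewrite lerDl; apply: sumr_ge0 => k _.
    by rewrite mulr_ge0 ?mulr_ge0 ?invr_ge0.
  by rewrite ler_pM2l.
have S3sq := weighted_cauchy d z; rewrite -/S3 in S3sq.
have D2 : D ^+ 2 <= (w 0%N - c) ^+ 2 * S3 ^+ 2.
  rewrite -[D ^+ 2]real_normK ?num_real // -[(w 0%N - c) ^+ 2]real_normK ?num_real // -exprMn.
  by rewrite ler_sqr ?nnegrE ?mulr_ge0.
have wc : (w 0%N - c) ^+ 2 <= 2 * w 0%N ^+ 2 + 2 * c ^+ 2.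
  by have := sqr_ge0 (w 0%N + c); nra.
rewrite E.
set f := 2 * d%:R * e in he *.
have x0 : 0 <= d%:R + 1 :> R by lra.
have T3 : (c * S1 + f * S2 + D) ^+ 2 <= 3 * (c ^+ 2 * S1 ^+ 2 + f ^+ 2 * S2 ^+ 2 + D ^+ 2).
  have := sqr_ge0 (c * S1 - f * S2); have := sqr_ge0 (c * S1 - D); have := sqr_ge0 (f * S2 - D).
  nra.
rewrite /half_form -/S1 -/S2.
set Hd := hardy_weight d * _ in S3sq *.
have Q1 : (d%:R + 1) * (c ^+ 2 * S1 ^+ 2) <= 56 * N * S1 ^+ 2.
  by rewrite mulrA ler_wpM2r ?sqr_ge0.
have Q2 : (d%:R + 1) * (f ^+ 2 * S2 ^+ 2) <= 56 * N * S2 ^+ 2.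
  by rewrite mulrA ler_wpM2r ?sqr_ge0.
have Q3 : (d%:R + 1) * D ^+ 2 <= 224 * N * Hd.
  apply: le_trans (_ : (d%:R + 1) * ((w 0%N - c) ^+ 2 * S3 ^+ 2) <= _); first by rewrite ler_wpM2l.
  rewrite mulrA.
  have k1 : (d%:R + 1) * (w 0%N - c) ^+ 2 <= 224 * N.
    apply: le_trans (_ : (d%:R + 1) * (2 * w 0%N ^+ 2 + 2 * c ^+ 2) <= _); first by rewrite ler_wpM2l.
    rewrite mulrDr; lra.
  have N0 : 0 <= 224 * N by apply: le_trans k1; rewrite mulr_ge0 ?sqr_ge0.
  apply: le_trans (_ : 224 * N * S3 ^+ 2 <= _); first by rewrite ler_wpM2r ?sqr_ge0.
  by rewrite ler_wpM2l.
have : (d%:R + 1) * (c * S1 + f * S2 + D) ^+ 2 <=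
   (d%:R + 1) * (3 * (c ^+ 2 * S1 ^+ 2 + f ^+ 2 * S2 ^+ 2 + D ^+ 2)) by rewrite ler_wpM2l.
rewrite mulrCA !mulrDr => H; apply: le_trans H _.
lra.
Qed.

End half_window.

Section single_knot_window.
Context {R : realType}.
Implicit Types (T d n p s k c v : nat) (w z a b : nat -> R).

Definition restrict (W : pred nat) w t : R := if W t then w t else 0.

(** A linear functional of finitely many shifted or reflected coordinates of z is a functional
of z with the same norm; this transfers bounds on means to half windows. *)
Definition reads T n (sh : nat -> nat) := forall k a, (k <= n)%N -> exists2 b : nat -> R,
  (forall z : nat -> R, ip T b z = \sum_(1 <= s < k.+1) a s * z (sh s)) &
  nrm2 T b = \sum_(1 <= s < k.+1) a s ^+ 2.

Lemma reads_injective T n sh : (forall s, (1 <= s <= n)%N -> (1 <= sh s <= T)%N) ->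
  (forall s s', (1 <= s <= n)%N -> (1 <= s' <= n)%N -> sh s = sh s' -> s = s') -> reads T n sh.
Proof.
move=> inT inj k a kn; pose b t := \sum_(1 <= s < k.+1) a s * (t == sh s)%:R.
have E z : ip T b z = \sum_(1 <= s < k.+1) a s * z (sh s).
  rewrite ip_suml; apply: eq_big_nat => s hs; rewrite ipZl ip_delta // inT //.
  by move: hs kn; clear; lia.
exists b => //; rewrite /nrm2 E; apply: eq_big_nat => s hs.
rewrite expr2 /b (bigD1_seq s) ?iota_uniq ?mem_index_iota //= eqxx mulr1.
rewrite big1_seq ?addr0 // => i /andP[si]; rewrite mem_index_iota => hi.
case: eqP => [e|_]; last by rewrite mulr0.
have si' : s = i by apply: inj => //; move: hs hi kn; clear; lia.
by rewrite si' eqxx in si.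
Qed.

Lemma mean_le_reads T n sh k a : reads T n sh -> (k <= n)%N ->
  mean_le T (16 * \sum_(1 <= s < k.+1) a s ^+ 2)
    (fun z => (\sum_(1 <= s < k.+1) a s * z (sh s)) ^+ 2).
Proof.
move=> rd kn; have [b bz <-] := rd k a kn.
by apply: mean_le_mono (mean_le_sqr T b) _ _ => // z; rewrite bz.
Qed.

(** The mean of the square of a partial sum of length k is of order k, so that the third term of
[half_form] has mean of order [hardy_weight d ^+ 2], which is of order d. *)
Lemma mean_le_half_form T d sh : reads T (2 * d) sh ->
  mean_le T (320 * d%:R) (fun z : nat -> R => half_form d (fun s => z (sh s))).
Proof.
move=> rd.
have E1 := @mean_le_reads T _ sh (2 * d) (fun=> 1) rd (leqnn _).
have E2 := @mean_le_reads T _ sh (2 * d) (fun s => s%:R / (2 * d%:R)) rd (leqnn _).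
have A0 : 0 <= hardy_weight d :> R by apply: sumr_ge0 => k _; rewrite invr_ge0 sqrtr_ge0.
have E3 : mean_le T (\sum_(k <- index_iota 1 d.+1) (k%:R * Num.sqrt k%:R)^-1 * (16 * k%:R))
  (fun z : nat -> R => \sum_(k <- index_iota 1 d.+1) (k%:R * Num.sqrt k%:R)^-1 *
     partial_sum (fun s => z (sh s)) k ^+ 2).
  apply: mean_le_sum => k; rewrite mem_index_iota => /andP[k1 kd].
  apply: mean_leZ; first by rewrite invr_ge0 mulr_ge0 ?sqrtr_ge0.
  have h : (k <= 2 * d)%N by lia.
  apply: mean_le_mono (@mean_le_reads T _ sh k (fun=> 1) rd h) _ _ => [|z].
    under eq_bigr do rewrite expr1n.
    by rewrite big_const_nat iter_addr_0 subn1.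
  by rewrite /partial_sum; under [in leRHS]eq_bigr do rewrite mul1r.
have E4 := mean_leZ (ler0n _ 4) (mean_leZ A0 E3).
apply: mean_le_mono (mean_leD (mean_leD E1 E2) E4) _ _; last first.
  by move=> z; rewrite /half_form; under [in X in _ <= X + _ + _]eq_bigr do rewrite mul1r.
have S1 : \sum_(1 <= s < (2 * d).+1) (1 : R) ^+ 2 = 2 * d%:R.
  under eq_bigr do rewrite expr1n.
  by rewrite big_const_nat iter_addr_0 subn1 /= natrM.
have S2 : \sum_(1 <= s < (2 * d).+1) (s%:R / (2 * d%:R)) ^+ 2 <= 2 * d%:R :> R.
  apply: le_trans (_ : \sum_(1 <= s < (2 * d).+1) (1 : R) ^+ 2 <= _); last by rewrite S1.
  apply: ler_sum_nat => s /andP[s1 sd].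
  have d0 : 0 < 2 * d%:R :> R by rewrite -natrM ltr0n; lia.
  rewrite ler_sqr ?nnegrE ?ler01 ?divr_ge0 ?(ltW d0) //.
  by rewrite ler_pdivrMr // mul1r -natrM ler_nat.
have S3 : \sum_(k <- index_iota 1 d.+1) (k%:R * Num.sqrt k%:R)^-1 * (16 * k%:R) =
    16 * hardy_weight d :> R.
  rewrite mulr_sumr; apply: eq_big_nat => k /andP[k1 _].
  have s0 : Num.sqrt k%:R != 0 :> R by rewrite gt_eqF // sqrtr_gt0 ltr0n.
  have k0 : k%:R != 0 :> R by rewrite gt_eqF // ltr0n.
  by field; rewrite s0 k0.
have S4 : hardy_weight d ^+ 2 <= 4 * d%:R :> R.
  have := hardy_weight_le d; have : 0 <= Num.sqrt d%:R :> R by rewrite sqrtr_ge0.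
  have : Num.sqrt d%:R ^+ 2 = d%:R :> R by rewrite sqr_sqrtr.
  move=> E h1 h2; have : hardy_weight d ^+ 2 <= (2 * Num.sqrt d%:R) ^+ 2 :> R.
    by rewrite ler_sqr ?nnegrE ?mulr_ge0 // h2.
  by rewrite exprMn E; lra.
rewrite S1 S3; have -> : 4 * (hardy_weight d * (16 * hardy_weight d)) = 64 * hardy_weight d ^+ 2 :> R by ring.
lra.
Qed.

Lemma d2_reflect w c s : (0 < s < c)%N -> d2 (fun s => w (c - s)%N) s = d2 w (c - s)%N.
Proof.
move=> hs; rewrite /d2.
have -> : (c - s.+1 = (c - s).-1)%N by lia.
have -> : (c - s.-1 = (c - s).+1)%N by lia.
ring.
Qed.

Definition window_form c d z : R :=
  z c ^+ 2 + (half_form d (fun s => z (c + s)%N) + half_form d (fun s => z (c - s)%N)).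

Lemma window_form_ge0 c d z : 0 <= window_form c d z.
Proof.
have hf0 y : 0 <= half_form d y.
  rewrite /half_form !addr_ge0 ?sqr_ge0 // !mulr_ge0 //.
    by apply: sumr_ge0 => k _; rewrite invr_ge0 sqrtr_ge0.
  apply: sumr_ge0 => k _; rewrite mulr_ge0 ?sqr_ge0 // invr_ge0 mulr_ge0 ?sqrtr_ge0 //.
by rewrite /window_form; apply: addr_ge0; [exact: sqr_ge0|apply: addr_ge0; exact: hf0].
Qed.

Lemma mean_le_window_form T c d : (2 * d < c)%N -> (c + 2 * d <= T)%N ->
  mean_le T (640 * (d%:R + 1)) (window_form c d).
Proof.
move=> dc cT.
have rr : reads T (2 * d) (addn c).
  by apply: reads_injective => [s|s s']; move: dc cT; clear; lia.
have rl : reads T (2 * d) (subn c).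
  by apply: reads_injective => [s|s s']; move: dc cT; clear; lia.
have zc : mean_le T 16 (fun z : nat -> R => z c ^+ 2).
  have cin : (1 <= c <= T)%N by move: dc cT; clear; lia.
  pose e t : R := (t == c)%:R.
  apply: mean_le_mono (mean_le_sqr T e) _ _; last by move=> z; rewrite ip_delta.
  by rewrite /nrm2 ip_delta // /e eqxx mulr1.
have H := mean_leD zc (mean_leD (mean_le_half_form rr) (mean_le_half_form rl)).
apply: mean_le_mono H _ _; last by move=> z; rewrite lexx.
lra.
Qed.

(** The knots are the changepoint c and the estimate v. Each side of c has at most one kink, so
that [half_window_bound] applies to both sides. It needs a bound on w c: the side without v is
linear up to c, which gives it by [affine_start]. *)
Lemma single_knot_window T c d w v : (2 * d < c)%N -> (c + 2 * d <= T)%N ->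
  (c - d <= v <= c + d)%N ->
  (forall t, (c - 2 * d < t < c + 2 * d)%N -> t != c -> t != v -> d2 w t = 0) ->
  let u := restrict (fun t => c - 2 * d <= t <= c + 2 * d)%N w in
  forall z, (d%:R + 1) * ip T z u ^+ 2 <= 504 * window_form c d z * nrm2 T u.
Proof.
move=> dc cT vd hw u z.
have d1 : 0 < d%:R + 1 :> R by rewrite natr1 ltr0n.
have uin s : (s <= 2 * d)%N -> u (c + s)%N = w (c + s)%N /\ u (c - s)%N = w (c - s)%N.
  move=> hs; rewrite /u /restrict.
  have [-> ->] : (c - 2 * d <= c + s <= c + 2 * d)%N /\ (c - 2 * d <= c - s <= c + 2 * d)%N.
    by split; lia.
  by [].
have uc : u c = w c by have [+ _] := uin 0%N isT; rewrite addn0.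
have uo t : ~~ (c - 2 * d <= t <= c + 2 * d)%N -> u t = 0.
  by rewrite /u /restrict => /negbTE ->.
pose N := nrm2 T u.
have NE : N = w c ^+ 2 + (\sum_(1 <= s < (2 * d).+1) w (c + s)%N ^+ 2 +
   \sum_(1 <= s < (2 * d).+1) w (c - s)%N ^+ 2).
  rewrite /N /nrm2 /ip (@sum_window _ T c (2 * d)) //; last first.
    by move=> t _ /uo ->; rewrite mul0r.
  rewrite uc -expr2 -big_split; congr (_ + _); apply: eq_big_nat => s /andP[_ hs].
  by have [-> ->] := uin s hs; rewrite -!expr2.
have IE : ip T z u = w c * z c + (\sum_(1 <= s < (2 * d).+1) w (c + s)%N * z (c + s)%N +
   \sum_(1 <= s < (2 * d).+1) w (c - s)%N * z (c - s)%N).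
  rewrite ipC /ip (@sum_window _ T c (2 * d)) //; last first.
    by move=> t _ /uo ->; rewrite mul0r.
  rewrite uc -big_split; congr (_ + _); apply: eq_big_nat => s /andP[_ hs].
  by have [-> ->] := uin s hs.
have tail (f : nat -> R) : \sum_(d <= s < (2 * d).+1) f s ^+ 2 <= f 0%N ^+ 2 + \sum_(1 <= s < (2 * d).+1) f s ^+ 2.
  have <- : \sum_(0 <= s < (2 * d).+1) f s ^+ 2 = f 0%N ^+ 2 + \sum_(1 <= s < (2 * d).+1) f s ^+ 2.
    by rewrite big_ltn.
  rewrite [leRHS](big_cat_nat (n := d)) //=; last lia.
  by rewrite lerDr; apply: sumr_ge0 => s _; rewrite sqr_ge0.
pose wr s := w (c + s)%N; pose wl s := w (c - s)%N.
have sq0 (f : nat -> R) : 0 <= \sum_(1 <= s < (2 * d).+1) f s ^+ 2.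
  by apply: sumr_ge0 => s _; rewrite sqr_ge0.
have Nr : \sum_(d <= s < (2 * d).+1) wr s ^+ 2 <= N.
  apply: le_trans (tail _) _; rewrite NE /wr addn0; have := sq0 wl; rewrite /wl; lra.
have Nl : \sum_(d <= s < (2 * d).+1) wl s ^+ 2 <= N.
  apply: le_trans (tail _) _; rewrite NE /wl subn0; have := sq0 wr; rewrite /wr; lra.
have wr0 : wr 0%N = w c by rewrite /wr addn0.
have wl0 : wl 0%N = w c by rewrite /wl subn0.
have d2r s : (0 < s < 2 * d)%N -> (c + s)%N != v -> d2 wr s = 0.
  move=> hs sv; have -> : d2 wr s = d2 w (c + s)%N.
    rewrite /d2 /wr addnS (_ : (c + s.-1 = (c + s).-1)%N) //; lia.
  by apply: hw => //; lia.
have d2l s : (0 < s < 2 * d)%N -> (c - s)%N != v -> d2 wl s = 0.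
  move=> hs sv; rewrite /wl d2_reflect; last lia.
  by apply: hw => //; lia.
have [H0 Hr Hl] : [/\ (d%:R + 1) * w c ^+ 2 <= 56 * N,
   (d%:R + 1) * (\sum_(1 <= s < (2 * d).+1) wr s * z (c + s)%N) ^+ 2 <=
     168 * N * half_form d (fun s => z (c + s)%N) &
   (d%:R + 1) * (\sum_(1 <= s < (2 * d).+1) wl s * z (c - s)%N) ^+ 2 <=
     168 * N * half_form d (fun s => z (c - s)%N)].
  have [cv|vc] := leqP c v.
    have k0 : (d%:R + 1) * w c ^+ 2 <= 56 * N.
      by rewrite -wl0; apply: (@affine_start _ d wl) => // s hs; apply: d2l => //; lia.
    split=> //.
    - apply: (@half_window_bound _ d (v - c)%N wr) => //; [lia| |by rewrite wr0].
      by move=> s hs sv; apply: d2r => //; lia.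
    - apply: (@half_window_bound _ d 0%N wl) => //; last by rewrite wl0.
      by move=> s hs sv; apply: d2l => //; lia.
  have k0 : (d%:R + 1) * w c ^+ 2 <= 56 * N.
    by rewrite -wr0; apply: (@affine_start _ d wr) => // s hs; apply: d2r => //; lia.
  split=> //.
  - apply: (@half_window_bound _ d 0%N wr) => //; last by rewrite wr0.
    by move=> s hs sv; apply: d2r => //; lia.
  - apply: (@half_window_bound _ d (c - v)%N wl) => //; [lia| |by rewrite wl0].
    by move=> s hs sv; apply: d2l => //; lia.
rewrite IE -/N /window_form.
set A := \sum_(1 <= s < _) wr s * _ in Hr.
set B := \sum_(1 <= s < _) wl s * _ in Hl.
rewrite -/A -/B.
set hr := half_form d _ in Hr *; set hl := half_form d _ in Hl *.
have Hz : (d%:R + 1) * (w c * z c) ^+ 2 <= 56 * N * z c ^+ 2.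
  by rewrite exprMn mulrA ler_wpM2r ?sqr_ge0.
have T3 : (w c * z c + (A + B)) ^+ 2 <= 3 * ((w c * z c) ^+ 2 + A ^+ 2 + B ^+ 2).
  have := sqr_ge0 (w c * z c - A); have := sqr_ge0 (w c * z c - B); have := sqr_ge0 (A - B).
  clear; nra.
have N0 : 0 <= N by exact: nrm2_ge0.
have nz : 0 <= N * z c ^+ 2 by apply: mulr_ge0 => //; exact: sqr_ge0.
apply: le_trans (ler_wpM2l (ltW d1) T3) _.
rewrite [leLHS]mulrCA [X in 3 * X]mulrDr [X in 3 * (X + _)]mulrDr.
move: Hr Hl Hz nz; clear; move: (_ * A ^+ 2) (_ * B ^+ 2) (_ * (w c * z c) ^+ 2) => x y t.
by lra.
Qed.

End single_knot_window.

(** * Moving an isolated knot *)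

Section knot_moving.
Context {R : realType}.
Implicit Types (T t u a r q : nat) (g z : nat -> R).

(** The combination of ramps with a kink of size 1 at u that is supported by [a, a + r].
Subtracting a multiple of it moves the kink of a function from u to a and a + r. *)
Definition hat r a u t : R :=
  ramp u t - (r%:R - (u - a)%:R) / r%:R * ramp a t - (u - a)%:R / r%:R * ramp (a + r) t.

Lemma d2_hat r a u t : (0 < t)%N -> d2 (hat r a u) t =
  (t == u)%:R - (r%:R - (u - a)%:R) / r%:R * (t == a)%:R - (u - a)%:R / r%:R * (t == a + r)%N%:R.
Proof.
move=> t0; rewrite -!d2_ramp // /hat /d2.
move: (_ / r%:R) (_ / r%:R) => x y; ring.
Qed.

Lemma hat_support r a u t : (0 < r)%N -> (a <= u)%N -> (u <= a + r)%N ->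
  ~~ (a < t < a + r)%N -> hat r a u t = 0.
Proof.
move=> r0 uu ur ht; rewrite /hat /ramp; have [h|h] := leqP t a.
  have [-> -> ->] : [/\ t - u = 0, t - a = 0 & t - (a + r) = 0]%N by split; lia.
  by rewrite !mulr0 !subr0.
have h' : (a + r <= t)%N by lia.
have [-> ->] : (t - u = (t - (a + r)) + (r - (u - a)) /\ t - a = (t - (a + r)) + r)%N by split; lia.
rewrite !natrD (natrB _ (_ : u - a <= r)%N); last lia.
have : r%:R != 0 :> R by rewrite pnatr_eq0 -lt0n.
by move=> rn; field.
Qed.

(** The extreme value is at u, namely - (u - a) (r - (u - a)) / r. *)
Lemma normr_hat_le r a u t : (0 < r)%N -> (a <= u)%N -> (u <= a + r)%N ->
  `|hat r a u t| <= (u - a)%:R.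
Proof.
move=> r0 uu ur.
have [ht|/(hat_support r0 uu ur) ->] := boolP (a < t < a + r)%N; last by rewrite normr0.
have rR : 0 < r%:R :> R by rewrite ltr0n.
rewrite /hat /ramp (_ : t - (a + r) = 0)%N; last lia.
rewrite mulr0 subr0.
set p : R := (u - a)%:R; have p0 : 0 <= p by [].
have pr : p <= r%:R by rewrite ler_nat; lia.
have s0 : 0 <= (t - a)%:R :> R by [].
have sr : (t - a)%:R <= r%:R :> R by rewrite ler_nat; lia.
have [tu|tu] := leqP t u.
  rewrite (_ : t - u = 0)%N ?sub0r ?normrN; last lia.
  have sp : (t - a)%:R <= p by rewrite ler_nat; lia.
  rewrite ger0_norm ?mulr_ge0 ?invr_ge0 ?subr_ge0 //.
  rewrite mulrAC ler_pdivrMr //; move: s0 sr sp p0 pr rR; clear.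
  by move: (t - a)%:R r%:R p => s x y; nra.
have -> : (t - u)%:R = (t - a)%:R - p by rewrite /p -natrB; [congr (_%:R)|]; lia.
have -> : (t - a)%:R - p - (r%:R - p) / r%:R * (t - a)%:R = - (p * (1 - (t - a)%:R / r%:R)).
  by field; rewrite gt_eqF.
have q0 : 0 <= (t - a)%:R / r%:R :> R by rewrite divr_ge0.
have q1 : (t - a)%:R / r%:R <= 1 :> R by rewrite ler_pdivrMr // mul1r.
rewrite normrN ger0_norm; last by rewrite mulr_ge0 // subr_ge0.
by rewrite ler_piMr //; lra.
Qed.

Lemma nrm2_hat_le T r a u : (0 < r)%N -> (a <= u)%N -> (u <= a + r)%N ->
  nrm2 T (hat r a u) <= (u - a)%:R ^+ 2 * r%:R.
Proof.
move=> r0 uu ur; set p : R := (u - a)%:R.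
have h t : hat r a u t * hat r a u t <= p ^+ 2.
  rewrite -expr2 -[leLHS]real_normK ?num_real // ler_sqr ?nnegrE //.
  exact: normr_hat_le.
rewrite /nrm2 /ip.
apply: le_trans (_ : \sum_(a <= t < a + r) p ^+ 2 <= _); last first.
  by rewrite big_const_nat iter_addr_0 addKn mulr_natr.
apply: le_trans (_ : \sum_(1 <= t < T.+1 | (a < t < a + r)%N) p ^+ 2 <= _).
  rewrite [leRHS]big_mkcond; apply: ler_sum => t _.
  by case: ifPn => [_|/(hat_support r0 uu ur) ->]; rewrite ?mul0r.
rewrite -[leLHS]big_filter !big_const_seq !count_predT !iter_addr_0 ler_wpMn2l ?sqr_ge0 //.
apply: uniq_leq_size; first by rewrite filter_uniq ?iota_uniq.
move=> t; rewrite !mem_filter !mem_index_iota; lia.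
Qed.

(** The kink at u is isolated on the scale r, so kink^2 r^3 <= 24 |g|^2, whereas the hat has
squared norm at most q^2 r. The constant 5 exceeds the square root of 24. *)
Lemma move_knot T r q a u g : (r < u)%N -> (u + r <= T)%N -> (a <= u)%N -> (u - a <= q)%N ->
  (q <= r)%N -> (0 < r)%N ->
  (forall t, (u - r < t < u + r)%N -> t != u -> d2 g t = 0) ->
  `|d2 g u| * nrm T (hat r a u) <= 5 * (q%:R / r%:R) * nrm T g.
Proof.
move=> ru uT uu uq qr r0 hg.
have rR : 0 < r%:R :> R by rewrite ltr0n.
have K := @kink_le_nrm R T u r g _ uT hg.
have {}K : d2 g u ^+ 2 * r%:R ^+ 3 <= 24 * nrm2 T g by apply: K; rewrite r0.
have N := @nrm2_hat_le T r a u r0 uu ltac:(lia).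
rewrite -ler_sqr ?nnegrE ?mulr_ge0 ?nrm_ge0 ?invr_ge0 //.
rewrite !exprMn real_normK ?num_real // !sqr_nrm.
have pq : (u - a)%:R ^+ 2 <= q%:R ^+ 2 :> R by rewrite ler_sqr ?nnegrE // ler_nat.
apply: le_trans (_ : d2 g u ^+ 2 * (q%:R ^+ 2 * r%:R) <= _).
  rewrite ler_wpM2l ?sqr_ge0 //; apply: le_trans N _.
  by rewrite ler_wpM2r.
have -> : d2 g u ^+ 2 * (q%:R ^+ 2 * r%:R) = (q%:R * r%:R^-1) ^+ 2 * (d2 g u ^+ 2 * r%:R ^+ 3).
  by field; rewrite gt_eqF.
have q20 : 0 <= (q%:R * r%:R^-1) ^+ 2 :> R by exact: sqr_ge0.
apply: le_trans (ler_wpM2l q20 K) _.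
have n0 := nrm2_ge0 T g.
rewrite -exprMn.
have := mulr_ge0 q20 n0; move: ((q%:R / r%:R) ^+ 2) (nrm2 T g) => x y; clear; nra.
Qed.

End knot_moving.

(** * A union bound over lists *)

Section union_over_lists.
Context {R : realType} {A : eqType}.
Variables (T : nat) (As : seq A) (w : A -> R).
Hypotheses (w0 : forall a, 0 <= w a) (W : \sum_(a <- As) w a <= 1 / 2).

(** The weights of all lists of length n add up to at most 2^-n. In the induction the first
entry a is split off: the remaining lists contribute 2 M w a, and the sum of these over a is at
most M. *)
Lemma rare_lists N (M : R) (E : seq A -> (nat -> R) -> Prop) : 0 <= M ->
  (forall s, {subset s <= As} -> (size s <= N)%N -> rare T (M * \prod_(a <- s) w a) (E s)) ->
  rare T (2 * M) (fun z => exists s, [/\ {subset s <= As}, (size s <= N)%N & E s z]).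
Proof.
elim: N M E => [|N IH] M E M0 hE.
  have := hE [::] (fun a (h : a \in [::]) => ltac:(by [])) isT; rewrite big_nil mulr1 => H.
  apply: rare_mono H _ _ => [|z [[|a s] [_]]] //; lra.
have H0 := hE [::] (fun a (h : a \in [::]) => ltac:(by [])) isT.
rewrite big_nil mulr1 in H0.
have H1 : {in As, forall a, rare T (2 * (M * w a))
   (fun z => exists s, [/\ {subset s <= As}, (size s <= N)%N & E (a :: s) z])}.
  move=> a ain; apply: (IH (M * w a) (fun s => E (a :: s))); first by rewrite mulr_ge0.
  move=> s sA sN; have := hE (a :: s); rewrite big_cons mulrA; apply=> //.
  by move=> b; rewrite inE => /orP[/eqP->|/sA].
apply: rare_mono (rareU H0 (rare_bigU H1)) _ _.
  rewrite -mulr_sumr -mulr_sumr.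
  have : M * \sum_(a <- As) w a <= M * (1 / 2) by rewrite ler_wpM2l.
  lra.
move=> z [[|a s] [sA sN Es]]; first by left.
right; exists a; first by apply: sA; rewrite mem_head.
by exists s; split=> // b bs; apply: sA; rewrite inE bs orbT.
Qed.

End union_over_lists.

(** * Describing the knots of the estimate *)

Section configurations.
Context {R : realType}.
Variables (T d r q : nat) (tau : seq nat).
Implicit Types (c t k n i j : nat) (s : seq (R * seq nat)).

Definition in_window c : pred nat := fun t => (c - 2 * d <= t <= c + 2 * d)%N.

(** The true changepoints and the borders of their windows. With knots on both sides of each
border, a piecewise linear function stays piecewise linear when it is set to 0 on a window. *)
Definition fixed_knots := flatten
  [seq [:: c; (c - 2 * d)%N; (c - 2 * d).-1; (c + 2 * d)%N; (c + 2 * d).+1] | c <- tau].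

Definition around n c := iota (c - n) (2 * n).+1.

Definition window_points := flatten [seq around (2 * d) c | c <- tau].

(** One or two knots that can be chosen in about T ways: any single knot, or two knots of a window
at distance at most r. *)
Definition atoms1 : seq (R * seq nat) :=
  [seq (1, [:: i]) | i <- iota 1 T] ++
  flatten [seq [seq (1, [:: i; j]) | j <- around r i] | i <- window_points].

(** A knot of a window, of which there are about T^(2/3). *)
Definition atoms2 : seq (R * seq nat) := [seq (2 / 3, [:: i]) | i <- window_points].

(** Choices of which there are about T^(1/3): a knot within r of a changepoint, or two grid points
at distance r, which replace an isolated knot between them. *)
Definition atoms3 : seq (R * seq nat) :=
  [seq (1 / 3, [:: i]) | i <- flatten [seq around r c | c <- tau]] ++
  [seq (1 / 3, [:: j * q; j * q + r]%N) |
     j <- flatten [seq iota ((c - 2 * d) %/ q) (4 * d %/ q).+2 | c <- tau]].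

Definition atoms := atoms1 ++ atoms2 ++ atoms3.

(** In units of ln T, the logarithm of the number of choices that a list of atoms stands for. *)
Definition total_level s : R := \sum_(a <- s) a.1.
Definition knots_of s : seq nat := flatten [seq a.2 | a <- s].

Lemma mem_around n c t : (c - n <= t <= c + n)%N -> t \in around n c.
Proof. by rewrite mem_iota; lia. Qed.

Lemma mem_window_points c t : c \in tau -> in_window c t -> t \in window_points.
Proof.
by move=> ct ht; apply/flatten_mapP; exists c => //; apply: mem_around.
Qed.

Lemma size_flatten_const (A B : eqType) (f : A -> seq B) n (l : seq A) :
  (forall x, size (f x) = n) -> size (flatten [seq f x | x <- l]) = (size l * n)%N.
Proof. by move=> h; elim: l => //= x l IH; rewrite size_cat IH h mulSn. Qed.

Lemma size_around n c : size (around n c) = (2 * n).+1.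
Proof. by rewrite size_iota. Qed.

Lemma size_fixed_knots : size fixed_knots = (size tau * 5)%N.
Proof. exact: size_flatten_const. Qed.

Lemma size_window_points : size window_points = (size tau * (4 * d).+1)%N.
Proof.
rewrite (@size_flatten_const _ _ _ (4 * d).+1) // => c.
by rewrite size_around mulnA.
Qed.

Lemma size_atoms1 : size atoms1 = (T + size tau * (4 * d).+1 * (2 * r).+1)%N.
Proof.
rewrite size_cat size_map size_iota; congr addn.
rewrite (@size_flatten_const _ _ _ (2 * r).+1) ?size_window_points // => i.
by rewrite size_map size_around.
Qed.

Lemma size_atoms2 : size atoms2 = (size tau * (4 * d).+1)%N.
Proof. by rewrite size_map size_window_points. Qed.

Lemma size_atoms3 : size atoms3 = (size tau * (2 * r).+1 + size tau * (4 * d %/ q).+2)%N.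
Proof.
rewrite size_cat !size_map; congr addn.
  by rewrite (@size_flatten_const _ _ _ (2 * r).+1) // => c; rewrite size_around.
by rewrite (@size_flatten_const _ _ _ (4 * d %/ q).+2) // => c; rewrite size_iota.
Qed.

Lemma atom1_level a : a \in atoms1 -> a.1 = 1.
Proof.
by rewrite mem_cat => /orP[/mapP[i _ ->]//|/flatten_mapP[i _ /mapP[j _ ->]]].
Qed.

Lemma atom2_level a : a \in atoms2 -> a.1 = 2 / 3.
Proof. by move=> /mapP[i _ ->]. Qed.

Lemma atom3_level a : a \in atoms3 -> a.1 = 1 / 3.
Proof. by rewrite mem_cat => /orP[/mapP[i _ ->]|/mapP[i _ ->]]. Qed.

Lemma size_atom a : a \in atoms -> (size a.2 <= 2)%N.
Proof.
rewrite !mem_cat -!orbA => /or4P[/mapP[i _ ->]//|/flatten_mapP[i _ /mapP[j _ ->]]//|/mapP[i _ ->]//|].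
by move=> /orP[/mapP[i _ ->]|/mapP[i _ ->]].
Qed.

Lemma atom_level_ge (a : R * seq nat) : a \in atoms -> 1 / 3 <= a.1.
Proof.
have [h1 h2] : 1 / 3 <= (1 : R) /\ 1 / 3 <= (2 / 3 : R) by split; lra.
rewrite mem_cat => /orP[h|].
  by rewrite (atom1_level h).
rewrite mem_cat => /orP[h|h]; first by rewrite (atom2_level h).
by rewrite (atom3_level h).
Qed.

Lemma size_knots_of s : {subset s <= atoms} -> (size (knots_of s) <= 2 * size s)%N.
Proof.
elim: s => //= a s IH sA; rewrite /knots_of /= size_cat mulnS leq_add //.
  by apply: size_atom; apply: sA; rewrite mem_head.
by apply: IH => b bs; apply: sA; rewrite inE bs orbT.
Qed.

Lemma size_le_level s : {subset s <= atoms} -> (size s)%:R <= 3 * total_level s.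
Proof.
rewrite /total_level; elim: s => [|a s IH] sA; first by rewrite big_nil mulr0.
rewrite big_cons /= -natr1.
have := @atom_level_ge a (sA _ (mem_head _ _)).
have := IH (fun b bs => sA b ltac:(by rewrite inE bs orbT)).
lra.
Qed.

Lemma total_level_cat s1 s2 : total_level (s1 ++ s2) = total_level s1 + total_level s2.
Proof. by rewrite /total_level big_cat. Qed.

Lemma knots_of_cat s1 s2 : knots_of (s1 ++ s2) = knots_of s1 ++ knots_of s2.
Proof. by rewrite /knots_of map_cat flatten_cat. Qed.

Lemma knots_of_single (x : R) (l : seq nat) : knots_of [seq (x, [:: k]) | k <- l] = l.
Proof. by elim: l => //= k l IH; rewrite /knots_of /= -[flatten _]/(knots_of _) IH. Qed.

Lemma level_of_single (x : R) (l : seq nat) :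
  total_level [seq (x, [:: k]) | k <- l] = (size l)%:R * x.
Proof.
rewrite /total_level big_map /= big_const_seq count_predT iter_addr_0.
by rewrite mulr_natl.
Qed.

Lemma mem_fixed c : c \in tau ->
  [/\ c \in fixed_knots, (c - 2 * d)%N \in fixed_knots, (c - 2 * d).-1 \in fixed_knots,
      (c + 2 * d)%N \in fixed_knots & (c + 2 * d).+1 \in fixed_knots].
Proof.
by move=> ct; split; apply/flatten_mapP; exists c => //; rewrite !inE eqxx ?orbT.
Qed.

Hypotheses (tau_uniq : uniq tau) (tau_in : forall c, c \in tau -> (2 * d < c)%N && (c + 2 * d < T)%N).
Hypothesis tau_sep : forall c c', c \in tau -> c' \in tau -> (c < c')%N -> (c + 4 * d < c')%N.
Hypotheses (q0 : (0 < q)%N) (qr : (q <= r)%N).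

Lemma window_disjoint c c' t : c \in tau -> c' \in tau -> in_window c t -> in_window c' t -> c = c'.
Proof.
move=> h h'; rewrite /in_window => ht ht'.
have := tau_in h; have := tau_in h' => i1 i2.
have [cc|cc|//] := ltngtP c c'.
  by have := tau_sep h h' cc; lia.
by have := tau_sep h' h cc; lia.
Qed.

Lemma fixed_inside c t : c \in tau -> (c - 2 * d < t < c + 2 * d)%N -> t \in fixed_knots -> t = c.
Proof.
move=> ct ht /flatten_mapP[c' ct' tc'].
have := tau_in ct; have := tau_in ct' => i1 i2.
have [cc|cc|cc] := ltngtP c c'.
- have := tau_sep ct ct' cc; move: tc'; rewrite !inE => /or4P[/eqP|/eqP|/eqP|/orP[/eqP|/eqP]]; lia.
- have := tau_sep ct' ct cc; move: tc'; rewrite !inE => /or4P[/eqP|/eqP|/eqP|/orP[/eqP|/eqP]]; lia.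
- by subst c'; move: tc'; rewrite !inE => /or4P[/eqP|/eqP|/eqP|/orP[/eqP|/eqP]]; lia.
Qed.

Variables (khat : seq nat).
Hypotheses (khat_uniq : uniq khat) (khat_in : forall k, k \in khat -> (0 < k < T)%N).
Hypothesis khat_near : forall c, c \in tau -> exists2 u, u \in khat & (c - d <= u <= c + d)%N.

Definition knot_count c := count (in_window c) khat.

(** Inside the window of c, the function [ut] is described up to the correction p by atoms of
total level at most the number of estimated knots there minus one; that one knot is the
changepoint's own. The correction is small relative to [ut]. *)
Definition encoded c (ut z : nat -> R) (B : R) := exists s (p : nat -> R),
  [/\ {subset s <= atoms}, total_level s <= (knot_count c)%:R - 1,
      forall t, (0 < t < T)%N -> in_window c t -> t \notin knots_of s ++ fixed_knots ->
        d2 (fun t => ut t - p t) t = 0,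
      forall t, (0 < t)%N -> ~~ in_window c t -> d2 p t = 0 &
      nrm T p <= 5 * (q%:R / r%:R) * nrm T ut /\
      `|ip T z p| <= 5 * (q%:R / r%:R) * nrm T ut * B].

(** The case without a correction, in which the atoms list all the estimated knots. *)
Lemma encode_plain c ut z B F s : {subset F <= khat} ->
  spline T (mem (F ++ fixed_knots)) ut -> 0 <= B -> {subset s <= atoms} ->
  total_level s <= (knot_count c)%:R - 1 ->
  (forall k, k \in F -> in_window c k -> k \in knots_of s) -> encoded c ut z B.
Proof.
move=> Fk sut B0 sA sl hF; exists s, (fun=> 0); split=> //.
- move=> t ht wt; rewrite mem_cat negb_or => /andP[ts tf].
  rewrite d2B sut //; first by rewrite /d2; ring.
  by rewrite mem_cat negb_or tf andbT; apply: contra ts => tF; exact: hF.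
- by move=> t _ _; rewrite /d2; ring.
rewrite nrm0; have -> : ip T z (fun=> 0) = 0 by rewrite /ip big1 // => t _; rewrite mulr0.
by rewrite normr0 !mulr_ge0 ?nrm_ge0 ?invr_ge0.
Qed.

(** With three or more knots each is described at level 2 / 3, as 2 n / 3 <= n - 1. With two knots
u and v, of which u is the one close to c, there is level 1 to spend: on the pair when they are
close to each other, else 1 / 3 on u and 2 / 3 on v. Level 1 / 3 is enough for u when it is
within r of c; otherwise u is isolated and is moved to the grid. *)
Lemma encode_window c ut z B F : c \in tau -> {subset F <= khat} ->
  (knot_count c = 1%N -> forall k, k \in F -> ~~ in_window c k) ->
  spline T (mem (F ++ fixed_knots)) ut -> 0 <= B ->
  (forall a u, (a <= u <= T)%N -> `|ip T z (hat r a u)| <= B * nrm T (hat r a u)) ->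
  encoded c ut z B.
Proof.
move=> ct Fk F1 sut B0 noise.
have [u0 u0k u0c] := khat_near ct.
have /andP[cl cr] := tau_in ct.
pose Kc := [seq k <- khat | in_window c k].
have szK : size Kc = knot_count c by rewrite size_filter.
have memK k : k \in F -> in_window c k -> k \in Kc.
  by move=> /Fk kk kw; rewrite mem_filter kw.
have KA k : k \in Kc -> in_window c k by rewrite mem_filter => /andP[].
have u0K : u0 \in Kc by rewrite mem_filter u0k andbT /in_window; move: u0c; clear; lia.
have wpt k : k \in Kc -> k \in window_points by move=> /KA; exact: mem_window_points.
have in2 k : k \in window_points -> (2 / 3, [:: k]) \in atoms.
  by move=> h; rewrite !mem_cat map_f ?orbT.
have [n1|n1] := eqVneq (knot_count c) 1%N.
  apply: (@encode_plain c ut z B F [::]) => //.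
    by rewrite /total_level big_nil n1 subrr.
  by move=> k kF kw; have := F1 n1 k kF; rewrite kw.
have n0 : (0 < knot_count c)%N by rewrite -szK; case: (Kc) u0K.
(* 2 n / 3 <= n - 1 for n >= 3 *)
have [n3|n2] := leqP 3 (knot_count c).
  apply: (@encode_plain c ut z B F [seq (2 / 3, [:: k]) | k <- Kc]) => //.
  - by move=> a /mapP[k /wpt /in2 h ->].
  - rewrite level_of_single szK.
    have : 3 <= (knot_count c)%:R :> R by rewrite ler_nat.
    lra.
  - by move=> k kF kw; rewrite knots_of_single memK.
have {n0 n1 n2}n2 : knot_count c = 2%N.
  by apply/eqP; rewrite eqn_leq -ltnS n2 ltn_neqAle eq_sym n1 n0.
have [u [v [uv uK vK onlyuv uc]]] : exists u v, [/\ u != v, u \in Kc, v \in Kc,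
    forall k, k \in Kc -> k = u \/ k = v & (c - d <= u <= c + d)%N].
  have uniqK : uniq Kc by rewrite filter_uniq.
  move: szK; rewrite n2; case: (Kc) u0K uniqK => [|a [|b []]] //=.
  rewrite !inE => /orP[/eqP ua|/eqP ub]; rewrite andbT => ab _.
    exists a, b; rewrite !inE !eqxx orbT; split=> //; last by rewrite -ua.
    by move=> k; rewrite !inE => /orP[/eqP|/eqP]; [left|right].
  exists b, a; rewrite !inE !eqxx orbT; split=> //; last by rewrite -ub.
    by rewrite eq_sym.
  by move=> k; rewrite !inE => /orP[/eqP|/eqP]; [right|left].
have kF k : k \in F -> in_window c k -> k = u \/ k = v.
  by move=> h1 h2; apply: onlyuv; exact: memK.
have inv : (2 / 3, [:: v]) \in atoms by apply: in2; exact: wpt.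
have [close|far] := boolP (v \in around r u).
  apply: (@encode_plain c ut z B F [:: (1, [:: u; v])]) => //.
  - move=> a; rewrite inE => /eqP->; rewrite mem_cat; apply/orP; left.
    rewrite mem_cat; apply/orP; right; apply/flatten_mapP; exists u; first exact: wpt.
    by apply/mapP; exists v.
  - by rewrite /total_level big_seq1 n2 /=; lra.
  - by move=> k h1 h2; rewrite /knots_of /= !inE; case: (kF k h1 h2) => ->; rewrite eqxx ?orbT.
have [nearc|farc] := boolP (u \in around r c).
  apply: (@encode_plain c ut z B F [:: (1 / 3, [:: u]); (2 / 3, [:: v])]) => //.
  - move=> a; rewrite !inE => /orP[/eqP->|/eqP->//].
    rewrite !mem_cat; apply/orP; right; apply/orP; right; apply/orP; left.
    by apply/mapP; exists u => //; apply/flatten_mapP; exists c.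
  - by rewrite /total_level !big_cons big_nil n2 /=; lra.
  - by move=> k h1 h2; rewrite /knots_of /= !inE; case: (kF k h1 h2) => ->; rewrite eqxx ?orbT.
(* u is far from every other knot: move it to the grid *)
have Nuv : ~~ (u - r <= v <= u + r)%N by apply: contra far; exact: mem_around.
have Nuc : ~~ (c - r <= u <= c + r)%N by apply: contra farc; exact: mem_around.
have r0 : (0 < r)%N by exact: leq_trans q0 qr.
have wv := KA v vK; have wu := KA u uK.
rewrite /in_window in wv wu.
pose a := (u %/ q * q)%N.
have au : (a <= u)%N by exact: leq_divM.
have ua : (u - a < q)%N.
  by rewrite /a {1}(divn_eq u q) addKn ltn_mod.
(* because r < |u - c| <= d *)
have [ul ur] : (c - 2 * d < u - r)%N /\ (u + r < c + 2 * d)%N.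
  by move: uc Nuc wu cl r0; clear; lia.
have [ru uT] : (r < u)%N /\ (u + r < T)%N by move: ul ur cr; clear; lia.
pose k := d2 ut u.
have hin t : (u - r < t < u + r)%N -> t != u -> d2 ut t = 0.
  move=> ht tu; have tc : (c - 2 * d < t < c + 2 * d)%N by move: ht ul ur; clear; lia.
  apply: sut; first by move: tc cr; clear; lia.
  rewrite mem_cat negb_or; apply/andP; split.
    apply/negP => tF; have [||] := kF t tF; first by rewrite /in_window; move: tc; clear; lia.
      by move=> e; rewrite e eqxx in tu.
    by move=> e; move: ht Nuv; rewrite e; clear; lia.
  apply/negP => tf; have e := @fixed_inside c t ct tc tf.
  by move: Nuc ht; rewrite e; clear; lia.
exists [:: (1 / 3, [:: a; a + r]%N); (2 / 3, [:: v])], (fun t => k * hat r a u t).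
have MK : `|k| * nrm T (hat r a u) <= 5 * (q%:R / r%:R) * nrm T ut.
  by apply: move_knot => //; [exact: ltnW|exact: ltnW].
split.
- move=> b; rewrite !inE => /orP[/eqP->|/eqP->//].
  rewrite !mem_cat; do 3! (apply/orP; right).
  apply/mapP; exists (u %/ q)%N => //; apply/flatten_mapP; exists c => //.
  rewrite mem_iota; apply/andP; split.
    by apply: leq_div2r; case/andP: wu.
  apply: leq_ltn_trans (_ : (c - 2 * d + 4 * d) %/ q < _)%N.
    by apply: leq_div2r; move: wu cl; clear; lia.
  by have := leq_divDl q (c - 2 * d) (4 * d); rewrite addn1 !addnS ltnS.
- by rewrite /total_level !big_cons big_nil n2 /=; lra.
- move=> t ht wt; rewrite /knots_of /= !inE !negb_or => /and4P[ta tar tv tf].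
  rewrite d2B d2Z d2_hat; last by case/andP: ht.
  rewrite (negbTE ta) (negbTE tar) !mulr0 !subr0.
  have [->|tu] := eqVneq t u; first by rewrite mulr1 subrr.
  rewrite mulr0 subr0; apply: sut => //; rewrite mem_cat negb_or tf andbT.
  by apply/negP => tF; case: (kF t tF wt) => e; [rewrite e eqxx in tu|rewrite e eqxx in tv].
- move=> t t0 nw; rewrite d2Z d2_hat //.
  have [ta tu tar] : [/\ t == a = false, t == u = false & t == (a + r)%N = false].
    by split; apply/negP => /eqP e; move: nw; rewrite /in_window e;
      move: ul ur au ua qr; clear; lia.
  by rewrite ta tu tar !mulr0 !subr0 mulr0.
- rewrite nrmZ ipZr normrM; split=> //.
  apply: le_trans (_ : `|k| * (B * nrm T (hat r a u)) <= _).
    rewrite ler_wpM2l //; apply: noise; rewrite au /=.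
    by apply: leq_trans (leq_addr _ _) (ltnW uT).
  by rewrite mulrCA mulrC ler_wpM2r.
Qed.

Lemma sum_windows S t : uniq S -> {subset S <= tau} ->
  (\sum_(c <- S) in_window c t = has (in_window^~ t) S)%N.
Proof.
elim: S => [|c S IH] /=; first by rewrite big_nil.
move=> /andP[cS uS] Stau; rewrite big_cons IH //; last first.
  by move=> x xS; apply: Stau; rewrite inE xS orbT.
case: (boolP (in_window c t)) => //= wc.
rewrite (_ : has _ S = false) //; apply/negP => /hasP[c' c'S wc'].
move: cS; rewrite (@window_disjoint c c' t) ?c'S //; apply: Stau.
  by rewrite mem_head.
by rewrite inE c'S orbT.
Qed.

(** The windows are disjoint, so that each estimated knot is in at most one of them. *)
Lemma size_partition : (size khat = \sum_(c <- tau) knot_count c +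
  size [seq k <- khat | ~~ has (in_window^~ k) tau])%N.
Proof.
rewrite size_filter -(count_predC (fun k => has (in_window^~ k) tau) khat); congr addn.
rewrite /knot_count -[LHS]sum1_count big_mkcond /=.
under [RHS]eq_bigr do rewrite -sum1_count big_mkcond.
rewrite exchange_big; apply: eq_bigr => k _ /=.
rewrite -[LHS](_ : nat_of_bool (has (in_window^~ k) tau) = _); last by case: has.
by rewrite -sum_windows //; apply: eq_bigr => c _; case: in_window.
Qed.

(** The correction of one window has no kinks in the others, so that corrections add up. *)
Lemma encode_windows ut z B S : uniq S -> {subset S <= tau} ->
  {in S, forall c, encoded c ut z B} -> exists s (p : nat -> R),
  [/\ {subset s <= atoms}, total_level s <= \sum_(c <- S) ((knot_count c)%:R - 1),
      forall t, (0 < t < T)%N -> has (in_window^~ t) S -> t \notin knots_of s ++ fixed_knots ->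
        d2 (fun t => ut t - p t) t = 0,
      forall t, (0 < t)%N -> ~~ has (in_window^~ t) S -> d2 p t = 0 &
      nrm T p <= (size S)%:R * (5 * (q%:R / r%:R)) * nrm T ut /\
      `|ip T z p| <= (size S)%:R * (5 * (q%:R / r%:R)) * nrm T ut * B].
Proof.
elim: S => [|c S IH] /=.
  move=> _ _ _; exists [::], (fun=> 0); split=> //.
  - by rewrite /total_level !big_nil.
  - by move=> t _ _; rewrite /d2; ring.
  rewrite nrm0 !mul0r; have -> : ip T z (fun=> 0) = 0 by rewrite /ip big1 // => t _; rewrite mulr0.
  by rewrite normr0.
move=> /andP[cS uS] Stau enc.
have ctau : c \in tau by apply: Stau; rewrite mem_head.
have {}Stau : {subset S <= tau} by move=> x xS; apply: Stau; rewrite inE xS orbT.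
have [s1 [p1 [a1 l1 b1 c1 [n1 i1]]]] := enc c (mem_head _ _).
have [|s2 [p2 [a2 l2 b2 c2 [n2 i2]]]] := IH uS Stau.
  by move=> x xS; apply: enc; rewrite inE xS orbT.
have disj t : in_window c t -> ~~ has (in_window^~ t) S.
  move=> wc; apply/negP => /hasP[c' c'S wc'].
  by move: cS; rewrite (@window_disjoint c c' t) ?c'S //; exact: Stau.
exists (s1 ++ s2), (fun t => p1 t + p2 t); split.
- by move=> a; rewrite mem_cat => /orP[/a1|/a2].
- by rewrite total_level_cat big_cons lerD.
- move=> t ht; rewrite knots_of_cat !mem_cat !negb_or -andbA => hw /and3P[t1 t2 t3].
  have e : d2 (fun t => ut t - (p1 t + p2 t)) t = d2 ut t - d2 p1 t - d2 p2 t.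
    by rewrite /d2; ring.
  have t0 : (0 < t)%N by case/andP: ht.
  rewrite e; case/orP: hw => [wc|wS].
    rewrite (c2 t t0 (disj t wc)) subr0 -d2B b1 //.
    by rewrite mem_cat negb_or t1.
  have nc : ~~ in_window c t by apply: contraL wS => /disj.
  rewrite (c1 t t0 nc) subr0 -d2B b2 //.
  by rewrite mem_cat negb_or t2.
- move=> t t0; rewrite negb_or => /andP[wc wS].
  by rewrite d2D c1 // c2 // addr0.
- rewrite ipDr -natr1; split.
    apply: le_trans (nrmD _ _ _) _; rewrite [X in _ <= X](_ : _ =
      5 * (q%:R / r%:R) * nrm T ut + (size S)%:R * (5 * (q%:R / r%:R)) * nrm T ut).
      exact: lerD.
    by ring.
  apply: le_trans (ler_normD _ _) _; rewrite [X in _ <= X](_ : _ =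
    5 * (q%:R / r%:R) * nrm T ut * B + (size S)%:R * (5 * (q%:R / r%:R)) * nrm T ut * B).
    exact: lerD.
  by ring.
Qed.

Lemma double_le_add (a x y : R) : 0 <= x -> 0 <= y -> a ^+ 2 <= x * y -> 2 * a <= x + y.
Proof.
move=> x0 y0 h; have [a0|a0] := leP a 0; first lra.
rewrite -ler_sqr ?nnegrE; [|lra|lra].
have := sqr_ge0 (x - y); nra.
Qed.

(** The bound on a quadratic in l for all l is a bound on its discriminant. *)
Lemma sqr_le_of_quadratic (a n x : R) : 0 <= n ->
  (forall l, 2 * (l * a) - l ^+ 2 * n <= x) -> a ^+ 2 <= x * n.
Proof.
move=> n0 h; have [nz|nz] := eqVneq n 0.
  rewrite nz mulr0; have [->|a0] := eqVneq a 0; first by rewrite expr0n.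
  have := h ((x + 1) / a); rewrite nz mulfVK // mulr0; have := h 0; lra.
have n1 : 0 < n by rewrite lt_def nz.
have := h (a / n); have -> : 2 * (a / n * a) - (a / n) ^+ 2 * n = a ^+ 2 / n.
  by field.
by rewrite ler_pdivrMr.
Qed.

(** Split u into its restrictions to the windows with a single estimated knot, which are controlled
by [single_knot_window], and the rest [ut]. The rest is g + p, where g is described by atoms
of total level at most the number of extra changepoints and p is the sum of the corrections,
smaller than [ut] by the factor Th. The hypothesis on lists of atoms bounds <z, g>^2 / |g|^2,
and a part Th of |ut|^2 is given up to absorb p. *)
Lemma overfit_bound u z B x0 x1 N : spline T (mem (khat ++ tau)) u -> 0 <= B ->
  (forall a u, (a <= u <= T)%N -> `|ip T z (hat r a u)| <= B * nrm T (hat r a u)) ->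
  0 <= x0 -> 0 <= x1 -> (3 * size khat <= N)%N ->
  (forall s, {subset s <= atoms} -> (size s <= N)%N ->
     forall g, spline T (mem (knots_of s ++ fixed_knots)) g ->
     2 * ip T z g - nrm2 T g <= x0 + x1 * total_level s) ->
  let Th := (size tau)%:R * (5 * (q%:R / r%:R)) in Th < 1 ->
  2 * ip T z u - nrm2 T u <= \sum_(c <- tau) 504 / (d%:R + 1) * window_form c d z +
    (x0 + x1 * ((size khat)%:R - (size tau)%:R)) * ((1 + Th) ^+ 2 / (1 - Th)) + Th * B ^+ 2.
Proof.
move=> su B0 noise x00 x10 hN chi Th Th1.
pose S1 := [seq c <- tau | knot_count c == 1%N].
have uS1 : uniq S1 by rewrite filter_uniq.
have S1tau : {subset S1 <= tau} by move=> c; rewrite mem_filter => /andP[].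
pose ut t : R := if has (in_window^~ t) S1 then 0 else u t.
have res c t : restrict (in_window c) u t = (in_window c t)%:R * u t.
  by rewrite /restrict; case: in_window; rewrite ?mul1r ?mul0r.
have split1 t : u t = ut t + \sum_(c <- S1) restrict (in_window c) u t.
  under eq_bigr do rewrite res.
  rewrite -mulr_suml -natr_sum (sum_windows _ uS1 S1tau) /ut.
  by case: has; rewrite ?mul1r ?mul0r ?add0r ?addr0.
have split2 t : u t * u t = ut t * ut t +
    \sum_(c <- S1) restrict (in_window c) u t * restrict (in_window c) u t.
  have -> : \sum_(c <- S1) restrict (in_window c) u t * restrict (in_window c) u t =
      \sum_(c <- S1) (in_window c t)%:R * (u t * u t).
    apply: eq_bigr => c _; rewrite res.
    by case: in_window; rewrite ?mul1r ?mul0r.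
  rewrite -mulr_suml -natr_sum (sum_windows _ uS1 S1tau) /ut.
  by case: has; rewrite ?mul1r ?mul0r ?add0r ?addr0.
have ipE : ip T z u = ip T z ut + \sum_(c <- S1) ip T z (restrict (in_window c) u).
  rewrite -ip_sumr -ipDr; apply: eq_ip => // t _; exact: split1.
have nE : nrm2 T u = nrm2 T ut + \sum_(c <- S1) nrm2 T (restrict (in_window c) u).
  rewrite /nrm2 /ip exchange_big -big_split; apply: eq_bigr => t _; exact: split2.
have wf0 c : 0 <= 504 / (d%:R + 1) * window_form c d z.
  apply: mulr_ge0; last exact: window_form_ge0.
  by apply: divr_ge0; [exact: ler0n|rewrite natr1; exact: ler0n].
have single c : c \in S1 ->
    2 * ip T z (restrict (in_window c) u) - nrm2 T (restrict (in_window c) u) <=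
    504 / (d%:R + 1) * window_form c d z.
  rewrite mem_filter => /andP[/eqP n1 ct].
  have [v vk vc] := khat_near ct.
  have /andP[cl cr] := tau_in ct.
  have only k : k \in khat -> in_window c k -> k = v.
    move=> kk kw; have vw : in_window c v by rewrite /in_window; move: vc; clear; lia.
    have : size [seq k <- khat | in_window c k] = 1%N by rewrite size_filter.
    have : k \in [seq k <- khat | in_window c k] by rewrite mem_filter kw.
    have : v \in [seq k <- khat | in_window c k] by rewrite mem_filter vw.
    move: [seq k <- khat | in_window c k] => l; case: l => [|a [|]] //.
    by rewrite !inE => /eqP-> /eqP->.
  have hw t : (c - 2 * d < t < c + 2 * d)%N -> t != c -> t != v -> d2 u t = 0.
    move=> ht tc tv; have tw : in_window c t by rewrite /in_window; move: ht; clear; lia.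
    apply: su; first by move: ht cr; clear; lia.
    rewrite mem_cat negb_or; apply/andP; split.
      by apply/negP => tk; rewrite (only t tk tw) eqxx in tv.
    apply/negP => ttau; have := @window_disjoint c t t ct ttau tw.
    move=> /(_ _) e; move: tc; rewrite -e ?eqxx // /in_window; clear; lia.
  have := @single_knot_window R T c d u v cl (ltnW cr) vc hw z.
  rewrite -/(in_window c) -/(restrict (in_window c) u).
  have d1 : 0 < d%:R + 1 :> R by rewrite natr1 ltr0n.
  move=> h; rewrite lerBlDr; apply: double_le_add => //; first exact: nrm2_ge0.
  have -> : 504 / (d%:R + 1) * window_form c d z * nrm2 T (restrict (in_window c) u) =
    504 * window_form c d z * nrm2 T (restrict (in_window c) u) / (d%:R + 1).
    by move: (504 : R) => K; field; rewrite gt_eqF.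
  by rewrite ler_pdivlMr // mulrC.
have main : 2 * ip T z ut - nrm2 T ut <=
  (x0 + x1 * ((size khat)%:R - (size tau)%:R)) * ((1 + Th) ^+ 2 / (1 - Th)) + Th * B ^+ 2.
  pose F := [seq k <- khat | ~~ has (in_window^~ k) S1].
  have Fk : {subset F <= khat} by move=> k; rewrite mem_filter => /andP[].
  have sut : spline T (mem (F ++ fixed_knots)) ut.
    move=> t ht; rewrite mem_cat negb_or => /andP[tF tf].
    have tt c : c \in tau -> t != c.
      by move=> ct; apply: contra tf => /eqP->; have [] := mem_fixed ct.
    (* away from the fixed knots, neighbouring times lie in the same windows *)
    have out i : (i = t.-1 \/ i = t.+1) -> has (in_window^~ i) S1 = has (in_window^~ t) S1.
      move=> hs; apply/hasP/hasP => -[c cS wc]; exists c => //;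
        have [f1 f2 f3 f4 f5] := mem_fixed (S1tau _ cS);
        have /andP[cl cr] := tau_in (S1tau _ cS).
        have g3 : t != (c - 2 * d).-1 by apply: contra tf => /eqP->.
        have g5 : t != (c + 2 * d).+1 by apply: contra tf => /eqP->.
        by move: wc hs g3 g5 cl ht; rewrite /in_window; clear; lia.
      have g2 : t != (c - 2 * d)%N by apply: contra tf => /eqP->.
      have g4 : t != (c + 2 * d)%N by apply: contra tf => /eqP->.
      by move: wc hs g2 g4 cl ht; rewrite /in_window; clear; lia.
    rewrite /d2 /ut (out t.-1) ?(out t.+1); [|by right|by left].
    case: (boolP (has _ S1)) => hS; first by ring.
    have := su t ht; rewrite /d2; apply; rewrite mem_cat negb_or; apply/andP; split.
      by apply: contra tF => tk; rewrite mem_filter hS.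
    by apply/negP => ttau; have := tt t ttau; rewrite eqxx.
  have enc : {in tau, forall c, encoded c ut z B}.
    move=> c ct; apply: (@encode_window c ut z B F) => //.
    move=> n1 k; rewrite mem_filter => /andP[/hasPn h _]; apply: h.
    by rewrite mem_filter n1 eqxx.
  have [s [p [sA sl sw so [pn pz]]]] := encode_windows tau_uniq (fun c h => h) enc.
  rewrite -/Th in pn pz.
  pose Fo := [seq k <- khat | ~~ has (in_window^~ k) tau].
  pose s' := s ++ [seq (1, [:: k]) | k <- Fo].
  have s'A : {subset s' <= atoms}.
    move=> a; rewrite mem_cat => /orP[/sA//|/mapP[k]].
    rewrite mem_filter => /andP[_ /khat_in kT] ->.
    rewrite mem_cat; apply/orP; left; rewrite mem_cat; apply/orP; left.
    by apply/mapP; exists k => //; rewrite mem_iota; move: kT; clear; lia.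
  have s'l : total_level s' <= (size khat)%:R - (size tau)%:R.
    rewrite total_level_cat level_of_single mulr1 size_partition natrD natr_sum.
    have E : \sum_(c <- tau) ((knot_count c)%:R - 1) = \sum_(c <- tau) (knot_count c)%:R - (size tau)%:R :> R.
      by rewrite sumrB big_const_seq count_predT iter_addr_0.
    rewrite E in sl; rewrite -/Fo; lra.
  have lev0 : 0 <= total_level s'.
    rewrite /total_level big_seq; apply: sumr_ge0 => a /s'A /atom_level_ge h.
    by apply: le_trans h; lra.
  have s'N : (size s' <= N)%N.
    apply: leq_trans hN; rewrite -(ler_nat R) natrM.
    apply: le_trans (size_le_level s'A) _.
    have : 0 <= (size tau)%:R :> R by [].
    lra.
  pose g t := ut t - p t.
  have sg : spline T (mem (knots_of s' ++ fixed_knots)) g.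
    move=> t ht; rewrite knots_of_cat knots_of_single !mem_cat !negb_or -andbA => /and3P[t1 t2 t3].
    case: (boolP (has (in_window^~ t) tau)) => hw.
      by apply: sw => //; rewrite mem_cat negb_or t1.
    have t0 : (0 < t)%N by case/andP: ht.
    rewrite d2B (so t t0 hw) subr0; apply: sut => //.
    rewrite mem_cat negb_or t3 andbT; apply: contra t2 => tF.
    by rewrite mem_filter hw (Fk t tF).
  pose X := x0 + x1 * ((size khat)%:R - (size tau)%:R).
  have Xs : x0 + x1 * total_level s' <= X by rewrite lerD2l ler_wpM2l.
  have X0 : 0 <= X by apply: le_trans Xs; rewrite addr_ge0 // mulr_ge0.
  (* the multiples of g have the same knots, so the bound can be made homogeneous *)
  have zg : ip T z g ^+ 2 <= X * nrm2 T g.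
    apply: sqr_le_of_quadratic; first exact: nrm2_ge0.
    move=> l; apply: le_trans Xs.
    have := chi s' s'A s'N (fun t => l * g t) _.
    rewrite ipZr nrm2Z; apply.
    by move=> t ht tk; rewrite d2Z sg ?mulr0.
  rewrite -/X.
  have Th0 : 0 <= Th by rewrite !mulr_ge0 ?invr_ge0.
  have M0 := nrm_ge0 T ut.
  have gM : nrm T g <= (1 + Th) * nrm T ut.
    have -> : nrm T g = nrm T (fun t => ut t + (-1) * p t).
      by rewrite /nrm /nrm2; congr Num.sqrt; apply: eq_ip => t _; rewrite /g mulN1r.
    by apply: le_trans (nrmD _ _ _) _; rewrite nrmZ normrN1 mul1r; lra.
  have gM2 : nrm2 T g <= ((1 + Th) * nrm T ut) ^+ 2.
    rewrite -sqr_nrm ler_sqr ?nnegrE ?nrm_ge0 //; apply: mulr_ge0 => //; lra.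
  have Y0 : 0 <= X * ((1 + Th) ^+ 2 / (1 - Th)).
    by rewrite mulr_ge0 // divr_ge0 ?sqr_ge0 // subr_ge0 ltW.
  have a2 : 2 * ip T z g <= X * ((1 + Th) ^+ 2 / (1 - Th)) + (1 - Th) * nrm2 T ut.
    apply: double_le_add => //.
      by rewrite mulr_ge0 ?nrm2_ge0 // subr_ge0 ltW.
    apply: le_trans zg _; apply: le_trans (ler_wpM2l X0 gM2) _.
    rewrite exprMn sqr_nrm le_eqVlt; apply/orP; left; apply/eqP.
    by field; rewrite gt_eqF // subr_gt0.
  have -> : ip T z ut = ip T z g + ip T z p.
    by rewrite -ipDr; apply: eq_ip => // t _; rewrite /g subrK.
  have pz' := le_trans (ler_norm _) pz.
  have : 2 * (Th * nrm T ut * B) <= Th * nrm2 T ut + Th * B ^+ 2.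
    rewrite -sqr_nrm -mulrDr.
    have -> : 2 * (Th * nrm T ut * B) = Th * (2 * (nrm T ut * B)) by ring.
    by apply: ler_wpM2l => //; have := sqr_ge0 (nrm T ut - B); nra.
  move: a2 pz'; move: (X * _) (nrm2 T ut) => y n; clear; nra.
have sumS : \sum_(c <- S1) (2 * ip T z (restrict (in_window c) u) - nrm2 T (restrict (in_window c) u)) <=
    \sum_(c <- tau) 504 / (d%:R + 1) * window_form c d z.
  apply: le_trans (_ : \sum_(c <- S1) 504 / (d%:R + 1) * window_form c d z <= _).
    by rewrite !big_seq; apply: ler_sum => c; exact: single.
  rewrite big_filter [leLHS]big_mkcond; apply: ler_sum => c _.
  by case: ifP.
have E2 : \sum_(c <- S1) 2 * ip T z (restrict (in_window c) u) =
  2 * \sum_(c <- S1) ip T z (restrict (in_window c) u) by rewrite mulr_sumr.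
rewrite sumrB E2 in sumS.
rewrite ipE nE mulrDr; move: sumS main; clear.
move: (\sum_(_ <- S1) ip _ _ _) (\sum_(_ <- S1) nrm2 _ _) (\sum_(_ <- tau) _) => a b e.
move: (_ * (_ / _)) (Th * _) (ip T z ut) (nrm2 T ut) => f g h k; lra.
Qed.

End configurations.

(** * Exceptional noise *)

Section noise_events.
Context {R : realType}.
Implicit Types (T t c h a u r d q n m : nat) (z g : nat -> R) (B C s x : R) (tau : seq nat).

(** Finitely many linear functionals of z stay below B times their norm. The value of z at t is
one of them; it is used to bound the norm of z. *)
Definition regular T r B z := [/\ forall t, (1 <= t <= T)%N -> `|z t| <= B,
  forall c h, (c <= T)%N -> (h <= T)%N -> `|ip T (wedge c h) z| <= B * nrm T (wedge c h) &
  forall a u, (a <= T)%N -> (u <= T)%N -> `|ip T (hat r a u) z| <= B * nrm T (hat r a u)].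

(** There are at most 3 (T + 1)^2 functionals, and [rare_linear] applies to each. *)
Lemma rare_irregular T r B : 0 <= B ->
  rare T (6 * T.+1%:R ^+ 2 * expR (- (B ^+ 2 / 2))) (fun z => ~ regular T r B z).
Proof.
move=> B0; pose delta t : nat -> R := fun i => (i == t)%:R.
pose l := iota 0 T.+1.
pose V := [seq delta t | t <- l] ++ [seq wedge c h | c <- l, h <- l] ++
  [seq hat r a u | a <- l, u <- l].
have H : {in V, forall v, rare T (2 * expR (- (B ^+ 2 / 2))) (fun z => B * nrm T v < `|ip T v z|)}.
  by move=> v _; exact: rare_linear.
apply: rare_mono (rare_bigU H) _ _.
  rewrite big_const_seq count_predT iter_addr_0 size_cat size_cat size_map !size_allpairs size_iota.
  rewrite -[leLHS]mulr_natl mulrA ler_wpM2r ?expR_ge0 //.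
  rewrite -(natrX _ T.+1 2) -!natrM ler_nat.
  rewrite -mulnn; have := leq_pmulr T.+1 (ltn0Sn T).
  by move: (T.+1 * T.+1)%N (T.+1) => y x; clear; lia.
move=> z; apply: contra_notP => H1.
have nV v : v \in V -> `|ip T v z| <= B * nrm T v.
  by move=> vV; rewrite leNgt; apply/negP => h; apply: H1; exists v.
have inl t : (t <= T)%N -> t \in l by move=> tT; rewrite mem_iota.
split.
- move=> t ht; have := nV (delta t); rewrite mem_cat map_f ?inl //; last by case/andP: ht.
  move=> /(_ isT).
  have -> : nrm T (delta t) = 1 by rewrite /nrm /nrm2 ip_delta // /delta eqxx sqrtr1.
  by rewrite ip_delta // mulr1.
- move=> c h hc hh; apply: nV.
  rewrite mem_cat; apply/orP; right; rewrite mem_cat; apply/orP; left.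
  by apply/allpairsP; exists (c, h); split=> //; exact: inl.
- move=> a u ha hu; apply: nV.
  rewrite mem_cat; apply/orP; right; rewrite mem_cat; apply/orP; right.
  by apply/allpairsP; exists (a, u); split=> //; exact: inl.
Qed.

Lemma regular_nrm T r B z : regular T r B z -> B ^+ 2 <= T%:R -> nrm T z <= T%:R.
Proof.
move=> [h _ _] BT; rewrite -ler_sqr ?nnegrE ?nrm_ge0 // sqr_nrm /nrm2 /ip.
apply: le_trans (_ : \sum_(1 <= t < T.+1) T%:R <= _).
  apply: ler_sum_nat => t ht; apply: le_trans BT.
  have := h t ht => zB; rewrite -expr2 -[leLHS]real_normK ?num_real // ler_sqr ?nnegrE //.
  exact: le_trans zB.
by rewrite big_const_nat iter_addr_0 subn1 /= expr2 mulr_natr.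
Qed.

Lemma rare_windows T d tau x : 0 < x ->
  (forall c, c \in tau -> (2 * d < c)%N && (c + 2 * d < T)%N) ->
  rare T ((size tau)%:R * (504 * 640) / x)
    (fun z => x <= \sum_(c <- tau) 504 / (d%:R + 1) * window_form c d z).
Proof.
move=> x0 tau_in; apply: markov => //.
have d1 : 0 < d%:R + 1 :> R by rewrite natr1 ltr0n.
have H : {in tau, forall c, mean_le T (504 * 640)
    (fun z : nat -> R => 504 / (d%:R + 1) * window_form c d z)}.
  move=> c ct; have /andP[cl cr] := tau_in c ct.
  have K0 : 0 <= 504 / (d%:R + 1) :> R.
    by apply: divr_ge0; [exact: ler0n|exact: ltW].
  have H := mean_leZ K0 (@mean_le_window_form R T c d cl (ltnW cr)).
  apply: mean_le_mono H _ _ => [|z]; last exact: lexx.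
  by rewrite -mulrA ler_wpM2l ?ler0n // mulrCA mulVf ?mulr1 ?gt_eqF.
apply: mean_le_mono (mean_le_sum H) _ _ => [|z]; last exact: lexx.
by rewrite big_const_seq count_predT iter_addr_0 [leRHS]mulr_natl.
Qed.

(** An atom of level l lowers the probability of exceeding the threshold by exp (- y l), and its
at most two knots raise the dimension by 2, hence the factor C^2. *)
Definition atom_weight C y (a : R * seq nat) : R := C ^+ 2 * expR (- (y * a.1)).

(** For a fixed list of atoms this is [rare_chi_square] with threshold [x0 + x1 * total_level l].
The bound is a constant times the product of the weights of the atoms, so that [rare_lists]
gives the union over lists. *)
Lemma rare_configurations T d r q tau N s C x0 x1 : 0 <= s -> 1 <= C ->
  expR (s / 2) * \sum_(k <- iota 0 (T + T).+1)
    expR (- (s * (1 - s) * (k%:R - T%:R) ^+ 2 / 2)) <= C ->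
  \sum_(a <- atoms T d r q tau) atom_weight C (s * x1 / 2) a <= 1 / 2 ->
  rare T (2 * (expR (- (s * x0 / 2)) * C ^+ (size tau * 5).+2))
    (fun z => nrm T z <= T%:R /\ exists l, [/\ {subset l <= atoms T d r q tau},
       (size l <= N)%N & exists2 g, spline T (mem (knots_of l ++ fixed_knots d tau)) g &
       x0 + x1 * total_level l < 2 * ip T z g - nrm2 T g]).
Proof.
move=> s0 C1 CS W.
have C0 : 0 <= C by apply: le_trans C1.
have w0 (a : R * seq nat) : 0 <= atom_weight C (s * x1 / 2) a.
  by rewrite mulr_ge0 ?expR_ge0 ?exprn_ge0.
pose E (l : seq (R * seq nat)) z := nrm T z <= T%:R /\
  exists2 g, spline T (mem (knots_of l ++ fixed_knots d tau)) g &
       x0 + x1 * total_level l < 2 * ip T z g - nrm2 T g.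
have M0 : 0 <= expR (- (s * x0 / 2)) * C ^+ (size tau * 5).+2.
  by rewrite mulr_ge0 ?expR_ge0 ?exprn_ge0.
have H := @rare_lists R _ T (atoms T d r q tau) _ w0 W N _ E M0.
have {}H := H _.
apply: rare_mono (H _) _ _ => //; last first.
  by move=> z [zT [l [la ln g]]]; exists l; split.
move=> l la ln; rewrite /E.
have CH := @rare_chi_square R T s (x0 + x1 * total_level l) C T
  (spline_basis (knots_of l ++ fixed_knots d tau)) s0 C1 CS.
apply: rare_mono CH _ _; last first.
  move=> z [zT [g sg hg]]; split=> //; exists g => //; exact: spline_in_span.
have -> : \prod_(a <- l) atom_weight C (s * x1 / 2) a =
    C ^+ (2 * size l) * expR (- (s * x1 / 2 * total_level l)).
  rewrite /total_level big_split /= big_const_seq count_predT exprM.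
  rewrite -[X in X * _]/(iter _ _ _); congr (_ * _).
    by rewrite iter_mulr_1.
  by rewrite -expR_sum mulr_sumr sumrN.
rewrite size_spline_basis size_cat size_fixed_knots.
have -> : expR (- (s * (x0 + x1 * total_level l) / 2)) =
   expR (- (s * x0 / 2)) * expR (- (s * x1 / 2 * total_level l)).
  by rewrite -expRD; congr expR; field.
have -> : expR (- (s * x0 / 2)) * C ^+ (size tau * 5).+2 *
    (C ^+ (2 * size l) * expR (- (s * x1 / 2 * total_level l))) =
    expR (- (s * x0 / 2)) * expR (- (s * x1 / 2 * total_level l)) *
    C ^+ ((size tau * 5).+2 + 2 * size l).
  by rewrite exprD; ring.
rewrite ler_wpM2l ?mulr_ge0 ?expR_ge0 // ler_weXn2l //.
rewrite -addnS -addnS addnC leq_add2l.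
exact: (size_knots_of la).
Qed.

End noise_events.

(** * Spacings of the changepoints *)

Section spacing.
Context {R : realType}.
Implicit Types (T t c i j k : nat) (tau : seq nat) (theta : nat -> R).

Lemma min_spacing_le T tau j : (1 <= j <= (size tau).+1)%N ->
  (min_spacing T tau <= spacing T tau j)%N.
Proof.
move=> hj; have : j \in index_iota 1 (size tau).+2 by rewrite mem_index_iota ltnS.
rewrite /min_spacing; elim: (index_iota _ _) => // i l IH.
rewrite inE big_cons => /orP[/eqP<-|/IH h]; first exact: geq_minl.
exact: leq_trans (geq_minr _ _) h.
Qed.

Lemma min_jump_le T tau theta j : (1 <= j <= size tau)%N ->
  min_jump T tau theta <= jump T tau theta j.
Proof.
move=> hj; have : j \in index_iota 1 (size tau).+1 by rewrite mem_index_iota ltnS.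
rewrite /min_jump; elim: (index_iota _ _) => // i l IH.
by rewrite inE big_cons ge_min => /orP[/eqP<-|/IH ->]; rewrite ?lexx ?orbT.
Qed.

Lemma min_jump_ge0 T tau theta : 0 <= min_jump T tau theta.
Proof.
rewrite /min_jump; elim/big_ind: _ => [|a b ha hb|j _]; rewrite ?normr_ge0 //.
by rewrite le_min ha.
Qed.

Lemma max_error_le T tau theta tauh (b : R) : 0 <= b ->
  (forall j, (1 <= j <= size tau)%N ->
    `| (knot T tauh j)%:R - (knot T tau j)%:R | ^+ 3 * jump T tau theta j ^+ 2 <= b) ->
  max_error T tau theta tauh <= b.
Proof.
move=> b0 h; rewrite /max_error big_nat.
by apply: (big_ind (fun y => y <= b)) => // y w hy hw; rewrite ge_max hy.
Qed.

Lemma knot_gap T tau i j : is_changepoints T tau -> (i < j <= (size tau).+1)%N ->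
  (knot T tau i + min_spacing T tau <= knot T tau j)%N.
Proof.
move=> cp /andP[ij jm].
have := @min_spacing_le T tau i.+1 ltac:(lia); rewrite /spacing /=.
have := @knot_ltnS T tau i cp ltac:(lia).
have := @knot_le T tau i.+1 j cp ltac:(lia).
lia.
Qed.

Lemma changepoint_gap T tau c c' : is_changepoints T tau -> c \in tau -> c' \in tau ->
  (c < c')%N -> (c + min_spacing T tau <= c')%N.
Proof.
move=> cp /(@mem_knot T) [i hi <-] /(@mem_knot T) [j hj <-] ij.
apply: knot_gap => //; rewrite ltnNge; apply/andP; split; last by lia.
apply/negP => ji; have := @knot_le T tau j i cp ltac:(lia).
lia.
Qed.

Lemma changepoint_bounds T tau c : is_changepoints T tau -> c \in tau ->
  (knot T tau 1 <= c)%N /\ (min_spacing T tau <= c)%N /\ (c + min_spacing T tau <= T)%N.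
Proof.
move=> cp /(@mem_knot T) [i hi <-]; split.
  by apply: knot_le => //; lia.
split.
  by have := @knot_gap T tau 0 i cp ltac:(lia); rewrite knot0.
by have := @knot_gap T tau i (size tau).+1 cp ltac:(lia); rewrite knot_last.
Qed.

Lemma min_spacing_gt0 T tau : is_changepoints T tau -> (0 < min_spacing T tau)%N.
Proof.
move=> cp; rewrite /min_spacing big_nat.
have h j : (1 <= j < (size tau).+2)%N -> (0 < spacing T tau j)%N.
  by case: j => // j hj; rewrite /spacing subn_gt0 knot_ltnS.
elim/big_ind: _ => // [|x y hx hy]; first by apply: h; lia.
by rewrite leq_min hx.
Qed.

End spacing.

(** * Localisation *)

Section localisation_of_changes.
Context {R : realType}.
Implicit Types (T t j r : nat) (tau tauh : seq nat) (theta f z x : nat -> R).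

(** With beta = (2 + eps) L and B^2 = 6 L, the condition of [detect_change] asks for
kink^2 h^3 > 48 (1 + 16 L + 5 eps L), and 1 <= 2 L. *)
Definition detection_constant (eps : R) : R := 48 * (18 + 5 * eps).

(** Take h least with jump^2 h^3 at least K L, where K is the detection constant and jumps are in
units of sigma, and let e = h - 1. Then jump^2 e^3 < K L. The lower bound 1024 K L = 2 8^3 K L for
delta^3 jump^2 gives 8 e < delta, so that the window of half-width h contains no other
changepoint, and the lower bound on jump^2 T^2 gives e^3 <= T^2. *)
Lemma localise (eps sigma Lam B : R) T r tau tauh theta f z x j :
  0 < eps -> 0 < sigma -> 1 <= Lam -> 0 <= B -> B ^+ 2 = 6 * Lam ->
  is_changepoints T tau -> (1 < knot T tau 1)%N -> is_signal T tau theta f ->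
  (forall t, (1 <= t <= T)%N -> x t = f t + sigma * z t) ->
  1024 * detection_constant eps * sigma ^+ 2 * Lam <=
    (min_spacing T tau)%:R ^+ 3 * min_jump T tau theta ^+ 2 ->
  detection_constant eps * sigma ^+ 2 * Lam / T%:R ^+ 2 <= min_jump T tau theta ^+ 2 ->
  regular T r B z -> is_minimiser sigma ((2 + eps) * Lam) T x tauh ->
  (1 <= j <= size tau)%N -> exists u e, [/\ u \in tauh,
  (knot T tau j - e <= u <= knot T tau j + e)%N, (8 * e < min_spacing T tau)%N,
  (e ^ 3 <= T ^ 2)%N &
  e%:R ^+ 3 * jump T tau theta j ^+ 2 <= 1024 * detection_constant eps * sigma ^+ 2 * Lam].
Proof.
move=> eps0 sigma0 Lam1 B0 B2 cp tau1 sig xE spacing_large jump_large reg opt hj.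
have [F [sF fF dF]] := signal_spline sigma0 cp sig.
pose c := knot T tau j; pose dl := min_spacing T tau.
have ct : c \in tau by exact: knot_mem.
have [c1 [dlc cdl]] := changepoint_bounds cp ct.
rewrite -/dl in dlc cdl.
have K0 : 0 < detection_constant eps.
  by rewrite /detection_constant; move: eps0; clear; lra.
set K := detection_constant eps in K0 spacing_large jump_large *.
have s2 : 0 < sigma ^+ 2 by rewrite exprn_gt0.
pose D := `|d2 F c|.
have DE : jump T tau theta j = D * sigma by rewrite /D dF // mulfVK // gt_eqF.
have D0 : 0 <= D by exact: normr_ge0.
have mj : min_jump T tau theta ^+ 2 <= D ^+ 2 * sigma ^+ 2.
  rewrite -exprMn -DE ler_sqr ?nnegrE ?min_jump_ge0 ?normr_ge0 //; exact: min_jump_le.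
have L0 : 0 < Lam by lra.
have KL0 : 0 < K * Lam by rewrite mulr_gt0.
have dl3 : 0 <= dl%:R ^+ 3 :> R by rewrite exprn_ge0.
have big1 : 1024 * (K * Lam) <= dl%:R ^+ 3 * D ^+ 2.
  rewrite -(ler_pM2r s2).
  have -> : 1024 * (K * Lam) * sigma ^+ 2 = 1024 * K * sigma ^+ 2 * Lam by ring.
  by apply: le_trans spacing_large _; rewrite -[leRHS]mulrA; exact: ler_wpM2l.
have T0 : (0 < T)%N by move: c1 cdl tau1; clear; lia.
have TR : 0 < T%:R ^+ 2 :> R by rewrite exprn_gt0 // ltr0n.
have big2 : K * Lam <= T%:R ^+ 2 * D ^+ 2.
  have h := le_trans jump_large mj; rewrite ler_pdivrMr // in h.
  rewrite -(ler_pM2r s2).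
  have -> : K * Lam * sigma ^+ 2 = K * sigma ^+ 2 * Lam by ring.
  have -> : T%:R ^+ 2 * D ^+ 2 * sigma ^+ 2 = D ^+ 2 * sigma ^+ 2 * T%:R ^+ 2 by ring.
  exact: h.
have dl0 : (0 < dl)%N by exact: min_spacing_gt0.
have ex : exists h, (0 < h)%N && (K * Lam <= h%:R ^+ 3 * D ^+ 2).
  by exists dl; rewrite dl0 /=; move: big1 KL0; clear; lra.
case: (ex_minnP ex) => h /andP[h0 hh] hmin.
pose e := h.-1.
have eh : h = e.+1 by rewrite prednK.
have es : e%:R ^+ 3 * D ^+ 2 < K * Lam.
  have [e0|e0] := posnP e; first by rewrite e0 expr0n mul0r.
  rewrite ltNge; apply/negP => H; have := hmin e; rewrite e0 H eh ltnn => /(_ isT) //.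
have e3 : 0 <= e%:R ^+ 3 :> R by rewrite exprn_ge0.
have D20 : 0 <= D ^+ 2 by exact: sqr_ge0.
have e8 : (8 * e < dl)%N.
  rewrite ltnNge; apply/negP => H.
  have : dl%:R ^+ 3 <= (8 * e%:R) ^+ 3 :> R.
    by rewrite -natrM lerXn2r ?nnegrE // ler_nat.
  rewrite exprMn => H3.
  have := ler_wpM2r D20 H3.
  have -> : 8 ^+ 3 * e%:R ^+ 3 * D ^+ 2 = 512 * (e%:R ^+ 3 * D ^+ 2) by ring.
  by move: big1 es KL0; clear; lra.
have eT : (e ^ 3 <= T ^ 2)%N.
  rewrite leqNgt; apply/negP => H.
  have : T%:R ^+ 2 <= e%:R ^+ 3 :> R by rewrite -!natrX ler_nat ltnW.
  move=> /(ler_wpM2r D20); move: big2 es; clear; lra.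
have hc : (0 < h < c)%N by move: e8 eh dlc c1 tau1; clear; lia.
have hT : (c + h <= T)%N by move: e8 eh cdl; clear; lia.
have [|||||u uin uc] := @detect_change R sigma ((2 + eps) * Lam) B T x z F tau tauh c h sigma0 _ _ sF opt hc hT _ _ _.
- by rewrite mulr_ge0; lra.
- by move=> t ht; rewrite xE // -fF //; field; rewrite gt_eqF.
- move=> t ht tc; apply/negP => tt.
  have [tlt|tgt|te] := ltngtP t c.
  + by have := changepoint_gap cp tt ct tlt; rewrite -/dl; move: ht e8 eh; clear; lia.
  + by have := changepoint_gap cp ct tt tgt; rewrite -/dl; move: ht e8 eh; clear; lia.
  + by rewrite te eqxx in tc.
- have [_ w _] := reg; apply: w; move: hT; clear; lia.
- have -> : d2 F c ^+ 2 = D ^+ 2 by rewrite /D real_normK ?num_real.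
  rewrite [ltRHS]mulrC; apply: lt_le_trans hh; rewrite B2 /K /detection_constant.
  have : 48 * (18 + 5 * eps) * Lam = 48 * (1 + 5 * ((2 + eps) * Lam) + 6 * Lam) + 48 * (2 * Lam - 1) by ring.
  by move=> ->; rewrite ltrDl; lra.
exists u, e; split=> //.
  by move: uc eh; rewrite -/c; clear; lia.
rewrite DE exprMn mulrA.
have -> : 1024 * K * sigma ^+ 2 * Lam = 1024 * (K * Lam) * sigma ^+ 2 by ring.
by rewrite ler_pM2r //; move: es KL0; clear; lra.
Qed.

(** The largest value that the error e of [localise] can take at any changepoint. It depends on the
true changepoints only, so that the windows do not depend on the noise. *)
Definition scale T tau := (\max_(n < T.+1 | (8 * n < min_spacing T tau) && (n ^ 3 <= T ^ 2)) n)%N.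

Lemma scaleP T tau : is_changepoints T tau ->
  (8 * scale T tau < min_spacing T tau)%N /\ (scale T tau ^ 3 <= T ^ 2)%N.
Proof.
move=> cp; pose P := fun n : 'I_T.+1 => ((8 * n < min_spacing T tau) && (n ^ 3 <= T ^ 2))%N.
have P0 : P ord0 by rewrite /P /= muln0 min_spacing_gt0.
have P1 : (0 < #|P|)%N by apply/card_gt0P; exists ord0; exact: P0.
have [n hn e] := eq_bigmax_cond (fun n : 'I_T.+1 => n : nat) P1.
have -> : scale T tau = n by exact: e.
by have /andP : P n by exact: hn.
Qed.

Lemma scale_ge T tau e : (8 * e < min_spacing T tau)%N -> (e ^ 3 <= T ^ 2)%N -> (e <= T)%N ->
  (e <= scale T tau)%N.
Proof.
move=> h1 h2 eT; have eT' : (e < T.+1)%N by [].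
pose P := fun n : 'I_T.+1 => ((8 * n < min_spacing T tau) && (n ^ 3 <= T ^ 2))%N.
have P1 : P (Ordinal eT') by rewrite /P /= h1 h2.
exact: (@leq_bigmax_cond _ P (fun n : 'I_T.+1 => n : nat) (Ordinal eT') P1).
Qed.

Lemma scale_window T tau c : is_changepoints T tau -> c \in tau ->
  (2 * scale T tau < c)%N && (c + 2 * scale T tau < T)%N.
Proof.
move=> cp ct; have [_ [h1 h2]] := changepoint_bounds cp ct.
by have [d8 _] := scaleP cp; move: h1 h2 d8; clear; lia.
Qed.

End localisation_of_changes.

(** * Consistency for unexceptional noise *)

Section consistency.
Context {R : realType}.
Implicit Types (T t j r q : nat) (tau tauh : seq nat) (theta f z x : nat -> R).

(** u is the difference between the almost optimal fit for [tauh] and F, and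
|F + z - g|^2 = |z|^2 - 2 <z, u> + |u|^2. *)
Lemma overfit_pays (sigma beta : R) T tau tauh F x z : 0 < sigma ->
  is_changepoints T tau -> spline T (mem tau) F ->
  (forall t, (1 <= t <= T)%N -> x t / sigma = F t + z t) ->
  is_minimiser sigma beta T x tauh ->
  exists2 u, spline T (mem (tauh ++ tau)) u &
    beta * ((size tauh)%:R - (size tau)%:R) <= 1 + (2 * ip T z u - nrm2 T u).
Proof.
move=> s0 cp sF xF [cph opt].
have [g sg gle] := cost_spline x s0 cph.
exists (fun t => g t - F t).
  move=> t ht; rewrite mem_cat negb_or => /andP[t1 t2].
  by rewrite d2B sg // sF // subrr.
have := opt tau cp; rewrite /penalised_cost => ople.
have := cost_le_spline x s0 cp sF => Fle.
have nF : nrm2 T (fun t => x t / sigma - F t) = nrm2 T z.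
  have E t : (1 <= t <= T)%N -> x t / sigma - F t = z t by move=> ht; rewrite xF //; ring.
  exact: eq_ip.
have nG : nrm2 T (fun t => x t / sigma - g t) =
    nrm2 T z - 2 * ip T z (fun t => g t - F t) + nrm2 T (fun t => g t - F t).
  rewrite -nrm2B.
  have E t : (1 <= t <= T)%N -> x t / sigma - g t = z t - (g t - F t).
    by move=> ht; rewrite xF //; ring.
  exact: eq_ip.
rewrite nF in Fle; rewrite nG in gle.
rewrite mulrBr; move: gle Fle ople.
move: (ip T z _) (nrm2 T z) (nrm2 T (fun t => g t - F t)) (cost _ _ _ tauh) (cost _ _ _ tau).
by move=> a b c d e; clear; lra.
Qed.

Lemma size_changepoints T tau : is_changepoints T tau -> (size tau <= T)%N.
Proof.
move=> cp; rewrite -[leqRHS](size_iota 0).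
apply: uniq_leq_size; first exact: changepoints_uniq cp.
by move=> t /(mem_changepoints cp); rewrite mem_iota; lia.
Qed.

(** The u j are strictly increasing because the changepoints are further apart than twice the
errors. So they are as many as the changepoints, and if [tauh] has no more entries, then it is
the sorted list of the u j. *)
Lemma match_estimates T tau tauh (u : nat -> nat) (d : nat) :
  is_changepoints T tau -> is_changepoints T tauh -> (4 * d < min_spacing T tau)%N ->
  (forall j, (1 <= j <= size tau)%N -> u j \in tauh /\
     (knot T tau j - d <= u j <= knot T tau j + d)%N) ->
  (size tau <= size tauh)%N /\
  (size tauh = size tau -> forall j, (1 <= j <= size tau)%N -> knot T tauh j = u j).
Proof.
move=> cp cph dd hu.
pose us := [seq u j | j <- iota 1 (size tau)].
have inI j : (j \in iota 1 (size tau)) = (1 <= j <= size tau)%N by rewrite mem_iota; lia.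
have sub : {subset us <= tauh} by move=> k /mapP[j]; rewrite inI => /hu [] h _ ->.
have mono : {in iota 1 (size tau) &, {homo u : i j / (i < j)%N >-> (i < j)%N}}.
  move=> i j; rewrite !inI => hi hj ij.
  have [_ h1] := hu i hi; have [_ h2] := hu j hj.
  have := @knot_gap T tau i j cp ltac:(lia); lia.
have srt : sorted ltn us.
  apply: (homo_sorted_in mono); last exact: iota_ltn_sorted.
  by apply/allP => j.
have uus : uniq us by move: srt; rewrite ltn_sorted_uniq_leq => /andP[].
have szu : size us = size tau by rewrite size_map size_iota.
split; first by rewrite -szu; exact: uniq_leq_size.
move=> sz j hj.
have [_ eq] := uniq_min_size uus sub ltac:(by rewrite szu sz).
have srth : sorted ltn tauh by move: cph; rewrite is_changepointsE => /and3P[].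
have -> : tauh = us.
  apply: (irr_sorted_eq ltn_trans ltnn) => // k; by rewrite eq.
case: j hj => // j hj; rewrite knotE ?szu //.
rewrite (nth_map 0%N) ?size_iota // nth_iota // add1n //.
Qed.

(** The contributions add up to at most (2 + eps / 4) L k from the atoms, (eps / 8) L k from
the proportion Th, less than (eps / 8) L from the windows and 1 <= (eps / 8) L k for the slack of
the fit. Together these stay below (2 + eps) L k. *)
Lemma overfit_budget (eps Lam Th k y w p : R) :
  0 < eps -> 1 <= Lam -> 8 <= eps * Lam -> 1 <= k -> 0 <= Th -> Th <= 1 / 8 ->
  Th * (8 * (14 + eps)) <= eps ->
  y <= (eps / 8 * Lam + (2 + eps / 8) * Lam * k) * (1 + 4 * Th) ->
  w < eps / 8 * Lam -> p <= w + y + Th * (6 * Lam) ->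
  (2 + eps) * Lam * k <= 1 + p -> False.
Proof.
move=> eps0 L1 L8 k1 Th0 Th8 Thle H2 win H pay.
have Lk : Lam <= Lam * k by rewrite ler_peMr //; lra.
have e1 : eps / 8 * Lam + (2 + eps / 8) * Lam * k <= (2 + eps / 4) * (Lam * k).
  have : eps / 8 * Lam <= eps / 8 * (Lam * k) by rewrite ler_wpM2l //; lra.
  lra.
have t4 : 0 <= 1 + 4 * Th by lra.
have H3 := ler_wpM2r t4 e1.
have H4 : Th * (6 * Lam) <= 6 * Th * (Lam * k).
  have : Th * Lam <= Th * (Lam * k) by rewrite ler_wpM2l.
  lra.
have H5 : 1 <= eps / 8 * (Lam * k).
  have : eps / 8 * Lam <= eps / 8 * (Lam * k) by rewrite ler_wpM2l //; lra.
  lra.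
have Lk0 : 0 < Lam * k by lra.
have H6 : (14 * Th + eps * Th) * (Lam * k) <= eps / 8 * (Lam * k).
  by rewrite ler_wpM2r ?(ltW Lk0) //; lra.
have H7 : eps / 8 * Lam <= eps / 8 * (Lam * k) by rewrite ler_wpM2l //; lra.
have : 0 < eps * (Lam * k) by rewrite mulr_gt0.
nra.
Qed.

(** [localise] provides an estimate near each changepoint, at distances bounded by [scale]. So
there are at least as many estimated as true changepoints; if there were more,
[overfit_bound] and [overfit_pays] would contradict each other by [overfit_budget]. When the
numbers agree, [match_estimates] identifies the estimates. *)
Lemma consistent_estimate (eps sigma Lam B : R) T r q tau tauh theta f z x :
  0 < eps -> 0 < sigma -> 1 <= Lam -> 8 <= eps * Lam -> 0 <= B -> B ^+ 2 = 6 * Lam ->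
  (0 < q <= r)%N -> (size tau)%:R * (5 * (q%:R / r%:R)) <= eps / (8 * (14 + eps)) ->
  is_changepoints T tau -> (1 < knot T tau 1)%N -> is_signal T tau theta f ->
  (forall t, (1 <= t <= T)%N -> x t = f t + sigma * z t) ->
  1024 * detection_constant eps * sigma ^+ 2 * Lam <=
    (min_spacing T tau)%:R ^+ 3 * min_jump T tau theta ^+ 2 ->
  detection_constant eps * sigma ^+ 2 * Lam / T%:R ^+ 2 <= min_jump T tau theta ^+ 2 ->
  is_minimiser sigma ((2 + eps) * Lam) T x tauh ->
  regular T r B z ->
  \sum_(c <- tau) 504 / ((scale T tau)%:R + 1) * window_form c (scale T tau) z < eps / 8 * Lam ->
  (forall l, {subset l <= atoms T (scale T tau) r q tau} -> (size l <= 3 * T)%N ->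
     forall g, spline T (mem (knots_of l ++ fixed_knots (scale T tau) tau)) g ->
     2 * ip T z g - nrm2 T g <= eps / 8 * Lam + (2 + eps / 8) * Lam * total_level l) ->
  size tauh = size tau /\
  max_error T tau theta tauh <= 1024 * detection_constant eps * sigma ^+ 2 * Lam.
Proof.
move=> eps0 s0 L1 L8 B0 B2 /andP[q0 qr] Thle cp tau1 sig xE sp jl opt reg win chi.
have loc := fun j hj => @localise R eps sigma Lam B T r tau tauh theta f z x j
  eps0 s0 L1 B0 B2 cp tau1 sig xE sp jl reg opt hj.
have [cph _] := opt.
set d := scale T tau in win chi.
have [d8 d3] : (8 * d < min_spacing T tau)%N /\ (d ^ 3 <= T ^ 2)%N := scaleP cp.
have d4 : (4 * d < min_spacing T tau)%N by move: d8; clear; lia.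
have near j : exists u : nat, (1 <= j <= size tau)%N -> [/\ u \in tauh,
    (knot T tau j - d <= u <= knot T tau j + d)%N &
    `|u%:R - (knot T tau j)%:R| ^+ 3 * jump T tau theta j ^+ 2 <=
      1024 * detection_constant eps * sigma ^+ 2 * Lam].
  have [hj|nj] := boolP (1 <= j <= size tau)%N; last by exists 0%N.
  have [u [e [uin ue e8 e3 eb]]] := loc j hj.
  exists u => _.
  have [_ [b0 b1]] := changepoint_bounds cp (knot_mem T hj).
  have eT : (e <= T)%N.
    by move: e8 b0 b1; clear; lia.
  have ed : (e <= d)%N by exact: scale_ge.
  split=> //; first by move: ue ed; rewrite -/d; clear; lia.
  apply: le_trans eb; rewrite ler_wpM2r ?sqr_ge0 // lerXn2r ?nnegrE //.
  rewrite ler_norml; apply/andP; split.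
    by rewrite lerBrDl lerBlDr -natrD ler_nat; move: ue; clear; lia.
  by rewrite lerBlDl -natrD ler_nat; move: ue; clear; lia.
have {near}[u hu] := choice near.
have [szle match_] := @match_estimates T tau tauh u d cp cph d4
  (fun j hj => let: And3 a b _ := hu j hj in conj a b).
have K0 : 0 <= 1024 * detection_constant eps * sigma ^+ 2 * Lam.
  have Kd : 0 <= detection_constant eps by rewrite /detection_constant; move: eps0; clear; lra.
  have Lm : 0 <= Lam by move: L1; clear; lra.
  exact: mulr_ge0 (mulr_ge0 (mulr_ge0 (ler0n _ _) Kd) (sqr_ge0 _)) Lm.
suff sz : size tauh = size tau.
  split=> //; apply: max_error_le => // j hj.
  by rewrite (match_ sz j hj); have [] := hu j hj.
apply/eqP; rewrite eqn_leq szle andbT leqNgt; apply/negP => more.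
have [F [sF fF _]] := signal_spline s0 cp sig.
have xF t : (1 <= t <= T)%N -> x t / sigma = F t + z t.
  by move=> ht; rewrite xE // -fF //; field; rewrite gt_eqF.
have [v sv pay] := overfit_pays s0 cp sF xF opt.
have tau_in c : c \in tau -> (2 * d < c)%N && (c + 2 * d < T)%N by exact: scale_window.
have tau_sep c c' : c \in tau -> c' \in tau -> (c < c')%N -> (c + 4 * d < c')%N.
  by move=> h1 h2 h3; have := changepoint_gap cp h1 h2 h3; move: d8; clear; lia.
have khat_near c : c \in tau -> exists2 w, w \in tauh & (c - d <= w <= c + d)%N.
  by move=> /(@mem_knot T) [j hj <-]; have [h1 h2 _] := hu j hj; exists (u j).
pose Th : R := (size tau)%:R * (5 * (q%:R / r%:R)).
have Th0 : 0 <= Th by rewrite !mulr_ge0 ?invr_ge0.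
have den : 0 < 8 * (14 + eps) by move: eps0; clear; lra.
rewrite -/Th ler_pdivlMr // in Thle.
have Th8 : Th <= 1 / 8 by move: Th0 Thle eps0; clearbody Th; clear; nra.
have hint a w : (a <= w <= T)%N -> `|ip T z (hat r a w)| <= B * nrm T (hat r a w).
  by move=> h; have [_ _ hh] := reg; rewrite ipC; apply: hh; move: h; clear; lia.
have szT := size_changepoints cph.
have := @overfit_bound R T d r q tau (changepoints_uniq cp) tau_in tau_sep q0 qr tauh
  (changepoints_uniq cph) (fun k => @mem_changepoints T tauh k cph) khat_near v z B
  (eps / 8 * Lam) ((2 + eps / 8) * Lam) (3 * T) sv B0 hint.
move=> /(_ _ _ _ chi) H.
have Lm : 0 <= Lam by move: L1; clear; lra.
have e8 : 0 <= eps / 8 by move: eps0; clear; lra.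
have x00 := mulr_ge0 e8 Lm.
have x10 := mulr_ge0 (addr_ge0 (ler0n R 2) e8) Lm.
have szT3 : (3 * size tauh <= 3 * T)%N by rewrite leq_mul2l szT orbT.
have Th1 : Th < 1 by move: Th8; clear; lra.
have {}H := H x00 x10 szT3 Th1.
rewrite -/Th in H.
have ratio : (1 + Th) ^+ 2 / (1 - Th) <= 1 + 4 * Th.
  have T1 : 0 < 1 - Th by move: Th8; clear; lra.
  by rewrite ler_pdivrMr //; move: Th0 Th8; clear; nra.
pose k : R := (size tauh)%:R - (size tau)%:R.
have k1 : 1 <= k by rewrite /k lerBrDl natr1 ler_nat.
rewrite -/k in H pay; rewrite B2 in H.
have Y0 : 0 <= eps / 8 * Lam + (2 + eps / 8) * Lam * k.
  have k0 : 0 <= k by move: k1; clear; lra.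
  exact: addr_ge0 x00 (mulr_ge0 x10 k0).
have H2 := ler_wpM2l Y0 ratio.
exact: overfit_budget eps0 L1 L8 k1 Th0 Th8 Thle H2 win H pay.
Qed.

End consistency.

(** * Thresholds for large T *)

Section asymptotics.
Context {R : realType}.
Implicit Types (T d r q m n : nat) (tau : seq nat) (C K L X kap th eta : R).

(** From (y / 3)^3 <= exp y. *)
Lemma exp_absorbs_square K kap eta : 0 <= K -> 0 < kap -> 0 < eta ->
  exists L0, forall L, L0 <= L -> K * L ^+ 2 * expR (- (kap * L)) <= eta.
Proof.
move=> K0 k0 e0; exists (27 * K / (eta * kap ^+ 3)) => L hL.
have k3 : 0 < eta * kap ^+ 3 by rewrite mulr_gt0 // exprn_gt0.
have L0 : 0 <= L by apply: le_trans hL; rewrite divr_ge0 ?(ltW k3) // mulr_ge0 ?ler0n.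
rewrite expRN ler_pdivrMr ?expR_gt0 //.
rewrite ler_pdivrMr // in hL.
have y0 : 0 <= kap * L / 3 by rewrite divr_ge0 ?ler0n // mulr_ge0 // ltW.
have H : (kap * L / 3) ^+ 3 <= expR (kap * L).
  have -> : expR (kap * L) = expR (kap * L / 3) ^+ 3.
    by rewrite -expRM_natl; congr expR; field.
  apply: lerXn2r; rewrite ?nnegrE ?expR_ge0 //.
  by apply: le_trans (expR_ge1Dx _); rewrite lerDr ler01.
apply: le_trans (ler_wpM2l (ltW e0) H).
have L2 : 0 <= L ^+ 2 by exact: sqr_ge0.
have {hL} := ler_wpM2r L2 hL.
have -> : L * (eta * kap ^+ 3) * L ^+ 2 = 27 * (eta * (kap * L / 3) ^+ 3) by field.
have -> : 27 * K * L ^+ 2 = 27 * (K * L ^+ 2) by ring.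
by rewrite ler_pM2l // ltr0n.
Qed.

Lemma ln_nat_large L : \forall T \near \oo, L <= ln (T%:R : R).
Proof.
exists (Num.truncn (expR L)).+1 => // T /= hT.
rewrite -[leLHS]expRK ler_ln ?posrE ?expR_gt0 //.
  apply/ltW; apply: lt_le_trans (truncnS_gt _) _.
  by rewrite ler_nat.
by rewrite ltr0n; apply: leq_trans hT.
Qed.

Lemma cube_root_exists T : exists r, (r ^ 3 <= T < r.+1 ^ 3)%N.
Proof.
have ex : exists n, (T < n.+1 ^ 3)%N.
  by exists T; rewrite -[X in (X <= _)%N]expn1; exact: leq_pexp2l.
case: (ex_minnP ex) => n hn hmin; exists n; rewrite hn andbT.
case: n hn hmin => [//|n] _ hmin.
by rewrite leqNgt; apply/negP => /hmin; rewrite ltnn.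
Qed.

Lemma sum_atom_weight C y lam (A : seq (R * seq nat)) :
  (forall a, a \in A -> a.1 = lam) ->
  \sum_(a <- A) atom_weight C y a = C ^+ 2 * ((size A)%:R * expR (- (y * lam))).
Proof.
move=> h; rewrite (@eq_big_seq _ _ _ _ _ _ (fun=> C ^+ 2 * expR (- (y * lam)))).
  by rewrite big_const_seq count_predT iter_addr_0 -mulrnAr mulr_natl.
by move=> a /h e; rewrite /atom_weight e.
Qed.

Lemma cube_le_exp (a L : R) : 0 <= a -> a ^+ 3 <= expR L -> a <= expR (L / 3).
Proof.
move=> a0; have -> : expR L = expR (L / 3) ^+ 3.
  by rewrite -expRM_natl; congr expR; field.
by rewrite ler_pXn2r // nnegrE ?expR_ge0.
Qed.

Lemma cube_root_bounds T r L : 1 <= L -> T%:R = expR L -> (r ^ 3 <= T < r.+1 ^ 3)%N ->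
  [/\ 1 <= r%:R :> R, r%:R <= expR (L / 3) & expR (L / 3) <= 2 * r%:R].
Proof.
move=> L1 TL /andP[rT Tr]; set X := expR (L / 3).
have X1 : 1 <= X by rewrite -expR0 ler_expR; move: L1; clear; lra.
have TX : T%:R = X ^+ 3 by rewrite TL -expRM_natl; congr expR; field.
have Xr : X <= r%:R + 1.
  rewrite natr1 -(@ler_pXn2r _ 3) ?nnegrE ?expR_ge0 ?ler0n //.
  by rewrite -TX -natrX ler_nat ltnW.
have r1 : 1 <= r%:R :> R.
  have : 1 <= T%:R :> R by rewrite TX exprn_ege1.
  rewrite !(ler_nat R 1) lt0n => T1; rewrite lt0n; apply/eqP => r0.
  by move: Tr T1; rewrite r0 exp1n; case: (T).
split=> //; first by apply: cube_le_exp => //; rewrite -TL -natrX ler_nat.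
by move: Xr r1; clear; lra.
Qed.

(** Atoms of level l number at most a power of L times T^l, and their weight is T^(- l) times
exp (- l kap L), which tends to 0 faster than any power of L grows. The number of grid points is
controlled through d / q <= T^(2/3) / q, where q is at least r th / (10 m) and r is close to the
cube root of T. *)
Lemma atoms_weight_le T d r q tau C th kap L :
  0 < kap -> 0 < th -> 1 <= L -> T%:R = expR L ->
  (d ^ 3 <= T ^ 2)%N -> (r ^ 3 <= T < r.+1 ^ 3)%N -> (0 < q)%N ->
  (1 <= size tau)%N -> (size tau)%:R <= L -> r%:R * th <= 10 * (size tau)%:R * q%:R ->
  \sum_(a <- atoms T d r q tau) atom_weight C ((1 + kap) * L) a <=
    C ^+ 2 * (26 + 80 / th) * L ^+ 2 * expR (- (kap / 3 * L)).
Proof.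
move=> k0 th0 L1 TL dT /andP[rT Tr] q0 m1 mL rq.
pose X := expR (L / 3); pose Z := expR (- (kap / 3 * L)).
set m : R := (size tau)%:R in mL rq *.
have m1' : 1 <= m by rewrite /m (ler_nat R 1).
have X1 : 1 <= X by rewrite -expR0 ler_expR; move: L1; clear; lra.
have X0 : 0 < X by exact: expR_gt0.
have Z0 : 0 < Z by exact: expR_gt0.
have Z1 : Z <= 1.
  by rewrite -expR0 ler_expR oppr_le0 mulr_ge0 //; move: k0 L1; clear; lra.
have TX : T%:R = X ^+ 3 by rewrite TL -expRM_natl; congr expR; field.
have dX : d%:R <= X ^+ 2.
  have -> : X ^+ 2 = expR (2 * L / 3) by rewrite -expRM_natl; congr expR; ring.
  by apply: cube_le_exp => //; rewrite expRM_natl -TL -!natrX ler_nat.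
have [r1 rX Xr] := cube_root_bounds L1 TL (introT andP (conj rT Tr)).
rewrite -/X in rX Xr.
pose Y := expR (- ((1 + kap) * L / 3)).
have Y0 : 0 < Y by exact: expR_gt0.
have XY : X * Y = Z by rewrite -expRD; congr expR; field.
have e1 : expR (- ((1 + kap) * L * 1)) = Y ^+ 3 by rewrite -expRM_natl; congr expR; field.
have e2 : expR (- ((1 + kap) * L * (2 / 3))) = Y ^+ 2 by rewrite -expRM_natl; congr expR; field.
have e3 : expR (- ((1 + kap) * L * (1 / 3))) = Y by congr expR; field.
have s1 := @sum_atom_weight C ((1 + kap) * L) 1 _ (@atom1_level R T d r tau).
have s2 := @sum_atom_weight C ((1 + kap) * L) (2 / 3) _ (@atom2_level R d tau).
have s3 := @sum_atom_weight C ((1 + kap) * L) (1 / 3) _ (@atom3_level R d r q tau).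
rewrite /atoms 2!big_cat /= [X in X + _]s1 [X in _ + (X + _)]s2 [X in _ + (_ + X)]s3.
rewrite size_atoms1 size_atoms2 size_atoms3 e1 e2 e3 -!mulrDr.
have -> : C ^+ 2 * (26 + 80 / th) * L ^+ 2 * expR (- (kap / 3 * L)) =
  C ^+ 2 * ((26 + 80 / th) * (L ^+ 2 * Z)) by rewrite /Z; ring.
apply: ler_wpM2l; first exact: sqr_ge0.
have d4 : (4 * d).+1%:R <= 5 * X ^+ 2.
  have := exprn_ege1 2 X1; rewrite -natr1 natrM; move: dX; clear; lra.
have r2 : (2 * r).+1%:R <= 3 * X by rewrite -natr1 natrM; move: rX X1; clear; lra.
have m0 : 0 <= m by exact: ler0n.
have n2 : (size tau * (4 * d).+1)%:R <= 5 * m * X ^+ 2.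
  by rewrite natrM -/m (_ : 5 * m * X ^+ 2 = m * (5 * X ^+ 2)) ?ler_wpM2l //; ring.
have n1 : (T + size tau * (4 * d).+1 * (2 * r).+1)%:R <= 16 * m * X ^+ 3.
  rewrite natrD natrM TX.
  have h1 : X ^+ 3 <= m * X ^+ 3 by rewrite ler_peMl // exprn_ge0 // ltW.
  have h2 := ler_pM (ler0n R _) (ler0n R _) n2 r2.
  apply: le_trans (lerD h1 h2) _.
  by rewrite le_eqVlt; apply/orP; left; apply/eqP; ring.
have n3 : (size tau * (2 * r).+1 + size tau * (4 * d %/ q).+2)%:R <= (5 + 80 / th) * m ^+ 2 * X.
  have q1 : 0 < q%:R :> R by rewrite ltr0n.
  have hD : (4 * d %/ q)%:R * q%:R <= 4 * X ^+ 2.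
    rewrite -natrM; apply: le_trans (_ : (4 * d)%:R <= _); first by rewrite ler_nat leq_divM.
    by rewrite natrM ler_wpM2l // ler0n.
  have hX : X * th <= 20 * m * q%:R.
    have : X * th <= 2 * (r%:R * th).
      by rewrite mulrA ler_wpM2r ?(ltW th0).
    by move: rq; move: (r%:R * th) (X * th) => a b; clear; lra.
  have hq : (4 * d %/ q)%:R <= 80 / th * m * X.
    rewrite (_ : 80 / th * m * X = 80 * m * X / th); last by ring.
    rewrite ler_pdivlMr // -(ler_pM2r q1) mulrAC.
    apply: le_trans (ler_wpM2r (ltW th0) hD) _.
    have -> : 4 * X ^+ 2 * th = (4 * X) * (X * th) by ring.
    have -> : 80 * m * X * q%:R = (4 * X) * (20 * m * q%:R) by ring.
    by rewrite ler_pM2l // mulr_gt0 ?ltr0n.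
  rewrite natrD !natrM -/m -mulrDr.
  have -> : (5 + 80 / th) * m ^+ 2 * X = m * (5 * (m * X) + 80 / th * m * X) by ring.
  have D2 n : n.+2%:R = n%:R + 2 :> R by rewrite -addn2 natrD.
  rewrite ler_wpM2l // D2.
  have mX : X <= m * X by rewrite ler_peMl // ltW.
  by move: r2 hq mX X1; move: (80 / th * m * X) => a; clear; lra.
have m2L : m ^+ 2 <= L ^+ 2 by rewrite ler_sqr ?nnegrE //; move: m1' mL; clear; lra.
have mm2 : m <= m ^+ 2 by rewrite expr2 ler_peMr //; move: m1'; clear; lra.
have thi : 0 < th^-1 by rewrite invr_gt0.
have h1 := ler_wpM2r (ltW (exprn_gt0 3 Y0)) n1.
have h2 := ler_wpM2r (ltW (exprn_gt0 2 Y0)) n2.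
have h3 := ler_wpM2r (ltW Y0) n3.
apply: le_trans (lerD h1 (lerD h2 h3)) _.
have -> : 16 * m * X ^+ 3 * Y ^+ 3 + (5 * m * X ^+ 2 * Y ^+ 2 + (5 + 80 / th) * m ^+ 2 * X * Y) =
  16 * (m * Z ^+ 3) + 5 * (m * Z ^+ 2) + (5 + 80 / th) * (m ^+ 2 * Z) by rewrite -XY; ring.
have Z2 : Z ^+ 2 <= Z by rewrite expr2 ler_piMr // ltW.
have Z3 : Z ^+ 3 <= Z by rewrite exprS; apply: le_trans (ler_piMr (ltW Z0) _) _ => //; exact: le_trans Z1.
have L20 : 0 <= L ^+ 2 by exact: sqr_ge0.
have k1 : m * Z ^+ 3 <= L ^+ 2 * Z.
  by apply: ler_pM => //; [rewrite exprn_ge0 // ltW|exact: le_trans m2L].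
have k2 : m * Z ^+ 2 <= L ^+ 2 * Z.
  by apply: ler_pM => //; [rewrite exprn_ge0 // ltW|exact: le_trans m2L].
have k3 : m ^+ 2 * Z <= L ^+ 2 * Z by rewrite ler_wpM2r // ltW.
have c0 : 0 <= 5 + 80 / th by rewrite addr_ge0 ?ler0n // mulr_ge0 ?ler0n // ltW.
have k4 := ler_wpM2l c0 k3.
have -> : (26 + 80 / th) * (L ^+ 2 * Z) =
  16 * (L ^+ 2 * Z) + 5 * (L ^+ 2 * Z) + (5 + 80 / th) * (L ^+ 2 * Z) by ring.
by rewrite !lerD // ler_wpM2l // ler0n.
Qed.

End asymptotics.

Section bad_events.
Context {R : realType}.
Implicit Types (T d r q m n : nat) (tau : seq nat) (C L th eta : R).

(** q is the integer part of r th / (5 m). *)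
Lemma grid_exists T m th L : 0 < th -> th <= 1 -> (0 < m)%N -> 1 <= L -> T%:R = expR L ->
  20 * m%:R <= th * expR (L / 3) ->
  exists r q, [/\ (r ^ 3 <= T < r.+1 ^ 3)%N, (0 < q <= r)%N,
    m%:R * (5 * (q%:R / r%:R)) <= th & r%:R * th <= 10 * m%:R * q%:R].
Proof.
move=> th0 th1 m0 L1 TL mX.
have [r /andP[rT Tr]] := cube_root_exists T; exists r.
have m1 : 1 <= m%:R :> R by rewrite (ler_nat R 1).
pose X := expR (L / 3).
have [r1 _ Xr2] := cube_root_bounds L1 TL (introT andP (conj rT Tr)).
rewrite -/X in mX Xr2.
pose x : R := r%:R * th / (5 * m%:R).
have m5 : 0 < 5 * m%:R :> R by rewrite mulr_gt0 ?ltr0n.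
have x2 : 2 <= x.
  rewrite ler_pdivlMr //.
  have := ler_wpM2l (ltW th0) Xr2; rewrite (mulrC r%:R th) mulrCA.
  by move: mX; move: (th * r%:R) (th * X) => a b; clear; lra.
have x0 : 0 <= x by move: x2; clear; lra.
have xr : x <= r%:R.
  rewrite ler_pdivrMr //; apply: ler_wpM2l; first exact: ler0n.
  by move: th1 m1; clear; lra.
have qx : (Num.truncn x)%:R <= x by rewrite truncn_le.
have xq : x < (Num.truncn x)%:R + 1 by rewrite natr1; exact: truncnS_gt.
exists (Num.truncn x); move: (Num.truncn x) qx xq => q qx xq.
have r0 : 0 < r%:R :> R by move: r1; clear; lra.
have xE : x * (5 * m%:R) = r%:R * th by rewrite /x divfK // gt_eqF.
split.
- by rewrite rT.
- apply/andP; split; last by rewrite -(ler_nat R); exact: le_trans xr.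
  by rewrite -(ltr_nat R); move: xq x2; clear; lra.
- have -> : m%:R * (5 * (q%:R / r%:R)) = q%:R * (5 * m%:R) / r%:R :> R by ring.
  by rewrite ler_pdivrMr // (mulrC th) -xE ler_wpM2r // ltW.
- rewrite -xE (_ : 10 * m%:R * q%:R = 2 * q%:R * (5 * m%:R)); last by ring.
  by rewrite ler_wpM2r ?(ltW m5) //; move: xq x2; clear; lra.
Qed.

(** The parameters are B^2 = 6 L, for which the irregular noise has probability of order
T^2 exp (- 3 L) = 1 / T; s < 1 with s (2 + eps / 8) / 2 = 1 + eps / 32, so that the atoms have
total weight at most 1 / 2 while the sums over the lattice stay bounded; and a bound eta0 L on
the number of changepoints, where eta0 is small enough for the windows to contribute less than
(eps / 8) L, and for C^(5 m) not to outweigh exp (- s eps L / 16). *)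
Lemma rare_bad_noise (eps eta : R) : 0 < eps -> 0 < eta -> exists L0 eta0 : R, 0 < eta0 /\
  forall T tau, let L := ln T%:R in L0 <= L -> is_changepoints T tau -> (0 < size tau)%N ->
  (size tau)%:R <= eta0 * L -> exists r q E,
  [/\ rare T eta E, (0 < q <= r)%N,
    (size tau)%:R * (5 * (q%:R / r%:R)) <= eps / (8 * (14 + eps)) &
    forall z, ~ E z -> [/\ regular T r (Num.sqrt (6 * L)) z,
      \sum_(c <- tau) 504 / ((scale T tau)%:R + 1) * window_form c (scale T tau) z < eps / 8 * L &
      forall l, {subset l <= atoms T (scale T tau) r q tau} -> (size l <= 3 * T)%N ->
        forall g, spline T (mem (knots_of l ++ fixed_knots (scale T tau) tau)) g ->
        2 * ip T z g - nrm2 T g <= eps / 8 * L + (2 + eps / 8) * L * total_level l]].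
Proof.
move=> e0 eta0.
pose th := eps / (8 * (14 + eps)).
have den : 0 < 8 * (14 + eps) by move: e0; clear; lra.
have th0 : 0 < th by rewrite divr_gt0.
have th1 : th <= 1 by rewrite ler_pdivrMr // mul1r; move: e0; clear; lra.
pose s := (1 + eps / 32) / (1 + eps / 16).
have den2 : 0 < 1 + eps / 16 by move: e0; clear; lra.
have s0 : 0 < s by rewrite divr_gt0 //; move: e0; clear; lra.
have s1 : s < 1 by rewrite ltr_pdivrMr // mul1r; move: e0; clear; lra.
have sx L : s * ((2 + eps / 8) * L) / 2 = (1 + eps / 32) * L.
  have -> : 2 + eps / 8 = 2 * (1 + eps / 16) by field.
  by rewrite /s; field; rewrite gt_eqF //; move: e0; clear; lra.
pose Q := s * (1 - s) / 2.
have Q0 : 0 < Q by rewrite divr_gt0 // mulr_gt0 // subr_gt0.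
pose C := 1 + expR (s / 2) * (2 / (1 - expR (- Q))).
have CQ : 0 <= expR (s / 2) * (2 / (1 - expR (- Q))).
  by rewrite mulr_ge0 ?expR_ge0 // divr_ge0 ?ler0n // subr_ge0 ltW // expR_lt1 oppr_lt0.
have C1 : 1 <= C by rewrite /C lerDl.
have C0 : 0 < C by apply: lt_le_trans C1.
have c0 : 0 <= ln C by rewrite ln_ge0.
have C20 : 0 <= C ^+ 2 by exact: sqr_ge0.
have eta3 : 0 < eta / 3 by rewrite divr_gt0.
have ek : 0 < eps / 32 by apply: divr_gt0 => //; rewrite ltr0n.
have ki : 0 < eps / 32 / 3 by move: e0; clear; lra.
have kj : 0 < s * eps / 32 by apply: divr_gt0; [exact: mulr_gt0|rewrite ltr0n].
have tt : 0 <= 26 + 80 / th by rewrite addr_ge0 ?ler0n // divr_ge0 ?ler0n // ltW.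
have [La ha] := @exp_absorbs_square R 24 1 (eta / 3) (ler0n _ _) ltr01 eta3.
have [Lb hb] := @exp_absorbs_square R 20 (1 / 3) th (ler0n _ _) ltac:(by rewrite divr_gt0) th0.
have [Lc hc] := @exp_absorbs_square R (C ^+ 2 * (26 + 80 / th)) (eps / 32 / 3) (1 / 2)
  (mulr_ge0 C20 tt) ki ltac:(by rewrite divr_gt0).
have [Ld hd] := @exp_absorbs_square R (2 * C ^+ 2) (s * eps / 32) (eta / 3)
  (mulr_ge0 (ler0n _ _) C20) kj eta3.
have [Le he] := @exp_absorbs_square R 6 1 1 (ler0n _ _) ltr01 ltr01.
pose e2 := eta / 3 * (eps / 8) / (504 * 640).
pose e3 := s * eps / 32 / (5 * (1 + ln C)).
have e20 : 0 < e2.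
  by apply: divr_gt0; [apply: mulr_gt0 => //; apply: divr_gt0 => //; rewrite ltr0n
                      |apply: mulr_gt0; rewrite ltr0n].
have e30 : 0 < e3.
  by apply: divr_gt0 => //; apply: mulr_gt0; [by rewrite ltr0n|move: c0; clear; lra].
exists (Num.max 1 (Num.max La (Num.max Lb (Num.max Lc (Num.max Ld Le))))).
exists (Num.min 1 (Num.min e2 e3)); split; first by rewrite !lt_min ltr01 e20 e30.
move=> T tau L; rewrite !ge_max => /and5P[L1 /ha{}ha /hb{}hb /hc{}hc /andP[/hd{}hd /he{}he]] cp m1 msm.
have Lp : 0 < L by apply: lt_le_trans L1.
have T0 : (0 < T)%N by rewrite lt0n; apply/eqP => T0; move: Lp; rewrite /L T0 ln0 ?ltxx.
have TL : T%:R = expR L by rewrite /L lnK // posrE ltr0n.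
have [mL m2 m3] : [/\ (size tau)%:R <= L, (size tau)%:R <= e2 * L & (size tau)%:R <= e3 * L].
  have mn (a b c : R) : [/\ Num.min a (Num.min b c) <= a, Num.min a (Num.min b c) <= b &
      Num.min a (Num.min b c) <= c] by rewrite !ge_min !lexx !orbT.
  have [n1 n2 n3] := mn 1 e2 e3.
  have h (a : R) (na : Num.min 1 (Num.min e2 e3) <= a) := le_trans msm (ler_wpM2r (ltW Lp) na).
  by have := h _ n1; rewrite mul1r => h1; split; [exact: h1|exact: h _ n2|exact: h _ n3].
have LL : L <= L ^+ 2 by rewrite expr2 ler_peMr // ltW.
have mX : 20 * (size tau)%:R <= th * expR (L / 3).
  have : 20 * L ^+ 2 <= th * expR (L / 3).
    by move: hb; rewrite expRN mul1r (mulrC _ L) ler_pdivrMr ?expR_gt0.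
  by apply: le_trans; rewrite ler_wpM2l ?ler0n //; exact: le_trans LL.
have [r [q [rT qr Th rq]]] := @grid_exists T (size tau) th L th0 th1 m1 L1 TL mX.
have /andP[q0 _] := qr.
have [_ d3] := scaleP cp.
set d := scale T tau in d3 *.
have bad1 : rare T (eta / 3) (fun z => ~ regular T r (Num.sqrt (6 * L)) z).
  apply: rare_mono (@rare_irregular R T r (Num.sqrt (6 * L)) (sqrtr_ge0 _)) _ (fun z h => h).
  apply: le_trans ha.
  rewrite sqr_sqrtr; last by rewrite mulr_ge0 ?ler0n // ltW.
  have -> : 6 * L / 2 = 3 * L by field.
  have T1 : T.+1%:R <= 2 * expR L :> R.
    have : 1 <= T%:R :> R by rewrite (ler_nat R 1).
    by rewrite -natr1 -TL; clear; lra.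
  have T2 : T.+1%:R ^+ 2 <= (2 * expR L) ^+ 2 :> R.
    by apply: lerXn2r => //; rewrite nnegrE ?ler0n // mulr_ge0 ?ler0n ?expR_ge0.
  have eL : expR (- (1 * L)) = expR L ^+ 2 * expR (- (3 * L)).
    by rewrite -expRM_natl -expRD; congr expR; ring.
  rewrite eL mulrA; apply: ler_wpM2r; first exact: expR_ge0.
  have -> : 24 * L ^+ 2 * expR L ^+ 2 = 6 * (L ^+ 2 * (2 * expR L) ^+ 2) by ring.
  apply: ler_wpM2l; first exact: ler0n.
  apply: le_trans T2 _; rewrite ler_peMl ?sqr_ge0 //.
  exact: le_trans LL.
have bad2 : rare T (eta / 3)
    (fun z => eps / 8 * L <= \sum_(c <- tau) 504 / (d%:R + 1) * window_form c d z).
  have eL : 0 < eps / 8 * L by apply: mulr_gt0 => //; apply: divr_gt0 => //; rewrite ltr0n.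
  apply: rare_mono (@rare_windows R T d tau _ eL (fun c => @scale_window T tau c cp)) _ (fun z h => h).
  rewrite ler_pdivrMr // -ler_pdivlMr; last by apply: mulr_gt0; rewrite ltr0n.
  by apply: le_trans m2 _; rewrite /e2 le_eqVlt; apply/orP; left; apply/eqP; ring.
have W := @atoms_weight_le R T d r q tau C th (eps / 32) L ek th0 L1 TL d3 rT q0 m1 mL rq.
have {}W := le_trans W hc.
have bad3 := @rare_configurations R T d r q tau (3 * T) s C (eps / 8 * L) ((2 + eps / 8) * L)
  (ltW s0) C1.
rewrite sx in bad3.
have CS : expR (s / 2) * \sum_(k <- iota 0 (T + T).+1)
    expR (- (s * (1 - s) * (k%:R - T%:R) ^+ 2 / 2)) <= C.
  apply: le_trans (_ : _ <= expR (s / 2) * (2 / (1 - expR (- Q)))) _; last by rewrite /C lerDr.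
  apply: ler_wpM2l; first exact: expR_ge0.
  apply: le_trans (lattice_gauss_sum T Q0).
  by rewrite le_eqVlt; apply/orP; left; apply/eqP; apply: eq_bigr => k _; congr expR; rewrite /Q; ring.
have {}bad3 := bad3 CS W.
have p3 : 2 * (expR (- (s * (eps / 8 * L) / 2)) * C ^+ (size tau * 5).+2) <= eta / 3.
  apply: le_trans hd.
  have CE : C ^+ (size tau * 5) = expR ((size tau * 5)%:R * ln C).
    by rewrite expRM_natl lnK // posrE.
  have cL : (size tau * 5)%:R * ln C <= s * eps / 32 * L.
    have c1 : 0 < 5 * (1 + ln C) by apply: mulr_gt0; [rewrite ltr0n|move: c0; clear; lra].
    move: m3; rewrite /e3 mulrAC ler_pdivlMr //; apply: le_trans.
    rewrite natrM -mulrA ler_wpM2l ?ler0n // ler_wpM2l ?ler0n //.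
    by rewrite lerDr.
  have -> : 2 * C ^+ 2 * L ^+ 2 * expR (- (s * eps / 32 * L)) =
      2 * (C ^+ 2 * (L ^+ 2 * expR (- (s * eps / 32 * L)))) by ring.
  apply: ler_wpM2l; first exact: ler0n.
  have -> : C ^+ (size tau * 5).+2 = C ^+ 2 * C ^+ (size tau * 5).
    by rewrite 2!exprS expr2 mulrA.
  rewrite CE mulrCA.
  apply: ler_wpM2l => //; rewrite -expRD.
  apply: le_trans (_ : expR (- (s * eps / 32 * L)) <= _).
    rewrite ler_expR.
    have -> : s * (eps / 8 * L) / 2 = s * eps / 32 * L + s * eps / 32 * L by field.
    by move: cL; move: (_ * ln C) (s * eps / 32 * L) => a b; clear; lra.
  rewrite ler_peMl ?expR_ge0 //; exact: le_trans LL.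
have nT z : regular T r (Num.sqrt (6 * L)) z -> nrm T z <= T%:R.
  move=> reg; apply: regular_nrm reg _.
  rewrite sqr_sqrtr; last by rewrite mulr_ge0 ?ler0n // ltW.
  have : 6 * L ^+ 2 <= T%:R.
    by move: he; rewrite expRN (mul1r L) ler_pdivrMr ?expR_gt0 // mul1r TL.
  by apply: le_trans; rewrite ler_wpM2l ?ler0n.
pose E z := ~ regular T r (Num.sqrt (6 * L)) z \/
  (eps / 8 * L <= \sum_(c <- tau) 504 / (d%:R + 1) * window_form c d z \/
   (nrm T z <= T%:R /\ exists l, [/\ {subset l <= atoms T d r q tau},
       (size l <= 3 * T)%N & exists2 g, spline T (mem (knots_of l ++ fixed_knots d tau)) g &
       eps / 8 * L + (2 + eps / 8) * L * total_level l < 2 * ip T z g - nrm2 T g])).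
exists r, q, E; split=> //.
  apply: rare_mono (rareU bad1 (rareU bad2 bad3)) _ (fun z h => h).
  by move: p3; move: (2 * (_ * _)) => a; clear; lra.
move=> z nE.
have reg : regular T r (Num.sqrt (6 * L)) z by apply: contrapT => h; apply: nE; left.
split=> //.
  by rewrite ltNge; apply/negP => h; apply: nE; right; left.
move=> l lA lN g sg; rewrite leNgt; apply/negP => h; apply: nE; right; right.
by split; [exact: nT|exists l; split=> //; exists g].
Qed.

End bad_events.

(** * Convergence in probability *)

Section success_probability.
Context d (Omega : measurableType d) {R : realType} (P : probability Omega R).

(** There are countably many values, hence the preimage is a countable union. *)
Lemma measurable_countable_preimage (U : countType) (X : Omega -> U) (A : set U) :
  (forall s, measurable [set w | X w = s]) -> measurable [set w | A (X w)].
Proof.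
move=> mX.
have -> : [set w | A (X w)] = \bigcup_s [set w | X w = s /\ A s].
  by apply/seteqP; split=> [w /= Aw|w /= [s _ /= [<-]]] //; exists (X w).
apply: countable_bigcupT_measurable => [|s]; first exact: countableP.
have [As|nAs] := pselect (A s).
  by rewrite (_ : [set w | _] = [set w | X w = s]) //; apply/seteqP; split=> w /= => [[]|].
by rewrite (_ : [set w | _] = set0) //; apply/seteqP; split=> w //= [].
Qed.

Lemma probability_unless_rare (sigma : R) T (eps : nat -> {RV P >-> R}) eta
    (E : (nat -> R) -> Prop) (S : set Omega) : 0 < sigma ->
  iid_normal_noise sigma T eps -> rare T eta E -> measurable S ->
  (forall w, ~ E (noise sigma eps w) -> S w) ->
  P S \is a fin_num /\ `|1 - fine (P S)| <= eta.
Proof.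
move=> s0 iid rE mS ES.
have [N [mN PN EN]] := rare_probability s0 iid rE.
have fS : P S \is a fin_num by exact: fin_num_measure.
have S1 : fine (P S) <= 1 by rewrite -lee_fin fineK // probability_le1.
split=> //; rewrite ger0_norm ?subr_ge0 //.
rewrite lerBlDr -lee_fin EFinD fineK //.
rewrite -(probability_setT P).
have -> : [set: Omega] = N `|` S.
  apply/seteqP; split=> // w _; have [Ew|nEw] := pselect (E (noise sigma eps w)).
    by left; exact: EN.
  by right; exact: ES.
have h := measureU2 P mN mS.
apply: le_trans h _.
by rewrite leeD2r.
Qed.

End success_probability.

(* c3 and c4 depend only on epsilon; as slopes scale with the noise, the
   thresholds are c3 sigma^2 and c4 sigma^2 (c3 and c4 when sigma = 1).
   If tau_1 = 1 then the first segment is the single time t = 1, where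
   f_1 = theta_1: theta_0 is not observed and the change at time 1 cannot be
   detected. This is why tau_1 > 1 is required. *)
Theorem corollary3p2 (R : realType) (epsilon : R) (hepsilon : 0 < epsilon) :
  exists c3 c4 : R, [/\ 0 < c3, 0 < c4 &
    forall (sigma : R) (hsigma : 0 < sigma)
      (d : nat -> measure_display)
      (Omega : forall T : nat, measurableType (d T))
      (P : forall T : nat, probability (Omega T) R)
      (eps : forall T : nat, nat -> {RV (P T) >-> R})
      (tau : nat -> seq nat) (theta : nat -> nat -> R) (f : nat -> nat -> R)
      (tauh : forall T : nat, Omega T -> seq nat)
      (hnoise : \forall T \near \oo, iid_normal_noise sigma T (eps T))
      (htau : \forall T \near \oo, is_changepoints T (tau T))
      (hm : \forall T \near \oo, (1 <= size (tau T))%N)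
      (hf : \forall T \near \oo, is_signal T (tau T) (theta T) (f T))
      (htau1 : \forall T \near \oo, (1 < knot T (tau T) 1)%N)
      (htauh_measurable : \forall T \near \oo, forall s : seq nat,
         measurable [set w : Omega T | tauh T w = s])
      (htauh : \forall T \near \oo, forall w : Omega T,
         is_minimiser sigma ((2 + epsilon) * ln T%:R) T
           (fun t : nat => f T t + eps T t w) (tauh T w))
      (hm_small : (fun T : nat => (size (tau T))%:R : R^o)
                  =o_\oo (fun T : nat => ln (T%:R : R) : R^o))
      (hspacing : \forall T \near \oo,
         c3 * sigma ^+ 2 * ln T%:R <=
         (min_spacing T (tau T))%:R ^+ 3 *
         min_jump T (tau T) (theta T) ^+ 2)
      (hjump : \forall T \near \oo,
         c4 * sigma ^+ 2 * ln T%:R / T%:R ^+ 2 <=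
         min_jump T (tau T) (theta T) ^+ 2),
      (fun T : nat => P T [set w : Omega T |
         size (tauh T w) = size (tau T) /\
         max_error T (tau T) (theta T) (tauh T w) <=
           c3 * sigma ^+ 2 * ln T%:R])
        @ \oo --> 1%E].
Proof.
pose K := detection_constant epsilon.
have K0 : 0 < K by rewrite /K /detection_constant; move: hepsilon; clear; lra.
exists (1024 * K), K; split; [by apply: mulr_gt0; first rewrite ltr0n|exact: K0|].
move=> sigma s0 d Omega P eps tau theta f tauh hnoise htau hm hf htau1 hmeas hmin hsmall hsp hjump.
pose S T := [set w : Omega T | size (tauh T w) = size (tau T) /\
         max_error T (tau T) (theta T) (tauh T w) <=
           1024 * K * sigma ^+ 2 * ln T%:R].
suff main (eta : R) : 0 < eta ->
    \forall T \near \oo, P T (S T) \is a fin_num /\ `|1 - fine (P T (S T))| <= eta.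
  apply/fine_cvgP; split.
    by apply: filterS (main 1 ltr01) => T [].
  by apply/cvgrPdist_le => eta e0; apply: filterS (main eta e0) => T [].
move=> eta0.
have [L0 [eta1 [e10 good]]] := rare_bad_noise hepsilon eta0.
have small : \forall T \near \oo, (size (tau T))%:R <= eta1 * ln (T%:R : R).
  have /eqoP/(_ eta1 e10) := hsmall.
  apply: filter_app; apply: filterS (@ln_nat_large R 0) => T lnT.
  by rewrite !ger0_norm.
near=> T.
have cp : is_changepoints T (tau T) by near: T.
have L1 : 1 <= ln (T%:R : R) by near: T; exact: ln_nat_large.
have L8 : 8 / epsilon <= ln (T%:R : R) by near: T; exact: ln_nat_large.
have LL : L0 <= ln (T%:R : R) by near: T; exact: ln_nat_large.
have m1 : (0 < size (tau T))%N by near: T.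
have msm : (size (tau T))%:R <= eta1 * ln (T%:R : R) by near: T.
have [r [q [E [rE qr Th ok]]]] := good T (tau T) LL cp m1 msm.
have iid : iid_normal_noise sigma T (eps T) by near: T.
have mS : measurable (S T).
  apply: (@measurable_countable_preimage _ _ _ (tauh T) [set s | size s = size (tau T) /\
    max_error T (tau T) (theta T) s <= 1024 * K * sigma ^+ 2 * ln T%:R]).
  by near: T.
suff ES w : ~ E (noise sigma (eps T) w) -> S T w.
  exact: (probability_unless_rare s0 iid rE mS ES).
move=> nE.
have [reg win chi] := ok _ nE.
have L6 : 0 <= 6 * ln (T%:R : R) by apply: mulr_ge0; [exact: ler0n|exact: le_trans L1].
have B2 : Num.sqrt (6 * ln (T%:R : R)) ^+ 2 = 6 * ln T%:R by exact: sqr_sqrtr.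
apply: (@consistent_estimate R epsilon sigma (ln T%:R) (Num.sqrt (6 * ln T%:R)) T r q (tau T)
  (tauh T w) (theta T) (f T) (noise sigma (eps T) w) (fun t => f T t + eps T t w)).
- exact: hepsilon.
- exact: s0.
- exact: L1.
- by move: L8; rewrite ler_pdivrMr // mulrC.
- exact: sqrtr_ge0.
- exact: B2.
- exact: qr.
- exact: Th.
- exact: cp.
- by near: T.
- by near: T.
- by move=> t _; rewrite /noise mulrC divfK // gt_eqF.
- by near: T.
- by near: T.
- by move: w {nE reg win chi}; near: T.
- exact: reg.
- exact: win.
- exact: chi.
Unshelve. all: by end_near.
Qed.
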